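(* Given a finite multi-graph $G$ and an integer $\Delta$, the problem of finding a tree $T$ of maximum degree $\Delta$ together with a bijection $\varphi:V(G)\to V_L(T)$ minimizing $L(T,\varphi,G)$ (the Minimum Routing Tree Length problem) is NP-hard.
   Context: A multi-graph is a finite undirected graph possibly with parallel edges but without loops. $V_L(T)$ denotes the set of leaves of a tree $T$, and $d_T$ its path distance. For a bijection $\varphi:V(G)\to V_L(T)$, $L(T,\varphi,G)=\sum_{\{u,v\}\in E(G)} d_T(\varphi(u),\varphi(v))$, the sum taken over all edges of $G$ counted with multiplicity. *)

(* Defs.v *)
From mathcomp Require Import all_boot all_algebra.

Set Implicit Arguments.
Unset Strict Implicit.
Unset Printing Implicit Defensive.

Import GRing.Theory.

Notation string := (seq bool) (only parsing).

(* The tape alphabet is {0, 1, blank}, and [None] is the blank.  A machine may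
   have any number of tapes, so a larger alphabet would not change which
   problems are solvable in polynomial time. *)
Notation symbol := (option bool) (only parsing).

(* A two-way infinite tape: [ltape] lists the cells to the left of the head,
   nearest first; [rtape] starts with the scanned cell.  Cells beyond the end
   of either list are blank. *)
Record tape := Tape { ltape : seq symbol; rtape : seq symbol }.

Inductive move := Left | Stay | Right.

Definition scan (t : tape) : symbol := head None (rtape t).

Definition act (a : symbol * move) (t : tape) : tape :=
  let r := behead (rtape t) in
  match a.2 with
  | Left => Tape (behead (ltape t)) (head None (ltape t) :: a.1 :: r)
  | Stay => Tape (ltape t) (a.1 :: r)
  | Right => Tape (a.1 :: ltape t) r
  end.

Definition tape_of (s : string) : tape := Tape [::] (map Some s).

Fixpoint bits (r : seq symbol) : string :=
  if r is Some b :: r' then b :: bits r' else [::].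

(* The string starting at the head and ending before the first blank. *)
Definition string_of (t : tape) : string := bits (rtape t).

(* A deterministic machine with [extra + 2] tapes: tape [ord0] is the input
   tape; tape [ord_max] is the oracle tape, which also carries the certificate
   when the machine is used as a verifier.  A state [q] is halting when
   [verdict q] is [Some true] (accept) or [Some false] (reject); a non-halting
   [q] with [query q = Some q'] calls the oracle and resumes in [q']. *)
Record machine := Machine {
  state : finType;
  extra : nat;
  start : state;
  verdict : state -> option bool;
  query : state -> option state;
  delta : state -> {ffun 'I_extra.+2 -> symbol} ->
          state * {ffun 'I_extra.+2 -> symbol * move}
}.

Record config (M : machine) := Config {
  cstate : state M;
  ctape : {ffun 'I_(extra M).+2 -> tape}
}.

(* An oracle call costs one step: the string on the oracle tape is replaced by
   the oracle's answer, with the head on its first symbol. *)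
Definition step (O : string -> string) (M : machine) (c : config M) :
    config M :=
  let: Config q t := c in
  if verdict q is Some _ then c
  else if query q is Some q' then
    Config q' [ffun i => if i == ord_max then tape_of (O (string_of (t i)))
                         else t i]
  else
    let: (q', a) := delta q [ffun i => scan (t i)] in
    Config q' [ffun i => act (a i) (t i)].

Definition init (M : machine) (x y : string) : config M :=
  Config (start M) [ffun i => if i == ord0 then tape_of x
                              else if i == ord_max then tape_of y
                              else tape_of [::]].

Definition outcome (O : string -> string) (M : machine) (x y : string)
    (t : nat) : option bool :=
  verdict (cstate (iter t (@step O M) (init M x y))).

Definition oracle_free (M : machine) : Prop := forall q : state M, query q = None.

Definition no_oracle : string -> string := fun=> [::].

Definition language := string -> Prop.

Definition NP (A : language) : Prop :=
  exists (M : machine) (p : {poly nat}),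
    [/\ oracle_free M,
        forall x y, outcome no_oracle M x y p.[size x + size y]%R <> None
      & forall x, A x <->
          exists2 y : string, (size y <= p.[size x]%R)%N &
            outcome no_oracle M x y p.[size x + size y]%R = Some true].

(* The string relations of Garey and Johnson, Computers and Intractability,
   Chapter 5: [R x y] holds when the nonempty string [y] codes a solution of
   the instance coded by [x].  The definitions below are theirs: an oracle for
   [R] answers with some solution if there is one, and [R] is NP-hard if every
   NP language reduces to it by a polynomial-time oracle machine. *)
Definition search_problem := string -> string -> Prop.

(* The empty answer means "no solution". *)
Definition solves (O : string -> string) (R : search_problem) : Prop :=
  forall x, R x (O x) \/ (forall y, ~ R x y) /\ O x = [::].

(* Polynomial-time Turing reducibility.  The machine has to work with every
   oracle that solves [R]. *)
Definition turing_reducible (A : language) (R : search_problem) : Prop :=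
  exists (M : machine) (p : {poly nat}),
    forall O, solves O R ->
    forall x, outcome O M x [::] p.[size x]%R <> None /\
      (A x <-> outcome O M x [::] p.[size x]%R = Some true).

Definition NP_hard (R : search_problem) : Prop :=
  forall A, NP A -> turing_reducible A R.

(* Each parallel edge is listed separately; the order of the list and the
   orientation of the pairs carry no meaning. *)
Record multigraph := Multigraph {
  nverts : nat;
  edges : seq ('I_nverts * 'I_nverts);
  loopless : all (fun e => e.1 != e.2) edges
}.

Section Tree.
Variables (V : finType) (e : rel V).

Definition is_tree : Prop :=
  [/\ (0 < #|V|)%N, symmetric e, irreflexive e,
      forall x y, connect e x y
    & forall c : seq V, (2 < size c)%N -> ~ ucycle e c].

Definition degree (x : V) : nat := #|[set y | e x y]|.

Definition max_degree : nat := \max_(x : V) degree x.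

Definition leaves : {set V} := [set x | degree x == 1].

(* The least length of a path from [x] to [y]; a junk value ([#|V|]) if there
   is none. *)
Definition dist (x y : V) : nat :=
  find (fun k => [exists p : k.-tuple V, path e x p && (last x p == y)])
       (iota 0 #|V|).

End Tree.

Definition routing_tree (G : multigraph) (D N : nat) (T : rel 'I_N)
    (phi : 'I_(nverts G) -> 'I_N) : Prop :=
  [/\ is_tree T, max_degree T = D, injective phi
    & phi @: [set: 'I_(nverts G)] = leaves T].

Definition tree_length (G : multigraph) (N : nat) (T : rel 'I_N)
    (phi : 'I_(nverts G) -> 'I_N) : nat :=
  \sum_(uv <- edges G) dist T (phi uv.1) (phi uv.2).

Definition min_routing_tree (G : multigraph) (D N : nat) (T : rel 'I_N)
    (phi : 'I_(nverts G) -> 'I_N) : Prop :=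
  routing_tree D T phi /\
  forall (N' : nat) (T' : rel 'I_N') (phi' : 'I_(nverts G) -> 'I_N'),
    routing_tree D T' phi' -> (tree_length T phi <= tree_length T' phi')%N.

(* Numbers are coded in unary.  Vertex names are bounded by the number of
   vertices, and the maximum degree of a tree by its number of leaves, so this
   is polynomially equivalent to adjacency lists. *)
Definition encode (s : seq nat) : string :=
  flatten [seq rcons (nseq k true) false | k <- s].

Definition edge_names n (E : seq ('I_n * 'I_n)) : seq nat :=
  flatten [seq [:: val uv.1; val uv.2] | uv <- E].

Definition tree_edges n (T : rel 'I_n) : seq ('I_n * 'I_n) :=
  [seq uv : 'I_n * 'I_n <- enum predT | (uv.1 < uv.2)%N && T uv.1 uv.2].

Definition encode_instance (G : multigraph) (D : nat) : string :=
  encode [:: nverts G, D & edge_names (edges G)].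

Definition encode_solution n N (T : rel 'I_N) (phi : 'I_n -> 'I_N) : string :=
  encode (N :: [seq val (phi v) | v <- enum 'I_n] ++ edge_names (tree_edges T)).

Definition minimum_routing_tree_length : search_problem := fun x y =>
  exists (G : multigraph) (D N : nat) (T : rel 'I_N)
         (phi : 'I_(nverts G) -> 'I_N),
    [/\ x = encode_instance G D, y = encode_solution T phi
      & min_routing_tree D T phi].

(* Main.v *)
(* The reduction starts from an arbitrary NP machine.

   Let G contain, with a large multiplicity, all edges on 2m vertices except a
   perfect matching of "mates", and let the maximum degree be m + 1.  A leaf has
   at most m - 1 other leaves at distance 2, and all others are at distance at
   least 3; so the heavy edges are shortest exactly when the leaves split into
   two families of m siblings, mates being separated, and the double star
   reaches this.  Reading mates as complementary literals, such a tree is a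
   truth assignment, and each further edge of G costs 2, plus 1 if it joins
   literals with different values.  A triangle of such edges says that three
   literals are not all equal, so that a clause of three literals costs two
   triangles and one auxiliary variable.

   The clauses describe the computation of the NP machine, one column of cells
   being numbered relative to the heads, so that the next content of a column
   depends on three neighbouring columns and the central one.  They only push
   true facts forward (except for the guess of the certificate), so they can
   all be satisfied whatever the certificate; acceptance is rewarded by a single
   edge between True and a variable that must be false if some rejecting
   configuration is true at the end.  The machine then reads in the optimal tree
   whether these two leaves have the same parent. *)

From mathcomp Require Import all_boot all_algebra zify.
From Stdlib Require Import FunctionalExtensionality Classical.
Require Import Defs.

Set Implicit Arguments.
Unset Strict Implicit.
Unset Printing Implicit Defensive.

(** * Stack programs and their execution by oracle machines *)

(** Three scales of weight are separated. The multiplicity [W] of the heavy edges exceeds the number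
    of all other edges, so nothing gained on the latter pays for one unit lost on the former. Below
    that, a violated clause costs at least 2 more than a satisfied one, while the acceptance edge is
    worth 1: an optimal tree satisfies all clauses, and the acceptance edge alone decides. The
    oracle may answer with any optimal tree, and routing trees may contain arbitrarily many vertices
    of degree 2. The answer must still be read in polynomial time, so optimality is also shown to
    leave no inner vertices besides two adjacent centres; this is why the exact distance 3 between
    non-siblings is exploited, and not only the partition into two families. Machines are obtained
    by compiling stack programs. Apart from the input bits, every number in the instance is a
    polynomial in the input length and in loop counters, so the instance is produced by a small
    calculus of unary expressions and counting loops. *)

Definition stacks := nat -> string.

Definition upd (T : Type) (s : nat -> T) (r : nat) (v : T) : nat -> T :=
  fun i => if i == r then v else s i.

Inductive cmd :=
| Skip
| Push of nat & bool
| Pop of nat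
| Seq of cmd & cmd
| If of nat & pred (option bool) & cmd & cmd
| While of nat & pred (option bool) & cmd.

(** Costs are exactly those of the compiled machine: a push takes two steps, one to move left and
    one to write, and each test takes one. *)
Inductive exec : cmd -> stacks -> nat -> stacks -> Prop :=
| ExSkip s : exec Skip s 1 s
| ExPush s r b : exec (Push r b) s 2 (upd s r (b :: s r))
| ExPop s r : exec (Pop r) s 1 (upd s r (behead (s r)))
| ExSeq c1 c2 s s1 s2 n1 n2 :
    exec c1 s n1 s1 -> exec c2 s1 n2 s2 -> exec (Seq c1 c2) s (n1 + n2) s2
| ExIf r (P : pred (option bool)) c1 c2 s s' n :
    exec (if P (ohead (s r)) then c1 else c2) s n s' ->
    exec (If r P c1 c2) s n.+1 s'
| ExDone r (P : pred (option bool)) c s : ~~ P (ohead (s r)) -> exec (While r P c) s 1 s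
| ExLoop r (P : pred (option bool)) c s s1 s2 n1 n2 :
    P (ohead (s r)) -> exec c s n1 s1 -> exec (While r P c) s1 n2 s2 ->
    exec (While r P c) s (n1 + n2).+1 s2.

(* A stack is kept on a tape with the head on its top symbol; the cells to the
   left, once visited, have been erased. *)
Definition rep (t : tape) (s : string) : Prop :=
  exists a b, t = Tape (nseq a None) (map Some s ++ nseq b None).

Lemma rep_tape_of s : rep (tape_of s) s.
Proof. by exists 0, 0; rewrite /tape_of /= cats0. Qed.

Lemma rep_scan t s : rep t s -> scan t = ohead s.
Proof. by case=> a [b ->]; case: s => [|c s] //=; case: b. Qed.

Lemma rep_string_of t s : rep t s -> string_of t = s.
Proof.
case=> a [b ->]; rewrite /string_of /=.
by elim: s => [|c s /= -> //]; case: b.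
Qed.

Lemma rep_stay t s : rep t s -> rep (act (scan t, Stay) t) s.
Proof.
case=> a [b ->]; case: s => [|c s]; rewrite /act /scan /=; last by exists a, b.
by case: b => [|b]; [exists a, 1 | exists a, b.+1].
Qed.

Lemma rep_pop t s : rep t s -> rep (act (None, Right) t) (behead s).
Proof.
case=> a [b ->]; case: s => [|c s]; rewrite /act /=; last by exists a.+1, b.
by exists a.+1, b.-1; case: b.
Qed.

Lemma rep_push t s b : rep t s ->
  rep (act (Some b, Stay) (act (scan t, Left) t)) (b :: s).
Proof.
case=> a [e ->]; case: s => [|c s]; rewrite /act /scan /=.
- exists a.-1, (maxn e 1); case: a; case: e => //= e; by rewrite (maxn_idPl _).
- by exists a.-1, e; case: a.
Qed.

(** The program counter, as a finite type computed from the syntax; it becomes part of the state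
    space. [Push] needs two points, one per step, and a test has a point of its own. *)
Fixpoint point (c : cmd) : finType :=
  match c with
  | Push _ _ => bool
  | Seq c1 c2 => (point c1 + point c2)%type
  | If _ _ c1 c2 => (unit + (point c1 + point c2))%type
  | While _ _ c => (unit + point c)%type
  | _ => unit
  end.

Fixpoint entry (c : cmd) : point c :=
  match c with
  | Push _ _ => false
  | Seq c1 c2 => inl (entry c1)
  | If _ _ c1 c2 => inl tt
  | While _ _ c => inl tt
  | _ => tt
  end.

(* What a step does: nothing, or an action on a single tape. *)
Definition op := option (nat * (option bool -> option bool * move)).

(** Lifts a step of a subprogram: [f] embeds its control points, and [e] is the point reached when
    it exits, [None] meaning that the enclosing command exits as well. *)
Definition andthen (A B : Type) (f : A -> B) (e : option B)
    (r : option A * op) : option B * op :=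
  (if r.1 is Some a then Some (f a) else e, r.2).

Fixpoint next (c : cmd) : point c -> (nat -> option bool) ->
    option (point c) * op :=
  match c return point c -> (nat -> option bool) -> option (point c) * op with
  | Skip => fun _ _ => (None, None)
  | Push r b => fun q _ =>
      if q then (None, Some (r, fun=> (Some b, Stay)))
      else (Some true, Some (r, fun a => (a, Left)))
  | Pop r => fun _ _ => (None, Some (r, fun=> (None, Right)))
  | Seq c1 c2 => fun q v =>
      match q with
      | inl q1 => andthen inl (Some (inr (entry c2))) (next q1 v)
      | inr q2 => andthen inr None (next q2 v)
      end
  | If r P c1 c2 => fun q v =>
      match q with
      | inl _ => (Some (inr (if P (v r) then inl (entry c1)
                             else inr (entry c2))), None)
      | inr (inl q1) => andthen (fun q => inr (inl q)) None (next q1 v)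
      | inr (inr q2) => andthen (fun q => inr (inr q)) None (next q2 v)
      end
  | While r P c => fun q v =>
      match q with
      | inl _ => (if P (v r) then Some (inr (entry c)) else None, None)
      | inr q1 => andthen inr (Some (inl tt)) (next q1 v)
      end
  end.

Section Run.
Variable e : nat.
Notation tapes := {ffun 'I_e.+2 -> tape}.

(* Register 0 is the last tape, the oracle tape; register [r.+1] is tape [r]. *)
Definition tape_ix (r : nat) : 'I_e.+2 :=
  if r is r'.+1 then inord r' else ord_max.
Definition reg_ix (j : 'I_e.+2) : nat := if j == ord_max then 0 else j.+1.

Lemma reg_ixK r : r < e.+2 -> reg_ix (tape_ix r) = r.
Proof.
case: r => [|r] lt_r /=; first by rewrite /reg_ix eqxx.
rewrite /reg_ix -val_eqE /= inordK //; last by lia.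
by case: eqP => //; lia.
Qed.

Definition apply_op (o : op) (v : 'I_e.+2 -> option bool) :
    {ffun 'I_e.+2 -> option bool * move} :=
  [ffun j => if o is Some (r, f) then
               if reg_ix j == r then f (v j) else (v j, Stay)
             else (v j, Stay)].

Definition step_op (o : op) (T : tapes) : tapes :=
  [ffun j => act (apply_op o (fun j => scan (T j)) j) (T j)].

Definition scans (T : tapes) : nat -> option bool :=
  fun r => scan (T (tape_ix r)).

Definition reps (T : tapes) (s : stacks) : Prop :=
  forall j, rep (T j) (s (reg_ix j)).

Inductive runs (c : cmd) : point c -> tapes -> nat -> tapes -> Prop :=
| RunExit q T o :
    next q (scans T) = (None, o) -> runs q T 1 (step_op o T)
| RunStep q q' T o n T' :
    next q (scans T) = (Some q', o) -> runs q' (step_op o T) n T' ->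
    runs q T n.+1 T'.
Arguments runs : clear implicits.

Lemma runs_embed c c' (f : point c -> point c') q T n T' :
  (forall q v, next (f q) v = andthen f None (next q v)) ->
  runs c q T n T' -> runs c' (f q) T n T'.
Proof.
move=> Ef; elim=> {q T n T'} [q T o E|q q' T o n T' E _ IH].
  by apply: RunExit; rewrite Ef E.
by apply: RunStep IH; rewrite Ef E.
Qed.

Lemma runs_Seq1 c1 c2 q T n T' n' T'' :
  runs c1 q T n T' -> runs c2 (entry c2) T' n' T'' ->
  runs (Seq c1 c2) (inl q : point (Seq c1 c2)) T (n + n') T''.
Proof.
move=> run1 run2; elim: run1 run2 => {q T n T'}.
  move=> q T o E run2; rewrite add1n.
  apply: (RunStep (c := Seq c1 c2) (q' := inr (entry c2)) (o := o)).
    by rewrite /= E.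
  exact: (@runs_embed c2 (Seq c1 c2) inr).
move=> q q' T o n T' E _ IH run2; rewrite addSn.
apply: (RunStep (c := Seq c1 c2) (q' := inl q') (o := o)) (IH run2).
by rewrite /= E.
Qed.

Lemma runs_While r P c q T n T' n' T'' :
  runs c q T n T' -> runs (While r P c) (inl tt : point (While r P c)) T' n' T'' ->
  runs (While r P c) (inr q : point (While r P c)) T (n + n') T''.
Proof.
move=> run1 run2; elim: run1 run2 => {q T n T'}.
  move=> q T o E run2; rewrite add1n.
  apply: (RunStep (c := While r P c) (q' := inl tt) (o := o)) run2.
  by rewrite /= E.
move=> q q' T o n T' E _ IH run2; rewrite addSn.
apply: (RunStep (c := While r P c) (q' := inr q') (o := o)) (IH run2).
by rewrite /= E.
Qed.

Fixpoint fits (c : cmd) : bool :=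
  match c with
  | Skip => true
  | Push r _ | Pop r => r < e.+2
  | Seq c1 c2 => fits c1 && fits c2
  | If r _ c1 c2 => [&& r < e.+2, fits c1 & fits c2]
  | While r _ c => (r < e.+2) && fits c
  end.

Lemma reps_scan T s r : r < e.+2 -> reps T s -> scans T r = ohead (s r).
Proof. by move=> lt_r /(_ (tape_ix r)) /rep_scan; rewrite reg_ixK. Qed.

Lemma reps_none T s : reps T s -> reps (step_op None T) s.
Proof. by move=> rT j; rewrite !ffunE; apply: rep_stay. Qed.

Lemma runs_exec c s n s' T : fits c -> exec c s n s' -> reps T s ->
  exists2 T', reps T' s' & runs c (entry c) T n T'.
Proof.
move=> fit_c ex; elim: ex T fit_c => {c s n s'}.
- move=> s T _ rT; exists (step_op None T); first exact: reps_none.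
  exact: RunExit.
- move=> s r b T /= lt_r rT.
  exists (step_op (Some (r, fun=> (Some b, Stay)))
            (step_op (Some (r, fun a => (a, Left))) T)).
    move=> j; rewrite !ffunE /upd; case: eqP => [<-|_].
      exact: rep_push (rT j).
    exact: rep_stay (rep_stay (rT j)).
  by apply: (RunStep (c := Push r b) (q := false) (q' := true)) => //; apply: RunExit.
- move=> s r T /= lt_r rT; exists (step_op (Some (r, fun=> (None, Right))) T).
    move=> j; rewrite !ffunE /upd; case: eqP => [<-|_].
      exact: rep_pop (rT j).
    exact: rep_stay (rT j).
  exact: (RunExit (c := Pop r) (q := tt)).
- move=> c1 c2 s s1 s2 n1 n2 _ IH1 _ IH2 T /= /andP[fit1 fit2] rT.
  have [T1 rT1 run1] := IH1 _ fit1 rT.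
  have [T2 rT2 run2] := IH2 _ fit2 rT1.
  by exists T2 => //; apply: runs_Seq1 run2.
- move=> r P c1 c2 s s' n _ IH T /= /and3P[lt_r fit1 fit2] rT.
  have fitb : fits (if P (ohead (s r)) then c1 else c2) by case: ifP.
  have [T' rT' run1] := IH _ fitb (reps_none rT).
  exists T' => //; apply: RunStep; first by [].
  rewrite (reps_scan lt_r rT); move: run1; case: ifP => _ run1.
    by apply: (@runs_embed c1 (If r P c1 c2) (fun q => inr (inl q))).
  by apply: (@runs_embed c2 (If r P c1 c2) (fun q => inr (inr q))).
- move=> r P c s nP T /= /andP[lt_r fit1] rT.
  exists (step_op None T); first exact: reps_none.
  by apply: RunExit; rewrite /= (reps_scan lt_r rT) (negPf nP).
- move=> r P c s s1 s2 n1 n2 Ps _ IH1 _ IH2 T /= /andP[lt_r fit1] rT.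
  have [T1 rT1 run1] := IH1 _ fit1 (reps_none rT).
  have [|T2 rT2 run2] := IH2 T1 _ rT1; first by rewrite /= lt_r.
  exists T2 => //; apply: RunStep; first by rewrite /= (reps_scan lt_r rT) Ps.
  exact: runs_While run2.
Qed.

End Run.

Fixpoint regs (c : cmd) : nat :=
  match c with
  | Skip => 0
  | Push r _ | Pop r => r.+1
  | Seq c1 c2 => maxn (regs c1) (regs c2)
  | If r _ c1 c2 => maxn r.+1 (maxn (regs c1) (regs c2))
  | While r _ c => maxn r.+1 (regs c)
  end.

Lemma fits_regs e c : regs c <= e.+2 -> fits e c.
Proof.
elim: c => //=.
- by move=> c1 IH1 c2 IH2; rewrite geq_max => /andP[/IH1 -> /IH2 ->].
- move=> r _ c1 IH1 c2 IH2; rewrite !geq_max.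
  by case/and3P=> -> /IH1 -> /IH2 ->.
- by move=> r _ c IH; rewrite geq_max => /andP[-> /IH ->].
Qed.

Lemma iter_step_halted O (M : machine) (c : config M) n b :
  verdict (cstate c) = Some b -> iter n (@step O M) c = c.
Proof.
move=> vc; elim: n => //= n ->; case: c vc => q T /= vc.
by rewrite /step vc.
Qed.

(* A run that leaves register 0 nonempty is accepting. *)
Section Machine.
Variables c1 c2 : cmd.
Let e := maxn (regs c1) (regs c2).

(** Besides the control points of [c1] and [c2]: [inr None] calls the oracle, [inr (Some None)]
    inspects register 0, and [inr (Some (Some b))] has halted with verdict [b]. *)
Definition mstate : finType := (point c1 + point c2 + option (option bool))%type.

Definition mdelta (q : mstate) (v : {ffun 'I_e.+2 -> option bool}) :
    mstate * {ffun 'I_e.+2 -> option bool * move} :=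
  let w := fun r => v (tape_ix e r) in
  match q with
  | inl (inl q1) =>
      let: (q', o) := next q1 w in
      (if q' is Some q'' then inl (inl q'') else inr None, apply_op o v)
  | inl (inr q2) =>
      let: (q', o) := next q2 w in
      (if q' is Some q'' then inl (inr q'') else inr (Some None), apply_op o v)
  | inr _ => (inr (Some (Some (w 0 != None))), apply_op None v)
  end.

Definition oracle_machine : machine :=
  @Machine mstate e (inl (inl (entry c1)))
    (fun q => if q is inr (Some (Some b)) then Some b else None)
    (fun q => if q is inr None then Some (inl (inr (entry c2))) else None)
    mdelta.

Variable O : string -> string.

Let M := oracle_machine.

Lemma scansE (T : {ffun 'I_e.+2 -> tape}) :
  (fun r => [ffun i => scan (T i)] (tape_ix e r)) = scans T.
Proof. by apply: functional_extensionality => r; rewrite ffunE. Qed.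

Lemma step_opE o (T : {ffun 'I_e.+2 -> tape}) :
  [ffun i => act (apply_op o [ffun j => scan (T j)] i) (T i)] = step_op o T.
Proof. by apply/ffunP=> j; rewrite !ffunE. Qed.

Lemma iter_runs1 q T n T' : runs (c := c1) q T n T' ->
  iter n (@step O M) (@Config M (inl (inl q)) T) = @Config M (inr (None)) T'.
Proof.
elim=> {q T n T'} [q T o E|q q' T o n T' E _ <-].
  by rewrite [LHS]/= /mdelta scansE E step_opE.
by rewrite iterSr; congr iter; rewrite [LHS]/= /mdelta scansE E step_opE.
Qed.

Lemma iter_runs2 q T n T' : runs (c := c2) q T n T' ->
  iter n (@step O M) (@Config M (inl (inr q)) T) = @Config M (inr (Some None)) T'.
Proof.
elim=> {q T n T'} [q T o E|q q' T o n T' E _ <-].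
  by rewrite [LHS]/= /mdelta scansE E step_opE.
by rewrite iterSr; congr iter; rewrite [LHS]/= /mdelta scansE E step_opE.
Qed.

Definition init_stacks (x : string) : stacks := upd (fun=> [::]) 1 x.

Lemma outcome_oracle_machine x s1 s2 n1 n2 t :
  exec c1 (init_stacks x) n1 s1 ->
  exec c2 (upd s1 0 (O (s1 0))) n2 s2 ->
  n1 + n2 + 2 <= t ->
  outcome O M x [::] t = Some (s2 0 != [::]).
Proof.
move=> ex1 ex2 le_t.
have fit1 : fits e c1 by apply: fits_regs; rewrite /e; lia.
have fit2 : fits e c2 by apply: fits_regs; rewrite /e; lia.
have rep0 : reps (ctape (init M x [::])) (init_stacks x).
  move=> j; rewrite /= ffunE /init_stacks /upd /reg_ix.
  case: (eqVneq j ord0) => [->|j0].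
    by rewrite -val_eqE /=; apply: rep_tape_of.
  case: (eqVneq j ord_max) => [_|jm]; first exact: rep_tape_of.
  rewrite eqSS; case: eqP => [jj|_]; last exact: rep_tape_of.
  by case/eqP: j0; apply: val_inj.
have [T1 rT1 run1] := runs_exec fit1 ex1 rep0.
pose T1' := [ffun i => if i == ord_max then tape_of (O (string_of (T1 i)))
                       else T1 i].
have rT1' : reps T1' (upd s1 0 (O (s1 0))).
  move=> j; rewrite /T1' ffunE /upd /reg_ix.
  case: eqVneq => [->|jm].
    have := rT1 ord_max; rewrite /reg_ix eqxx => /rep_string_of ->.
    exact: rep_tape_of.
  by have := rT1 j; rewrite /reg_ix (negPf jm).
have [T2 rT2 run2] := runs_exec fit2 ex2 rT1'.
rewrite /outcome -(subnK le_t) iterD.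
have -> : iter (n1 + n2 + 2) (@step O M) (init M x [::]) =
  @Config M (inr (Some (Some (s2 0 != [::])))) (step_op None T2).
  (* The two additional steps are the oracle call and the final test of register 0. *)
  rewrite (_ : n1 + n2 + 2 = (n2.+1 + n1).+1); last by lia.
  rewrite iterS iterD (iter_runs1 run1) iterSr.
  have -> : @step O M (@Config M (inr None) T1) =
            @Config M (inl (inr (entry c2))) T1' by [].
  rewrite (iter_runs2 run2) [LHS]/= /mdelta step_opE.
  congr Config; congr (inr (Some (Some _))).
  have := rT2 ord_max; rewrite ffunE => /rep_scan ->.
  by rewrite /reg_ix eqxx; case: (s2 0).
by rewrite (@iter_step_halted _ _ _ _ (s2 0 != [::])).
Qed.

End Machine.

(** * Polynomial-time arithmetic on unary registers *)

Definition poly_bounded (f : nat -> nat) : Prop :=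
  exists p : {poly nat}, forall n, f n <= p.[n]%R.

Lemma horner_nat_mono (p : {poly nat}) m n : m <= n -> (p.[m] <= p.[n])%N%R.
Proof.
move=> le_mn; rewrite !horner_coef; elim/big_ind2: _ => //.
  by move=> x1 x2 y1 y2 le1 le2; apply: leq_add.
by move=> i _; apply: leq_mul => //; elim: (nat_of_ord i) => // k IH;
  rewrite !GRing.exprS; apply: leq_mul.
Qed.

Lemma poly_bounded_horner (p : {poly nat}) : poly_bounded (fun n => p.[n]%R).
Proof. by exists p. Qed.

Lemma poly_bounded_le f g : poly_bounded g -> (forall n, f n <= g n) ->
  poly_bounded f.
Proof. by case=> p le_p le_fg; exists p => n; apply: leq_trans (le_p n). Qed.

Lemma poly_bounded_const c : poly_bounded (fun=> c).
Proof. by exists c%:P%R => n; rewrite hornerC. Qed.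

Lemma poly_bounded_id : poly_bounded id.
Proof. by exists 'X%R => n; rewrite hornerX. Qed.

Lemma poly_bounded_add f g : poly_bounded f -> poly_bounded g ->
  poly_bounded (fun n => f n + g n).
Proof.
case=> p le_p [q le_q]; exists (p + q)%R => n.
by rewrite hornerD; apply: leq_add.
Qed.

Lemma poly_bounded_mul f g : poly_bounded f -> poly_bounded g ->
  poly_bounded (fun n => f n * g n).
Proof.
case=> p le_p [q le_q]; exists (p * q)%R => n.
by rewrite hornerM; apply: leq_mul.
Qed.

Lemma poly_bounded_comp f g : poly_bounded f -> poly_bounded g ->
  poly_bounded (fun n => f (g n)).
Proof.
case=> p le_p [q le_q]; exists (p \Po q)%R => n.
rewrite horner_comp; apply: leq_trans (le_p _) _.
exact: horner_nat_mono.
Qed.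

Ltac pbound := repeat (first
  [ exact: poly_bounded_const | exact: poly_bounded_id | assumption
  | apply: poly_bounded_add | apply: poly_bounded_mul
  | exact: poly_bounded_horner | apply: poly_bounded_comp ]).

(** * Time-bounded execution of stack programs *)

Definition ex (c : cmd) (s : stacks) (t : nat) (s' : stacks) : Prop :=
  exists2 n, n <= t & exec c s n s'.

Lemma ex_le c s t t' s' : t <= t' -> ex c s t s' -> ex c s t' s'.
Proof. by move=> le_t [n le_n ex_c]; exists n => //; apply: leq_trans le_t. Qed.

Lemma ex_Skip s : ex Skip s 1 s.
Proof. by exists 1 => //; constructor. Qed.

Lemma ex_Push s r b : ex (Push r b) s 2 (upd s r (b :: s r)).
Proof. by exists 2 => //; constructor. Qed.

Lemma ex_Pop s r : ex (Pop r) s 1 (upd s r (behead (s r))).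
Proof. by exists 1 => //; constructor. Qed.

Lemma ex_Seq c1 c2 s s1 s2 t1 t2 :
  ex c1 s t1 s1 -> ex c2 s1 t2 s2 -> ex (Seq c1 c2) s (t1 + t2) s2.
Proof.
case=> n1 le1 ex1 [n2 le2 ex2]; exists (n1 + n2); first exact: leq_add.
exact: ExSeq ex1 ex2.
Qed.

Lemma ex_If r (P : pred (option bool)) c1 c2 s s' t :
  ex (if P (ohead (s r)) then c1 else c2) s t s' ->
  ex (If r P c1 c2) s t.+1 s'.
Proof. by case=> n le_n ex1; exists n.+1 => //; constructor. Qed.

(** The loop is described by the explicit sequence [s] of its states, which serves as invariant and
    fixes the number of rounds. *)
Lemma ex_While r (P : pred (option bool)) c k t (s : nat -> stacks) :
  (forall i, i < k -> P (ohead (s i r))) ->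
  (forall i, i < k -> ex c (s i) t (s i.+1)) -> ~~ P (ohead (s k r)) ->
  ex (While r P c) (s 0) (k * t.+1 + 1) (s k).
Proof.
elim: k s => [|k IH] s Ps exs nP; first by exists 1 => //; apply: ExDone.
have [n1 le1 ex1] := exs 0 isT.
have [//|//|//|n2 le2 ex2] := IH (fun i => s i.+1).
- by move=> i lt_i; apply: Ps.
- by move=> i lt_i; apply: exs.
- exists (n1 + n2).+1; first by nia.
  by apply: ExLoop ex1 ex2; apply: Ps.
Qed.

Definition nonempty : pred (option bool) := fun a => a != None.

Lemma nonempty_ohead (s : seq bool) : nonempty (ohead s) = (s != [::]).
Proof. by case: s. Qed.

Lemma nonempty_drop i (s : seq bool) : (drop i s != [::]) = (i < size s).
Proof. by rewrite -size_eq0 size_drop subn_eq0 ltnNge. Qed.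

Ltac upds := apply: functional_extensionality => ?; rewrite /upd;
  repeat (case: eqP => ? //=); subst; try lia; try congruence.

Lemma upd_upd (T : Type) (s : nat -> T) r v w : upd (upd s r v) r w = upd s r w.
Proof. by apply: functional_extensionality => i; rewrite /upd; case: eqP. Qed.

Definition move1 (a b : nat) : cmd :=
  If a (pred1 (Some true)) (Seq (Pop a) (Push b true))
                           (Seq (Pop a) (Push b false)).

Lemma ex_move1 s a b : a != b -> s a != [::] ->
  ex (move1 a b) s 4 (upd (upd s a (behead (s a))) b (head true (s a) :: s b)).
Proof.
move=> ab sa; apply: ex_If.
have Eb x : upd s a x b = s b by rewrite /upd eq_sym (negPf ab).
case E: (s a) sa => [|[] l] //= _; apply: (ex_le (t := 1 + 2)) => //;
  apply: ex_Seq (ex_Pop _ _) _; rewrite E.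
- by have := ex_Push (upd s a l) b true; rewrite Eb.
- by have := ex_Push (upd s a l) b false; rewrite Eb.
Qed.

Lemma ex_eq c s t s1 s2 : s1 = s2 -> ex c s t s1 -> ex c s t s2.
Proof. by move->. Qed.

Definition move_all a b := While a nonempty (move1 a b).

Lemma take_rcons_drop (l : seq bool) i : i < size l ->
  rev (take i.+1 l) = head true (drop i l) :: rev (take i l).
Proof. by move=> lt_i; rewrite (take_nth true) // rev_rcons -nth0 nth_drop addn0. Qed.

Lemma ex_move_all s a b : a != b ->
  ex (move_all a b) s (size (s a) * 5 + 1)
    (upd (upd s a [::]) b (rev (s a) ++ s b)).
Proof.
move=> ab; set k := size (s a).
pose st i := upd (upd s a (drop i (s a))) b (rev (take i (s a)) ++ s b).
have sta i : st i a = drop i (s a) by rewrite /st /upd (negPf ab) eqxx.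
have E0 : st 0 = s by rewrite /st drop0 take0 /=; upds.
have <- : st k = upd (upd s a [::]) b (rev (s a) ++ s b).
  by rewrite /st drop_size take_size.
rewrite -[X in ex _ X]E0.
apply: (ex_While (s := st) (t := 4)) => [i lt_i|i lt_i|].
- by rewrite nonempty_ohead sta nonempty_drop.
- apply: ex_eq (ex_move1 ab _); last by rewrite sta nonempty_drop.
  rewrite sta -[behead _]drop1 drop_drop add1n.
  have -> : st i b = rev (take i (s a)) ++ s b by rewrite /st /upd eqxx.
  by rewrite -cat_cons -take_rcons_drop // /st; upds.
- by rewrite nonempty_ohead sta nonempty_drop ltnn.
Qed.

(* Adds the size of [v] to [r], using [f] as scratch space. *)
Definition copy v r f :=
  Seq (While v nonempty (Seq (move1 v f) (Push r true))) (move_all f v).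

Lemma ex_copy s v r f : v != r -> v != f -> r != f -> s f = [::] ->
  ex (copy v r f) s (size (s v) * 12 + 2)
     (upd s r (nseq (size (s v)) true ++ s r)).
Proof.
move=> vr vf rf sf; set k := size (s v).
pose st i := upd (upd (upd s v (drop i (s v))) f (rev (take i (s v))))
                 r (nseq i true ++ s r).
have stv i : st i v = drop i (s v).
  by rewrite /st /upd (negPf vr) (negPf vf) eqxx.
apply: (@ex_le _ _ ((k * 7 + 1) + (k * 5 + 1))); first by lia.
apply: (@ex_Seq _ _ _ (st k)).
  have E0 : st 0 = s by rewrite /st drop0 take0 /=; upds.
  rewrite -[X in ex _ X]E0.
  apply: (ex_While (s := st) (t := 6)) => [i lt_i|i lt_i|].
  - by rewrite nonempty_ohead stv nonempty_drop.
  - apply: (@ex_le _ _ (4 + 2)) => //.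
    apply: ex_Seq; first by apply: (ex_move1 vf _); rewrite stv nonempty_drop.
    apply: ex_eq (ex_Push _ _ _).
    rewrite stv -[behead _]drop1 drop_drop add1n.
    have -> : st i f = rev (take i (s v)).
      by rewrite /st /upd eq_sym (negPf rf) eqxx.
    rewrite -take_rcons_drop //.
    by rewrite /st {E0}; upds.
  - by rewrite nonempty_ohead stv nonempty_drop ltnn.
have fv : f != v by rewrite eq_sym.
have stf : st k f = rev (s v).
  by rewrite /st /upd eq_sym (negPf rf) eqxx take_size.
have := ex_move_all (st k) fv; rewrite stf size_rev => exm.
apply: ex_eq exm; rewrite revK stv drop_size cats0 /st; upds.
Qed.

(** * Unary expressions and the emission of lists of numbers *)

Definition sizes (s : stacks) : nat -> nat := fun i => size (s i).
(** Register 0 is left out because it collects the output: expressions never read it, so writing to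
    it does not change their values. *)
Definition agree d (r r' : nat -> nat) : Prop :=
  forall i, 0 < i < d -> r i = r' i.
Definition bounded d (r : nat -> nat) B : Prop := forall i, 0 < i < d -> r i <= B.

(* [e], a function of the sizes of the registers below [d], is computable in
   unary in polynomial time: [c r f] adds its value to register [r], using the
   empty registers from [f] on as scratch space. *)
Definition adder d (e : (nat -> nat) -> nat) : Prop :=
  (forall r r', agree d r r' -> e r = e r') /\
  exists (c : nat -> nat -> cmd) (C V : nat -> nat),
  [/\ poly_bounded C, poly_bounded V,
      forall r B, bounded d r B -> e r <= V B
    & forall r f s B, 0 < d <= f -> r < f -> (r == 0) || (d <= r) ->
        (forall i, f <= i -> s i = [::]) -> bounded d (sizes s) B ->
        ex (c r f) s (C B) (upd s r (nseq (e (sizes s)) true ++ s r))].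

Lemma adder_const d k : adder d (fun=> k).
Proof.
split=> //; exists (fun r _ => iter k (Seq (Push r true)) Skip).
exists (fun=> k * 2 + 1), (fun=> k); split=> //; try by pbound.
move=> r f s B _ _ _ _ _; elim: k s => [|k IH] s.
  by apply: ex_eq (ex_Skip _); upds.
apply: (@ex_le _ _ (2 + (k * 2 + 1))); first by lia.
apply: ex_Seq (ex_Push _ _ _) _; apply: ex_eq (IH _).
by upds; elim: k {IH} => //= k ->.
Qed.

Lemma adder_var d v : 0 < v < d -> adder d (fun r => r v).
Proof.
move=> lt_v; split=> [r r' /(_ v lt_v) //|].
exists (fun r f => copy v r f), (fun B => B * 12 + 2), id; split; try by pbound.
  by move=> r B /(_ v lt_v).
move=> r f s B le_f lt_r r0 sf /(_ v lt_v) le_B.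
apply: ex_le (ex_copy _ _ _ _); first by rewrite /sizes in le_B; nia.
- by lia.
- by lia.
- by lia.
- exact: sf.
Qed.

Lemma agree_upd d s r x : (r == 0) || (d <= r) ->
  agree d (sizes (upd s r x)) (sizes s).
Proof. by move=> r0 i lt_i; rewrite /sizes /upd; case: eqP => // ?; lia. Qed.

Lemma agree_sym d r r' : agree d r r' -> agree d r' r.
Proof. by move=> rr i lt_i; rewrite rr. Qed.

Lemma agree_bounded d r r' B : agree d r r' -> bounded d r B -> bounded d r' B.
Proof. by move=> rr br i lt_i; rewrite -rr //; apply: br. Qed.

Lemma adder_add d e1 e2 : adder d e1 -> adder d e2 ->
  adder d (fun r => e1 r + e2 r).
Proof.
move=> [x1 [c1 [C1 [V1 [pC1 pV1 bd1 ex1]]]]] [x2 [c2 [C2 [V2 [pC2 pV2 bd2 ex2]]]]].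
split=> [r r' rr|]; first by rewrite (x1 _ _ rr) (x2 _ _ rr).
exists (fun r f => Seq (c1 r f) (c2 r f)).
exists (fun B => C1 B + C2 B), (fun B => V1 B + V2 B).
split; try by pbound.
  by move=> r B br; apply: leq_add; [apply: bd1 | apply: bd2].
move=> r f s B le_f lt_r r0 sf bs.
have ag := agree_upd s (nseq (e1 (sizes s)) true ++ s r) r0.
apply: ex_Seq (ex1 _ _ _ _ le_f lt_r r0 sf bs) _.
apply: ex_eq (ex2 _ _ _ _ le_f lt_r r0 _ (agree_bounded (agree_sym ag) bs)).
  by rewrite (x2 _ _ ag); upds; rewrite catA -nseqD addnC.
by move=> i le_i; rewrite /upd; case: eqP => [?|_]; [lia | apply: sf].
Qed.

(** Register [f] receives [e1] and serves as a counter; each unit popped from it adds [e2] to [r].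
    The number of rounds is a computed value, which is why an adder comes with a bound [V] on its
    value besides its cost. *)
Lemma adder_mul d e1 e2 : adder d e1 -> adder d e2 ->
  adder d (fun r => e1 r * e2 r).
Proof.
move=> [x1 [c1 [C1 [V1 [pC1 pV1 bd1 ex1]]]]] [x2 [c2 [C2 [V2 [pC2 pV2 bd2 ex2]]]]].
split=> [r r' rr|]; first by rewrite (x1 _ _ rr) (x2 _ _ rr).
exists (fun r f => Seq (c1 f f.+1)
  (While f nonempty (Seq (Pop f) (c2 r f.+1)))).
exists (fun B => C1 B + (V1 B * (C2 B + 2) + 1)), (fun B => V1 B * V2 B).
split; try by pbound.
  by move=> r B br; apply: leq_mul; [apply: bd1 | apply: bd2].
move=> r f s B le_f lt_r r0 sf bs.
set k1 := e1 _; set k2 := e2 _.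
pose st i := upd (upd s f (nseq (k1 - i) true)) r (nseq (i * k2) true ++ s r).
have rf : r != f by case: eqP => // ?; lia.
have stf i : st i f = nseq (k1 - i) true.
  by rewrite /st /upd eq_sym (negPf rf) eqxx.
apply: (@ex_Seq _ _ _ (st 0)).
  apply: ex_eq (ex1 _ _ _ B _ _ _ _ bs); try lia.
    by rewrite -/k1 /st subn0 mul0n sf // cats0; upds.
  by move=> i le_i; apply: sf; lia.
have -> : upd s r (nseq (k1 * k2) true ++ s r) = st k1.
  by rewrite /st subnn; upds; rewrite sf.
have le_k1 := bd1 _ _ bs.
apply: (@ex_le _ _ (k1 * (1 + C2 B).+1 + 1)); first by nia.
apply: (ex_While (s := st)) => [i lt_i|i lt_i|].
- by rewrite stf; case: (k1 - i) (subn_gt0 i k1) => //; rewrite lt_i.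
- apply: ex_Seq (ex_Pop _ _) _.
  set s' := upd _ _ _.
  have Es' : s' = upd (upd s f (nseq (k1 - i.+1) true)) r (nseq (i * k2) true ++ s r).
    rewrite /s' stf -drop1 drop_nseq -subnDA addn1 /st; upds.
  have ag : agree d (sizes s') (sizes s).
    move=> j lt_j; rewrite Es' /sizes /upd; case: eqP => [?|_]; first by lia.
    by case: eqP => [?|_] //; lia.
  apply: ex_eq (ex2 r f.+1 s' B _ _ r0 _ (agree_bounded (agree_sym ag) bs)); try lia.
    rewrite (x2 _ _ ag) -/k2 Es' /st mulSn nseqD; upds.
    by rewrite catA.
  move=> j le_j; rewrite Es' /upd; case: eqP => [?|_]; first by lia.
  by case: eqP => [?|_]; [lia | apply: sf; lia].
- by rewrite stf subnn.
Qed.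

Lemma encode_cat a b : encode (a ++ b) = encode a ++ encode b.
Proof. by rewrite /encode map_cat flatten_cat. Qed.

(* [F], a list of numbers depending on the sizes of the registers below [d],
   can be written, coded by [encode], in front of register 0 in polynomial
   time. *)
Definition emitter d (F : (nat -> nat) -> seq nat) : Prop :=
  (forall r r', agree d r r' -> F r = F r') /\
  exists (c : cmd) (C : nat -> nat),
  poly_bounded C /\
  forall s B, 0 < d -> (forall i, d <= i -> s i = [::]) ->
    bounded d (sizes s) B -> ex c s (C B) (upd s 0 (encode (F (sizes s)) ++ s 0)).

Lemma emitter_nil d : emitter d (fun=> [::]).
Proof.
split=> //; exists Skip, (fun=> 1); split; first by pbound.
by move=> s B _ _ _; apply: ex_eq (ex_Skip _); upds.
Qed.

Lemma emitter_num d e : adder d e -> emitter d (fun r => [:: e r]).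
Proof.
move=> [x [c [C [V [pC pV _ exc]]]]].
split=> [r r' rr|]; first by rewrite (x _ _ rr).
exists (Seq (Push 0 false) (c 0 d)), (fun B => 2 + C B); split; first by pbound.
move=> s B d0 sd bs; apply: ex_Seq (ex_Push _ _ _) _.
have ag : agree d (sizes (upd s 0 (false :: s 0))) (sizes s).
  exact: agree_upd.
apply: ex_eq (exc _ _ _ _ _ d0 _ _ (agree_bounded (agree_sym ag) bs)) => //.
- by rewrite (x _ _ ag) /encode /= cats0; upds; rewrite cat_rcons.
- by rewrite d0 leqnn.
- by move=> i le_i; rewrite /upd; case: eqP => [?|_]; [lia | apply: sd].
Qed.

Lemma emitter_cat d F1 F2 : emitter d F1 -> emitter d F2 ->
  emitter d (fun r => F1 r ++ F2 r).
Proof.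
move=> [x1 [c1 [C1 [pC1 ex1]]]] [x2 [c2 [C2 [pC2 ex2]]]].
split=> [r r' rr|]; first by rewrite (x1 _ _ rr) (x2 _ _ rr).
(* Register 0 grows at the front, so the second list is written first. *)
exists (Seq c2 c1), (fun B => C2 B + C1 B); split; first by pbound.
move=> s B d0 sd bs; apply: ex_Seq (ex2 _ _ d0 sd bs) _.
set s' := upd _ _ _.
have ag : agree d (sizes s') (sizes s) by apply: agree_upd.
apply: ex_eq (ex1 _ _ d0 _ (agree_bounded (agree_sym ag) bs)).
  by rewrite (x1 _ _ ag) /s' encode_cat; upds; rewrite catA.
by move=> i le_i; rewrite /s' /upd; case: eqP => [i0|_]; [lia | apply: sd].
Qed.

(* The loop variable is register [d]; it counts down, so that the blocks, each
   written in front of the previous one, come out in increasing order. *)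
Lemma emitter_for d e F : adder d e -> emitter d.+1 F ->
  emitter d (fun r => flatten [seq F (upd r d i) | i <- iota 0 (e r)]).
Proof.
move=> [xe [c [C [V [pC pV bV exc]]]]] [xF [cF [D [pD exF]]]].
split=> [r r' rr|].
  rewrite (xe _ _ rr); congr flatten; apply: eq_map => i; apply: xF => j lt_j.
  by rewrite /upd; case: eqP => // ?; apply: rr; lia.
exists (Seq (c d d.+1) (While d nonempty (Seq (Pop d) cF))).
exists (fun B => C B + (V B * (D (B + V B) + 2) + 1)); split; first by pbound.
move=> s B d0 sd bs; set k := e _.
pose G i := F (upd (sizes s) d i).
pose st i := upd (upd s d (nseq (k - i) true)) 0
   (encode (flatten [seq G j | j <- iota (k - i) i]) ++ s 0).
have std i : st i d = nseq (k - i) true.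
  by rewrite /st /upd eqxx (gtn_eqF d0).
have le_k : k <= V B by apply: bV.
apply: (@ex_Seq _ _ _ (st 0)).
  apply: ex_eq (exc _ _ _ B _ _ _ _ bs); try lia.
    by rewrite -/k /st subn0 /= sd // cats0; upds.
  by move=> i le_i; apply: sd; lia.
have -> : upd s 0 (encode (flatten [seq G i | i <- iota 0 k]) ++ s 0) = st k.
  by rewrite /st subnn; upds; rewrite sd.
apply: (@ex_le _ _ (k * (1 + D (B + V B)).+1 + 1)); first by nia.
apply: (ex_While (s := st)) => [i lt_i|i lt_i|].
- by rewrite std; case: (k - i) (subn_gt0 i k) => //; rewrite lt_i.
- apply: ex_Seq (ex_Pop _ _) _.
  set s' := upd _ _ _.
  have Es' : s' = upd (upd s d (nseq (k - i.+1) true)) 0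
       (encode (flatten [seq G j | j <- iota (k - i) i]) ++ s 0).
    rewrite /s' std -drop1 drop_nseq -subnDA addn1 /st; upds.
  have ag : agree d.+1 (sizes s') (upd (sizes s) d (k - i.+1)).
    move=> j lt_j; rewrite Es' /sizes /upd; case: eqP => [?|_]; first by lia.
    by case: eqP => [?|_] //; rewrite size_nseq.
  apply: ex_eq (exF s' _ _ _ _) => //.
  + rewrite (xF _ _ ag) -/(G _) Es' /st.
    have -> : iota (k - i.+1) i.+1 = (k - i.+1) :: iota (k - i) i.
      by rewrite /=; congr (_ :: iota _ _); lia.
    by rewrite /= encode_cat; upds; rewrite catA.
  + move=> j le_j; rewrite Es' /upd; case: eqP => [?|_]; first by lia.
    by case: eqP => [?|_]; [lia | apply: sd; lia].
  + apply: agree_bounded (agree_sym ag) _ => j lt_j; rewrite /upd.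
    by case: eqP => [?|?]; [lia | have := bs j; lia].
- by rewrite std subnn.
Qed.

(** * Distances between the leaves of a tree *)

Section Distance.
Variables (V : finType) (e : rel V).

Lemma dist_le x p : path e x p -> size p < #|V| -> dist e x (last x p) <= size p.
Proof.
move=> e_p lt_p; rewrite leqNgt; apply/negP=> /(before_find 0).
rewrite nth_iota // add0n => /existsP; apply; exists (in_tuple p).
by rewrite /= e_p eqxx.
Qed.

(** The bound on [K] accounts for the value [#|V|] of [dist] when no path is found. *)
Lemma dist_ge x y K : K <= #|V| ->
  (forall p, path e x p -> last x p = y -> K <= size p) -> K <= dist e x y.
Proof.
move=> le_K Kp; rewrite leqNgt; apply/negP=> lt_d.
have d_has : dist e x y < size (iota 0 #|V|).
  by rewrite size_iota; apply: leq_trans le_K.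
have := d_has; rewrite -has_find => /(nth_find 0).
rewrite -/(dist e x y) nth_iota; last by rewrite -[#|V|](size_iota 0).
rewrite add0n => /existsP[p /andP[e_p /eqP lp]].
by have := Kp p e_p lp; rewrite size_tuple leqNgt lt_d.
Qed.

Lemma dist_path x y : dist e x y < #|V| ->
  exists p, [/\ path e x p, last x p = y & size p = dist e x y].
Proof.
move=> lt_d; have := lt_d; rewrite -{1}[#|V|](size_iota 0) -has_find.
move=> /(nth_find 0); rewrite -/(dist e x y) nth_iota // add0n.
by case/existsP=> p /andP[e_p /eqP lp]; exists p; rewrite size_tuple.
Qed.

End Distance.

Section Leaves.
Variables (V : finType) (T : rel V).
Hypothesis tree_T : is_tree T.

Let T_sym : symmetric T. Proof. by case: tree_T. Qed.

Definition parent (x : V) : V := odflt x [pick y | T x y].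

Lemma leaf_adj x y : x \in leaves T -> T x y = (y == parent x).
Proof.
rewrite inE /degree => /cards1P[z Ez].
have Tz w : T x w = (w == z) by have := in_set1 w z; rewrite -Ez inE.
rewrite /parent; case: pickP => [w|/(_ z)]; rewrite Tz ?eqxx //= Tz.
by move/eqP->.
Qed.

(** Connectivity as an induction principle: it turns a description of the neighbourhoods of a few
    vertices into one of the whole tree. *)
Lemma closed_all (A : {set V}) x : x \in A ->
  (forall y z, y \in A -> T y z -> z \in A) -> forall y, y \in A.
Proof.
move=> Ax clA y.
have csym : connect_sym T.
  by move=> a b; case: tree_T => _ _ _ con _; rewrite !con.
have clo : closed T A.
  by apply: intro_closed => // a b Tab Aa; apply: clA Tab.
rewrite -(closed_connect clo (x := x)) //.
by case: tree_T.
Qed.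

Hypothesis big_T : 2 < #|V|.

(** Two adjacent leaves would form a connected component, hence a tree with two vertices only. *)
Lemma leaves_nonadj x y : x \in leaves T -> y \in leaves T -> ~~ T x y.
Proof.
move=> Lx Ly; apply/negP=> Txy.
have Ey : y = parent x by apply/eqP; rewrite -leaf_adj.
have Ex : x = parent y by apply/eqP; rewrite -leaf_adj // T_sym.
have all_xy : forall z, z \in [set x; y].
  apply: (@closed_all _ x); first by rewrite set21.
  move=> a b; rewrite !inE => /orP[] /eqP->; rewrite leaf_adj //.
    by rewrite -Ey => ->; rewrite orbT.
  by rewrite -Ex => ->.
have := subset_leq_card (_ : [set: V] \subset [set x; y]).
rewrite cardsT cards2 => le; have: #|V| <= (x != y).+1.
  by apply: le; apply/subsetP.
by case: (x != y); lia.
Qed.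

Lemma parentP x : x \in leaves T -> T x (parent x).
Proof. by move=> Lx; rewrite leaf_adj. Qed.

Lemma parent_notin_leaves x : x \in leaves T -> parent x \notin leaves T.
Proof.
by move=> Lx; apply/negP=> /(leaves_nonadj Lx); rewrite parentP.
Qed.

(** A path of length 1 would make the leaves adjacent, and one of length 2 runs through a common
    parent. *)
Lemma leaf_dist x y : x \in leaves T -> y \in leaves T -> x != y ->
  3 - (parent x == parent y) <= dist T x y.
Proof.
move=> Lx Ly xy; apply: dist_ge; first by lia.
case=> [|a [|b [|c p]]] /=.
- by move=> _ ?; rewrite (eqP (_ : x == y)) ?eqxx // in xy; apply/eqP.
- by rewrite andbT => Txa ay; have := leaves_nonadj Lx Ly; rewrite -ay Txa.
- rewrite andbT => /andP[Txa Tab] b_y; rewrite b_y in Tab.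
  rewrite leaf_adj // in Txa; rewrite T_sym leaf_adj // in Tab.
  by rewrite -(eqP Txa) -(eqP Tab) eqxx.
- by move=> *; lia.
Qed.

Definition siblings c : {set V} := [set y in leaves T | parent y == c].

Lemma in_siblings c y :
  (y \in siblings c) = (y \in leaves T) && (parent y == c).
Proof. by rewrite /siblings in_set. Qed.

Lemma siblings_sub c : siblings c \subset [set y | T c y].
Proof.
apply/subsetP=> y; rewrite in_siblings => /andP[Ly /eqP<-].
by rewrite inE T_sym parentP.
Qed.

Lemma degree_le c : degree T c <= max_degree T.
Proof. exact: leq_bigmax. Qed.

(** If leaves exhausted the degree of their parent, the tree would be a star, with at most
    [max_degree T] leaves. *)
Lemma card_siblings x : x \in leaves T -> max_degree T < #|leaves T| ->
  #|siblings (parent x)| < max_degree T.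
Proof.
move=> Lx lt_L; set c := parent x; rewrite ltnNge; apply/negP=> le_S.
have ES : siblings c = [set y | T c y].
  by apply/eqP; rewrite eqEcard siblings_sub; apply: leq_trans le_S; apply: degree_le.
have all_c : forall z, z \in c |: siblings c.
  apply: (@closed_all _ c); first by rewrite setU11.
  move=> y z; rewrite in_setU1 => /orP[/eqP->|].
    by move=> Tcz; rewrite in_setU1 ES inE Tcz orbT.
  rewrite in_siblings => /andP[Ly /eqP cy]; rewrite leaf_adj // cy => /eqP->.
  by rewrite setU11.
have sub : leaves T \subset siblings c.
  apply/subsetP=> z Lz; have := all_c z; rewrite in_setU1 => /orP[/eqP zc|//].
  by have := parent_notin_leaves Lx; rewrite -/c -zc Lz.
have := subset_leq_card sub; move: (subset_leq_card (siblings_sub c)).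
have := degree_le c; rewrite /degree; lia.
Qed.

Lemma dist3_adj x y : x \in leaves T -> y \in leaves T -> x != y ->
  dist T x y <= 3 -> 3 < #|V| -> parent x != parent y ->
  T (parent x) (parent y).
Proof.
move=> Lx Ly xy le_d ltV pxy.
have ge3 := leaf_dist Lx Ly xy; rewrite (negPf pxy) subn0 in ge3.
have [|p [Tp lp sp]] := @dist_path _ T x y; first by lia.
have {sp}: size p = 3 by lia.
case: p Tp lp => [|a [|b [|c []]]] //= /and4P[Txa Tab Tbc _] cy _.
rewrite cy T_sym leaf_adj // in Tbc; rewrite leaf_adj // in Txa.
by rewrite -(eqP Txa) -(eqP Tbc).
Qed.

(** Their leaves and each other already exhaust the degrees of [a] and [b]; so these two vertices
    and the leaves form a closed set, which is the whole tree. *)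
Lemma card_double_star a b : T a b -> a \notin leaves T -> b \notin leaves T ->
  (forall x, x \in leaves T -> parent x \in [set a; b]) ->
  (max_degree T).-1 <= #|siblings a| -> (max_degree T).-1 <= #|siblings b| ->
  #|V| <= #|leaves T|.+2.
Proof.
have nbrs c d : T c d -> d \notin leaves T ->
    (max_degree T).-1 <= #|siblings c| -> [set y | T c y] = d |: siblings c.
  move=> Tcd Ld le_S; apply/esym/eqP; rewrite eqEcard; apply/andP; split.
    by rewrite subUset siblings_sub sub1set inE Tcd.
  rewrite cardsU1 in_siblings (negPf Ld) /= add1n.
  have := degree_le c; rewrite /degree; lia.
move=> Tab La Lb par_ab Sa Sb.
have all_A : forall z, z \in a |: (b |: leaves T).
  apply: (@closed_all _ a); first by rewrite setU11.
  move=> y z; rewrite !in_setU1 => /or3P[/eqP->|/eqP->|Ly] Tz.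
  - have : z \in [set y | T a y] by rewrite inE.
    rewrite (nbrs a b) // in_setU1 in_siblings.
    by case/orP=> [->|/andP[-> _]]; rewrite ?orbT.
  - have : z \in [set y | T b y] by rewrite inE.
    rewrite (nbrs b a) ?[T b a]T_sym // in_setU1 in_siblings.
    by case/orP=> [->|/andP[-> _]]; rewrite ?orbT.
  - rewrite leaf_adj // in Tz; have := par_ab y Ly.
    by rewrite -(eqP Tz) !inE => /orP[] ->; rewrite ?orbT.
have: #|[set: V]| <= #|a |: (b |: leaves T)|.
  by apply: subset_leq_card; apply/subsetP=> z _.
by rewrite cardsT !cardsU1; case: (a \notin _); case: (b \notin _); lia.
Qed.

End Leaves.

(** * Routing trees of the cocktail party graph *)

(* Vertices [2 v] and [2 v + 1] are the two literals of the variable [v]. *)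
Definition mate (u : nat) : nat := if odd u then u.-1 else u.+1.

Lemma odd_mate u : odd (mate u) = ~~ odd u.
Proof. by rewrite /mate; case: u => // u /=; case E: (odd u); rewrite /= ?E. Qed.

Lemma mate_neq u : mate u != u.
Proof. by rewrite /mate; case: ifP => [|_]; [case: u => //= u _|]; lia. Qed.

Lemma mate_lt u m : u < m.*2 -> mate u < m.*2.
Proof. by rewrite /mate; case: ifP; lia. Qed.

Definition nonmates (u v : nat) : bool := (v != u) && (v != mate u).

Lemma sum_nonmates m u (G : nat -> nat) : u < m.*2 ->
  \sum_(v < m.*2) G v = G u + G (mate u) + \sum_(v < m.*2 | nonmates u v) G v.
Proof.
move=> lt_u; rewrite (bigD1 (Ordinal lt_u)) //=.
rewrite (bigD1 (Ordinal (mate_lt lt_u))) /=; last first.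
  by rewrite -val_eqE /= mate_neq.
by rewrite addnA; congr (_ + _); apply: eq_bigl => v; rewrite -!val_eqE.
Qed.

Lemma card_nonmates m u : u < m.*2 ->
  \sum_(v < m.*2 | nonmates u v) 1 = m.*2 - 2.
Proof.
move=> lt_u; have := sum_nonmates (fun=> 1) lt_u.
by rewrite sum1_card card_ord /=; set s := \sum_(_ | _) _; lia.
Qed.

Section Optimal.
Variables (V : finType) (T : rel V) (m : nat) (f : nat -> V).
Hypothesis tree_T : is_tree T.
Hypothesis m_ge2 : 1 < m.
Hypothesis deg_T : max_degree T = m.+1.
Hypothesis f_inj : forall u v, u < m.*2 -> v < m.*2 -> f u = f v -> u = v.
Hypothesis f_leaf : forall u, u < m.*2 -> f u \in leaves T.
Hypothesis card_leaves : #|leaves T| = m.*2.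

Let D u v := dist T (f u) (f v).
Definition sib u v := parent T (f u) == parent T (f v).
Let par u := parent T (f u).

Let big_T : 3 < #|V|.
Proof. by have := max_card (leaves T); rewrite card_leaves; lia. Qed.

Let big_T2 : 2 < #|V|. Proof. exact: ltnW. Qed.

Lemma dist_sib u v : u < m.*2 -> v < m.*2 -> u != v -> 3 - sib u v <= D u v.
Proof.
move=> lt_u lt_v uv; apply: leaf_dist => //; try exact: f_leaf.
by apply: contraNneq uv => /f_inj ->.
Qed.

Lemma sum_sibE u : \sum_(v < m.*2) sib u v = #|[set v : 'I_(m.*2) | sib u v]|.
Proof.
rewrite -sum1_card big_mkcond [RHS]big_mkcond; apply: eq_bigr => v _ /=.
by rewrite inE; case: (sib u v).
Qed.

Lemma sum_sib_card u : u < m.*2 ->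
  \sum_(v < m.*2) sib u v <= #|siblings T (par u)|.
Proof.
move=> lt_u; rewrite sum_sibE.
rewrite -(card_in_imset (f := fun v : 'I_(m.*2) => f v)); last first.
  by move=> v w _ _ /f_inj vw; apply: val_inj; apply: vw.
apply: subset_leq_card; apply/subsetP=> x /imsetP[v]; rewrite inE => suv ->.
by rewrite in_siblings f_leaf //= eq_sym.
Qed.

Lemma sum_sib_le u : u < m.*2 -> \sum_(v < m.*2) sib u v <= m.
Proof.
move=> lt_u; apply: leq_trans (sum_sib_card lt_u) _.
rewrite -ltnS -deg_T; apply: card_siblings => //; first exact: f_leaf.
by rewrite deg_T card_leaves; lia.
Qed.

Lemma sib_refl u : sib u u. Proof. exact: eqxx. Qed.
Lemma sib_sym u v : sib u v = sib v u. Proof. exact: eq_sym. Qed.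
Lemma sib_trans u v w : sib u v -> sib v w -> sib u w.
Proof. by rewrite /sib => /eqP-> /eqP->. Qed.

Let row u := \sum_(v < m.*2 | nonmates u v) D u v.

Lemma row_nonsib u : u < m.*2 ->
  \sum_(v < m.*2 | nonmates u v) (3 - sib u v) +
  \sum_(v < m.*2 | nonmates u v) sib u v = 3 * (m.*2 - 2).
Proof.
move=> lt_u; rewrite -big_split /= -(card_nonmates lt_u) big_distrr /=.
by apply: eq_bigr => v _; case: (sib u v).
Qed.

Lemma row_sib u : u < m.*2 ->
  \sum_(v < m.*2 | nonmates u v) sib u v + sib u (mate u) < m.
Proof.
move=> lt_u; have := sum_sib_le lt_u.
rewrite (sum_nonmates (fun v => nat_of_bool (sib u v)) lt_u) sib_refl.
by set s := \sum_(_ | _) _; lia.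
Qed.

Lemma row_ge_nonsib u : u < m.*2 ->
  \sum_(v < m.*2 | nonmates u v) (3 - sib u v) <= row u.
Proof.
move=> lt_u; apply: leq_sum => v /andP[vu _]; apply: dist_sib => //.
by rewrite eq_sym.
Qed.

(** Of the [2m - 2] nonmates at most [m - 1] are siblings of [u], at distance 2; the others are at
    distance 3 or more, and [3(2m - 2) - (m - 1) = 5(m - 1)]. *)
Lemma row_ge u : u < m.*2 -> 5 * m.-1 <= row u.
Proof.
move=> lt_u; have := row_ge_nonsib lt_u.
have := row_nonsib lt_u; have := row_sib lt_u.
set s1 := \sum_(_ | _) _; set s2 := \sum_(_ | _) _; lia.
Qed.

(** Equality leaves no slack: a mate among the siblings, a family smaller than [m], or a single
    distance above 3 would each raise the row by at least one. *)
Lemma row_tight u : u < m.*2 -> row u <= 5 * m.-1 ->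
  [/\ ~~ sib u (mate u), \sum_(v < m.*2) sib u v = m
    & forall v, v < m.*2 -> nonmates u v -> D u v <= 3].
Proof.
move=> lt_u tight.
have ge1 := row_ge_nonsib lt_u; have eq1 := row_nonsib lt_u.
have lt1 := row_sib lt_u.
have nmate : sib u (mate u) = false.
  by move: ge1 eq1 lt1; case: (sib u (mate u)) => //;
    set s1 := \sum_(_ | _) _; set s2 := \sum_(_ | _) _; lia.
split; first by rewrite nmate.
  rewrite (sum_nonmates (fun v => nat_of_bool (sib u v)) lt_u) sib_refl nmate.
  by move: ge1 eq1 lt1; set s1 := \sum_(_ | _) _; set s2 := \sum_(_ | _) _; lia.
move=> v lt_v nm; rewrite leqNgt; apply/negP=> gt3.
(* A distance above 3 at [v] improves the termwise lower bound by one at that term. *)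
have: \sum_(w < m.*2 | nonmates u w) (3 - sib u w + (w == v :> nat)) <= row u.
  apply: leq_sum => w /andP[wu _]; case: eqP => [->|_]; first by lia.
  by rewrite addn0; apply: dist_sib => //; rewrite eq_sym.
rewrite big_split /=.
have: 0 < \sum_(w < m.*2 | nonmates u w) (w == v :> nat).
  by rewrite (bigD1 (Ordinal lt_v)) //= eqxx.
by move: ge1 eq1 lt1; rewrite nmate; set s1 := \sum_(_ | _) _;
  set s2 := \sum_(_ | _) _; set s3 := \sum_(_ | _) _; lia.
Qed.

Definition clique_length : nat := \sum_(u < m.*2) row u.

Lemma clique_length_ge : m.*2 * (5 * m.-1) <= clique_length.
Proof.
rewrite -[m.*2 in X in X <= _]card_ord -sum_nat_const.
by apply: leq_sum => u _; apply: row_ge.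
Qed.

Hypothesis tight : clique_length <= m.*2 * (5 * m.-1).

Lemma row_le u : u < m.*2 -> row u <= 5 * m.-1.
Proof.
move=> lt_u; rewrite leqNgt; apply/negP=> gt_u; move: tight.
rewrite leqNgt => /negP; apply; rewrite /clique_length.
rewrite -[m.*2 in X in X < _]card_ord -sum_nat_const.
rewrite (bigD1 (Ordinal lt_u)) //= [X in _ < X](bigD1 (Ordinal lt_u)) //=.
by rewrite -addSn; apply: leq_add => //; apply: leq_sum => w _; apply: row_ge.
Qed.

Lemma sib_mate u : u < m.*2 -> ~~ sib u (mate u).
Proof. by move=> lt_u; case: (row_tight lt_u (row_le lt_u)). Qed.

(** The families of [u] and of its mate are disjoint and have [m] members each, so they exhaust the
    [2m] leaves. *)
Lemma sib_or u v : u < m.*2 -> v < m.*2 -> sib (mate u) v = ~~ sib u v.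
Proof.
move=> lt_u; have lt_u' := mate_lt lt_u.
have nb w : ~~ (sib u w && sib (mate u) w).
  apply/negP=> /andP[s1]; rewrite sib_sym => s2.
  by have := sib_mate lt_u; rewrite (sib_trans s1 s2).
have sum2 : \sum_(w < m.*2) (sib u w + sib (mate u) w) = m.*2.
  rewrite big_split /=.
  have [_ -> _] := row_tight lt_u (row_le lt_u).
  by have [_ -> _] := row_tight lt_u' (row_le lt_u'); rewrite addnn.
move=> lt_v; case s1: (sib u v).
  by have := nb v; rewrite s1 /= => /negPf.
apply/negPn/negP=> s2; have: \sum_(w < m.*2) (sib u w + sib (mate u) w) < m.*2.
  rewrite -[X in _ < X]card_ord -sum1_card.
  rewrite (bigD1 (Ordinal lt_v)) //= [X in _ < X](bigD1 (Ordinal lt_v)) //=.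
  rewrite s1 (negPf s2) ltnS; apply: leq_sum => w _.
  by have := nb w; case: sib; case: sib.
by rewrite sum2 ltnn.
Qed.

Lemma sibE u v : u < m.*2 -> v < m.*2 -> sib u v = (sib 0 u == sib 0 v).
Proof.
move=> lt_u lt_v; have lt0 : 0 < m.*2 by lia.
case s0u: (sib 0 u); case s0v: (sib 0 v).
- by apply/idP; apply: sib_trans s0v; rewrite sib_sym.
- apply/idP=> suv; rewrite (sib_trans s0u suv) // in s0v.
- by apply/idP; rewrite sib_sym => suv; rewrite (sib_trans s0v suv) // in s0u.
- have := sib_or lt0 lt_u; have := sib_or lt0 lt_v; rewrite s0u s0v.
  move=> s1v s1u; apply/idP; apply: (@sib_trans _ (mate 0)); last by rewrite s1v.
  by rewrite sib_sym s1u.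
Qed.

Lemma sib0_mate u : u < m.*2 -> sib 0 (mate u) = ~~ sib 0 u.
Proof.
move=> lt_u; have lt0 : 0 < m.*2 by lia.
by rewrite sib_sym sib_or // sib_sym.
Qed.

Lemma exists_other_sib u : u < m.*2 ->
  exists2 v, v < m.*2 & sib u v && (v != u).
Proof.
move=> lt_u; have [_ eq_m _] := row_tight lt_u (row_le lt_u).
have: 1 < \sum_(v < m.*2) sib u v by rewrite eq_m.
rewrite (bigD1 (Ordinal lt_u)) //= sib_refl ltnS.
case E: [exists v : 'I_(m.*2), sib u v && (v != Ordinal lt_u)].
  by case/existsP: E => v sv _; exists v.
rewrite big1 // => v vu; case s: (sib u v) => //.
by case/existsP: E; exists v; rewrite s.
Qed.

(** No heavy edge joins 0 to its mate, so the distance between these two is not controlled directly.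
    A second leaf [v] with the parent of [mate 0] exists because [m >= 2]; it is a nonmate of 0, and
    its distance at most 3 from 0 makes the two parents adjacent. *)
Lemma card_tight : #|V| <= m.*2.+2.
Proof.
have lt0 : 0 < m.*2 by lia.
have lt1 := mate_lt lt0.
have s01 := sib_mate lt0.
have p01 : par 0 != par (mate 0) by [].
have [v lt_v /andP[sv v1]] := exists_other_sib lt1.
have s0v : ~~ sib 0 v.
  by apply: contra s01 => s0v; apply: sib_trans s0v _; rewrite sib_sym.
have v0 : v != 0 by apply: contraNneq s0v => ->; apply: sib_refl.
have pv : par v = par (mate 0) by apply/esym/eqP.
have f0v : f 0 != f v by apply: contraNneq v0 => /f_inj <-.
have [_ _ D3] := row_tight lt0 (row_le lt0).
have adj : T (par 0) (par (mate 0)).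
  rewrite -pv; apply: dist3_adj => //; try exact: f_leaf.
  by apply: D3 => //; rewrite /nonmates v0.
have cardS u : u < m.*2 -> m <= #|siblings T (par u)|.
  move=> lt_u; have [_ eq_m _] := row_tight lt_u (row_le lt_u).
  by rewrite -[X in X <= _]eq_m; apply: sum_sib_card.
rewrite -card_leaves; apply: (@card_double_star _ _ _ _ (par 0) (par (mate 0))) => //.
- by apply: parent_notin_leaves => //; apply: f_leaf.
- by apply: parent_notin_leaves => //; apply: f_leaf.
- have f_onto x : x \in leaves T -> exists2 u, u < m.*2 & x = f u.
    have E : [set f (val u) | u : 'I_(m.*2)] = leaves T.
      apply/eqP; rewrite eqEcard card_leaves card_imset ?card_ord ?leqnn ?andbT.
        by apply/subsetP=> y /imsetP[u _ ->]; apply: f_leaf (ltn_ord u).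
      by move=> u w fuw; apply: val_inj; apply: f_inj fuw; apply: ltn_ord.
    by rewrite -E => /imsetP[u _ ->]; exists u.
  move=> x /f_onto[u lt_u ->]; rewrite !inE -/(par u).
  have := sib_or lt0 lt_u; rewrite /sib -/(par _) -/(par _).
  by rewrite ![_ == par u]eq_sym => ->; case: eqP.
- by rewrite deg_T; apply: cardS.
- by rewrite deg_T; apply: cardS.
Qed.

End Optimal.

Lemma sum_double m (g : nat -> nat) :
  \sum_(u < m.*2) g u = \sum_(i < m) (g i.*2 + g i.*2.+1).
Proof.
elim: m => [|m IH]; first by rewrite !big_ord0.
by rewrite doubleS !big_ord_recr /= IH addnA.
Qed.

(** Keeps the leaves of the double star off any cycle. *)
Lemma ucycle_two_neighbours (V : finType) (e : rel V) (c : seq V) x :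
  symmetric e -> ucycle e c -> 2 < size c -> x \in c ->
  exists y z, [/\ e x y, e x z, y \in c & y != z].
Proof.
move=> e_sym /andP[cyc_c uniq_c] size_c /rot_to[i p Ep].
have : cycle e (rot i c) by rewrite rot_cycle.
have : uniq (rot i c) by rewrite rot_uniq.
have : 2 < size (rot i c) by rewrite size_rot.
have memc : rot i c =i c by apply: mem_rot.
rewrite Ep in memc *; case: p memc {Ep} => [|y [|z p]] // memc _.
rewrite /= rcons_path => /and3P[_ yzp _] /and3P[exy _ /andP[_ elx]].
exists y, (last z p); split => //.
- by rewrite e_sym.
- by rewrite -memc !inE eqxx orbT.
- by apply: contraNneq yzp => ->; apply: mem_last.
Qed.

(** * The double star of a truth assignment *)

Section DoubleStar.
Variables (m : nat) (sigma : nat -> bool).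
Hypothesis m_gt0 : 0 < m.
Hypothesis sigma_mate : forall u, u < m.*2 -> sigma (mate u) = ~~ sigma u.

Let N := m.*2.+2.
(** Vertices below [m.*2] are the leaves, and [m.*2] and [m.*2.+1] are the centres; leaf [x] hangs
    from centre [m.*2 + sigma x]. *)
Definition arc (x y : nat) : bool :=
  (x < m.*2) && (y == m.*2 + sigma x) || (x == m.*2) && (y == m.*2.+1).
Definition double_star : rel 'I_N := fun x y => arc x y || arc y x.
Let T := double_star.
Let f (u : nat) : 'I_N := inord u.

Let fE u : u < m.*2 -> f u = u :> nat.
Proof. by move=> lt_u; rewrite inordK // /N; lia. Qed.

Let T_sym : symmetric T. Proof. by move=> x y; apply: orbC. Qed.

Let T_leaf (x y : 'I_N) : x < m.*2 -> T x y = (y == m.*2 + sigma x :> nat).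
Proof.
move=> lt_x; rewrite /T /double_star /arc lt_x /=.
by have := ltn_ord y; case: (sigma x); case: (sigma y); lia.
Qed.

Let center (b : bool) : 'I_N := inord (m.*2 + b).
Let centerE (b : bool) : center b = m.*2 + b :> nat.
Proof. by rewrite inordK // /N; case: b; lia. Qed.

Let T_center (b : bool) (y : 'I_N) : T (center b) y =
  (y < m.*2) && (sigma y == b) || (y == m.*2 + ~~ b :> nat).
Proof.
rewrite T_sym; case: (ltnP y m.*2) => lt_y.
  rewrite T_leaf // centerE; case: (sigma y); case: b => /=; lia.
rewrite /T /double_star /arc centerE; have := ltn_ord y.
by case: (sigma y); case: b => /=; lia.
Qed.

(** Each pair of mates contributes one leaf to either side. *)
Lemma count_sigma b : \sum_(u < m.*2) (sigma u == b) = m.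
Proof.
rewrite (sum_double _ (fun u => nat_of_bool (sigma u == b))).
rewrite -[RHS]card_ord -sum1_card; apply: eq_bigr => i _.
have := sigma_mate (_ : i.*2 < m.*2); rewrite /mate odd_double => ->.
  by case: (sigma _); case: b.
by rewrite ltn_double.
Qed.

Let card_sigma b : #|[set y : 'I_N | (y < m.*2) && (sigma y == b)]| = m.
Proof.
rewrite -[RHS](count_sigma b) -sum1_card big_mkcond [LHS]big_ord_recr big_ord_recr.
rewrite /= !inE /= ltnn ltnNge leqnSn /= !addn0.
by apply: eq_bigr => u _; rewrite inE /= ltn_ord; case: eqP.
Qed.

Let degree_leaf (x : 'I_N) : x < m.*2 -> degree T x = 1.
Proof.
move=> lt_x; rewrite /degree.
rewrite (_ : [set y | _] = [set center (sigma x)]) ?cards1 //.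
by apply/setP=> y; rewrite !inE T_leaf // -val_eqE /= centerE.
Qed.

Let degree_center (b : bool) : degree T (center b) = m.+1.
Proof.
rewrite /degree.
rewrite (_ : [set y | _] =
  center (~~ b) |: [set y : 'I_N | (y < m.*2) && (sigma y == b)]).
  by rewrite cardsU1 card_sigma inE centerE ltnNge leq_addr.
by apply/setP=> y; rewrite !inE T_center orbC -val_eqE /= centerE.
Qed.

Let vertexP (x : 'I_N) : x < m.*2 \/ exists b, x = center b.
Proof.
case: (ltnP x m.*2) => lt_x; [by left | right].
exists (x != m.*2 :> nat); apply: val_inj; rewrite /= centerE.
have lt_x2 : x < m.*2.+2 := ltn_ord x.
by clear -lt_x lt_x2; case: eqP => /= ?; lia.
Qed.

Let leavesE (x : 'I_N) : (x \in leaves T) = (x < m.*2).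
Proof.
rewrite inE; case: (vertexP x) => [lt_x|[b ->]].
  by rewrite degree_leaf // lt_x.
by rewrite degree_center centerE; case: b; lia.
Qed.

Lemma double_star_max_degree : max_degree T = m.+1.
Proof.
apply/eqP; rewrite eqn_leq; apply/andP; split.
  apply/bigmax_leqP=> x _; case: (vertexP x) => [lt_x|[b ->]].
    by rewrite degree_leaf.
  by rewrite degree_center.
by rewrite -(degree_center false); apply: leq_bigmax.
Qed.

Lemma double_star_tree : is_tree T.
Proof.
have conn_sym : connect_sym T by apply: sym_connect_sym.
split=> //.
- by rewrite card_ord.
- move=> x; case: (vertexP x) => [lt_x|[b ->]].
    by rewrite T_leaf //; case: sigma; lia.
  by rewrite T_center centerE; case: b; lia.
- have conn0 x : connect T x (center false).
    have cc : T (center true) (center false).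
      by rewrite T_center centerE eqxx orbT.
    case: (vertexP x) => [lt_x|[[] ->]]; [|exact: connect1|exact: connect0].
    have := T_leaf (center (sigma x)) lt_x; rewrite centerE eqxx => Txc.
    by case: (sigma x) Txc => Txc; [apply: connect_trans (connect1 Txc) _ |];
      apply: connect1.
  move=> x y; apply: connect_trans (conn0 x) _.
  by rewrite conn_sym.
- move=> c size_c cyc_c; have /andP[_ uniq_c] := cyc_c.
  (* A leaf has a single neighbour, so a cycle could only visit the two centres. *)
  have sub : {subset c <= [:: center false; center true]}.
    move=> x xc; case: (vertexP x) => [lt_x|[[] ->]]; rewrite ?inE ?eqxx ?orbT //.
    have [y [z [Txy Txz _ /eqP[]]]] := ucycle_two_neighbours T_sym cyc_c size_c xc.
    rewrite T_leaf // in Txy; rewrite T_leaf // in Txz.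
    by apply: val_inj; rewrite /= (eqP Txy) (eqP Txz).
  by have := uniq_leq_size uniq_c sub; rewrite leqNgt size_c.
Qed.

Lemma double_star_leaves : [set f (val u) | u : 'I_(m.*2)] = leaves T.
Proof.
apply/setP=> x; rewrite leavesE; apply/imsetP/idP => [[u _ ->]|lt_x].
  by rewrite fE ltn_ord.
by exists (Ordinal lt_x) => //; apply: val_inj; rewrite /= fE.
Qed.

Lemma double_star_dist u v : u < m.*2 -> v < m.*2 -> u != v ->
  dist T (f u) (f v) <= 2 + (sigma u != sigma v).
Proof.
move=> lt_u lt_v uv; have Tc w : w < m.*2 -> T (f w) (center (sigma w)).
  by move=> lt_w; rewrite T_leaf fE // centerE.
have cardN : 3 < #|'I_N| by rewrite card_ord /N; lia.
case: eqVneq => [suv|suv].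
  apply: (@dist_le _ T (f u) [:: center (sigma u); f v]); last exact: ltnW.
  by rewrite /= Tc // suv T_sym Tc.
apply: (@dist_le _ T (f u) [:: center (sigma u); center (sigma v); f v]) => //.
rewrite /= Tc // [T _ (f v)]T_sym Tc // T_center centerE andbT.
by move: suv; case: (sigma u); case: (sigma v) => //; rewrite eqxx orbT.
Qed.

Lemma double_star_inj u v : u < m.*2 -> v < m.*2 -> f u = f v -> u = v.
Proof. by move=> lt_u lt_v /(congr1 val); rewrite /= !fE. Qed.

End DoubleStar.

(** * The edge list of the cocktail party graph *)

Definition block_edges (i j : nat) : seq (nat * nat) :=
  [:: (i.*2, j.*2); (i.*2, j.*2.+1); (i.*2.+1, j.*2); (i.*2.+1, j.*2.+1);
      (j.*2, i.*2); (j.*2.+1, i.*2); (j.*2, i.*2.+1); (j.*2.+1, i.*2.+1)].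

(* The complete graph minus the perfect matching of mates, every edge being
   listed in both orientations. *)
Definition cocktail (m : nat) : seq (nat * nat) :=
  flatten [seq flatten [seq block_edges i j | i <- iota 0 j] | j <- iota 0 m].

Lemma big_flatten_nat (I : Type) (s : seq (seq I)) (g : I -> nat) :
  \sum_(x <- flatten s) g x = \sum_(t <- s) \sum_(x <- t) g x.
Proof.
by elim: s => [|t s IH]; rewrite ?big_nil //= big_cat big_cons IH.
Qed.

(** Listing both orientations turns the sum over edges into a sum over ordered pairs, which can be
    studied one leaf at a time. *)
Lemma sum_cocktail m (g : nat -> nat -> nat) :
  \sum_(uv <- cocktail m) g uv.1 uv.2 =
  \sum_(u < m.*2) \sum_(v < m.*2 | nonmates u v) g u v.
Proof.
pose h i j := g i.*2 j.*2 + g i.*2 j.*2.+1 + g i.*2.+1 j.*2 + g i.*2.+1 j.*2.+1.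
have -> : \sum_(uv <- cocktail m) g uv.1 uv.2 =
          \sum_(0 <= j < m) \sum_(0 <= i < j) (h i j + h j i).
  rewrite big_flatten_nat big_map /index_iota subn0; apply: eq_bigr => j _.
  rewrite big_flatten_nat big_map /index_iota subn0; apply: eq_bigr => i _.
  by rewrite /block_edges !big_cons big_nil /= /h; lia.
have row i : i < m ->
    \sum_(v < m.*2 | nonmates i.*2 v) g i.*2 v +
    \sum_(v < m.*2 | nonmates i.*2.+1 v) g i.*2.+1 v =
    \sum_(0 <= j < m | j != i) h i j.
  move=> lt_i.
  have nmE (b : bool) (G : nat -> nat) :
      \sum_(v < m.*2 | nonmates (i.*2 + b) v) G v =
      \sum_(0 <= j < m | j != i) (G j.*2 + G j.*2.+1).
    rewrite big_mkcond /= [RHS]big_mkcond /= big_mkord.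
    rewrite (sum_double _ (fun v => if nonmates (i.*2 + b) v then G v else 0)).
    apply: eq_bigr => j _; rewrite /nonmates /mate.
    have -> : odd (i.*2 + b) = b by rewrite oddD odd_double; case: b.
    by case: b => /=; case: (eqVneq (j : nat) i) => [->|ji];
      rewrite ?addn0 ?addn1 /= ?eqxx ?andbF //=; do 2 case: ifP; lia.
  have := nmE false (g i.*2); rewrite addn0 => ->.
  have := nmE true (g i.*2.+1); rewrite addn1 => ->.
  by rewrite -big_split /=; apply: eq_bigr => j _; rewrite /h; lia.
rewrite (sum_double _ (fun u => \sum_(v < m.*2 | nonmates u v) g u v)).
under [RHS]eq_bigr => i _ do rewrite row //.
rewrite -(big_mkord xpredT (fun i => \sum_(0 <= j < m | j != i) h i j)).
(* The last variable adds one term to every earlier row, and one new row. *)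
elim: m {row} => [|m IH]; first by rewrite !big_geq.
have last_col i (G : nat -> nat) : \sum_(0 <= j < m.+1 | j != i) G j =
    \sum_(0 <= j < m | j != i) G j + (if m != i then G m else 0).
  by rewrite big_mkcond big_nat_recr //= -big_mkcond.
rewrite [LHS]big_nat_recr //= IH [RHS]big_nat_recr //= last_col eqxx addn0.
rewrite big_split /= addnA; congr (_ + _).
  rewrite -big_split /=; apply: eq_big_nat => i /andP[_ lt_i].
  by rewrite last_col gtn_eqF.
rewrite [RHS]big_mkcond /=; apply: eq_big_nat => i /andP[_ lt_i].
by rewrite ltn_eqF.
Qed.

(** * Optimal routing trees and minimum cuts *)

(** Classical well-ordering, applied to a property that quantifies over all trees. *)
Lemma nat_min (P : nat -> Prop) n : P n ->
  exists k, P k /\ forall j, P j -> k <= j.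
Proof.
elim/ltn_ind: n => n IH Pn.
case: (classic (exists2 j, P j & j < n)) => [[j Pj lt_j]|no]; first exact: IH Pj.
exists n; split=> // j Pj; rewrite leqNgt; apply/negP=> lt_j.
by case: no; exists j.
Qed.

(** A terminating [false] makes the code of numbers prefix-free; hence the instance string
    determines the graph and the degree. *)
Lemma encode_inj : injective encode.
Proof.
have eq1 k l a b : nseq k true ++ false :: a = nseq l true ++ false :: b ->
    k = l /\ a = b.
  by elim: k l => [|k IH] [|l] //= [] // /IH[-> ->].
elim=> [|k s IH] [|l t] //; rewrite /encode /= ?cat_rcons.
- by case: l.
- by case: k.
- by case/eq1=> -> /IH ->.
Qed.

Definition pair_names (E : seq (nat * nat)) : seq nat :=
  flatten [seq [:: uv.1; uv.2] | uv <- E].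

Lemma pair_names_inj : injective pair_names.
Proof.
elim=> [|[u v] s IH] [|[u' v'] t] //= [] -> -> e.
by congr (_ :: _); apply: IH.
Qed.

Lemma edge_namesE n (E : seq ('I_n * 'I_n)) :
  edge_names E = pair_names [seq (val uv.1, val uv.2) | uv <- E].
Proof. by rewrite /pair_names -map_comp. Qed.

Definition cut (sigma : nat -> bool) (H : seq (nat * nat)) : nat :=
  \sum_(uv <- H) (sigma uv.1 != sigma uv.2).

Definition simple_pairs n (E : seq (nat * nat)) : bool :=
  all (fun uv => [&& uv.1 < n, uv.2 < n & uv.1 != uv.2]) E.

Section Instance.
Variables (m W : nat) (E H : seq (nat * nat)).
Hypothesis m_ge2 : 1 < m.
Hypothesis E_ok : simple_pairs m.*2 E.
Hypothesis H_ok : simple_pairs m.*2 H.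
Hypothesis ltHW : size H < W.
(** The multiset [E] consists of [W] copies of the cocktail party graph together with [H]; stated
    through sums, this does not depend on the order of the list. *)
Hypothesis sum_E : forall g : nat * nat -> nat,
  \sum_(uv <- E) g uv = W * (\sum_(uv <- cocktail m) g uv) + \sum_(uv <- H) g uv.

Let vertex0 : 'I_(m.*2).
Proof. by exists 0; rewrite double_gt0; apply: ltnW. Defined.

Let vertex (u : nat) : 'I_(m.*2) := insubd vertex0 u.
Let vertexK u : u < m.*2 -> vertex u = u :> nat.
Proof. by move=> lt_u; rewrite val_insubd lt_u. Qed.

Definition instance : seq nat := [:: m.*2, m.+1 & pair_names E].

Lemma instance_graph : exists2 G : multigraph,
  encode instance = encode_instance G m.+1 & nverts G = m.*2.
Proof.
have ll : all (fun e : 'I_(m.*2) * 'I_(m.*2) => e.1 != e.2)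
    [seq (vertex uv.1, vertex uv.2) | uv <- E].
  rewrite all_map; apply: sub_all E_ok => uv /= /and3P[lt1 lt2].
  by apply: contraNneq => /(congr1 val) /=; rewrite !vertexK // => ->.
exists (Multigraph ll) => //; rewrite /encode_instance /=; congr (encode [:: _, _ & _]).
rewrite edge_namesE -map_comp; congr pair_names; rewrite -[LHS]map_id.
apply/eq_in_map => -[u v] /(allP E_ok) /= /and3P[lt_u lt_v _].
by rewrite !vertexK.
Qed.

Let sum_const (c : nat) (s : seq (nat * nat)) : \sum_(uv <- s) c = size s * c.
Proof. by rewrite big_const_seq count_predT iter_addn_0 mulnC. Qed.

Lemma double_star_length sigma (f : nat -> 'I_(m.*2.+2)) :
  (forall u, u < m.*2 -> sigma (mate u) = ~~ sigma u) ->
  (forall u, u < m.*2 -> f u = inord u) ->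
  \sum_(uv <- E) dist (double_star sigma) (f uv.1) (f uv.2) <=
  W * (m.*2 * (5 * m.-1)) + size H * 2 + cut sigma H.
Proof.
move=> sm fE; rewrite sum_E -addnA; apply: leq_add.
  rewrite leq_mul2l; apply/orP; right.
  rewrite (sum_cocktail m (fun u v => dist (double_star sigma) (f u) (f v))).
  rewrite -[m.*2 in X in _ <= X]card_ord -sum_nat_const.
  apply: leq_sum => u _; have lt_u := ltn_ord u.
  apply: (@leq_trans (\sum_(v < m.*2 | nonmates u v) (2 * 1 + (sigma v == ~~ sigma u)))).
    apply: leq_sum => v /andP[vu _]; rewrite !fE //.
    have -> : (sigma v == ~~ sigma u) = (sigma u != sigma v).
      by case: (sigma u); case: (sigma v).
    rewrite muln1; apply: (double_star_dist (m := m)) => //; first exact: ltnW.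
    by rewrite eq_sym.
  rewrite big_split /= -big_distrr /= card_nonmates //.
  (* Of the [m] leaves on the other side one is the mate; the row is therefore at most
     [2(2m - 2) + (m - 1) = 5(m - 1)], matching the lower bound. *)
  have := sum_nonmates (fun v => nat_of_bool (sigma v == ~~ sigma u)) lt_u.
  rewrite (count_sigma sm) sm // eqxx; case: (sigma u) => /=;
    by set s := \sum_(_ | _) _; lia.
rewrite -sum_const /cut -big_split /= big_seq [X in _ <= X]big_seq.
apply: leq_sum => uv /(allP H_ok) /and3P[lt1 lt2 ne]; rewrite !fE //.
by apply: (double_star_dist (m := m)) => //; apply: ltnW.
Qed.

(** Excludes the case where the oracle may answer that there is no solution. *)
Lemma exists_solution : exists y, minimum_routing_tree_length (encode instance) y.
Proof.
have [G EG nG] := instance_graph.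
have odd_sides u (_ : u < m.*2) := odd_mate u.
have m0 : 0 < m by apply: ltnW.
have ex0 : routing_tree (G := G) m.+1 (double_star odd)
             (fun u => inord u : 'I_(m.*2.+2)).
  split.
  - exact: double_star_tree.
  - exact: double_star_max_degree.
  - move=> u v uv; apply: val_inj.
    by apply: (double_star_inj m0 _ _ uv); rewrite -[X in _ < X]nG.
  - rewrite -(double_star_leaves m0 odd_sides); apply/setP=> x.
    apply/imsetP/imsetP=> -[u _ ->].
      by exists (cast_ord nG u).
    by exists (cast_ord (esym nG) u).
pose P L := exists N (T : rel 'I_N) phi,
  routing_tree (G := G) m.+1 T phi /\ tree_length T phi = L.
pose f0 (u : 'I_(nverts G)) : 'I_(m.*2.+2) := inord u.
have [|L [[N [T [phi [rT <-]]]] minL]] :=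
  @nat_min P (tree_length (G := G) (double_star odd) f0).
  by exists m.*2.+2, (double_star odd), f0.
exists (encode_solution T phi), G, m.+1, N, T, phi; split=> //; split=> //.
by move=> N' T' phi' rT'; apply: minL; exists N', T', phi'.
Qed.

(** The assignment read off the tree is [sib T f 0]: a literal is true when its leaf has the same
    parent as leaf 0. Optimality is retained only as minimality of the cut of [H]. *)
Record solution_spec N (T : rel 'I_N) (f : nat -> 'I_N) : Prop := SolutionSpec {
  spec_tree : is_tree T;
  spec_card : N <= m.*2.+2;
  spec_leaf : forall u, u < m.*2 -> f u \in leaves T;
  spec_mate : forall u, u < m.*2 -> sib T f 0 (mate u) = ~~ sib T f 0 u;
  spec_opt : forall sigma,
    (forall u, u < m.*2 -> sigma (mate u) = ~~ sigma u) ->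
    cut (sib T f 0) H <= cut sigma H
}.

Lemma solutionP y : minimum_routing_tree_length (encode instance) y ->
  exists N (T : rel 'I_N) f, solution_spec T f /\
  y = encode (N :: [seq val (f u) | u <- iota 0 m.*2] ++ edge_names (tree_edges T)).
Proof.
case=> G [D [N [T [phi [Ex -> [[tree_T deg_T phi_inj phi_leaf] minT]]]]]].
have [nG ED EE] : [/\ nverts G = m.*2, D = m.+1
    & E = [seq (val uv.1, val uv.2) | uv <- edges G]].
  have [e1 e2 e3] := encode_inj Ex; split=> //.
  by apply: pair_names_inj; rewrite -edge_namesE.
case: G nG EE phi phi_inj phi_leaf minT {Ex} => n Es ll /= nG.
move: ll; rewrite ED in deg_T *; move: Es; rewrite {n}nG {D ED} => Es ll EE.
move=> phi phi_inj phi_leaf minT.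
pose f u := phi (vertex u).
have fphi (u : 'I_(m.*2)) : phi u = f u.
  by congr phi; apply: val_inj; rewrite /= vertexK.
have f_inj u v : u < m.*2 -> v < m.*2 -> f u = f v -> u = v.
  by move=> lt_u lt_v /phi_inj /(congr1 val) /=; rewrite !vertexK.
have card_leaves : #|leaves T| = m.*2.
  by rewrite -phi_leaf card_imset // cardsT card_ord.
have f_leaf u : u < m.*2 -> f u \in leaves T.
  by move=> _; rewrite -phi_leaf imset_f.
have card_N : m.*2 <= N.
  by rewrite -card_leaves -[N in X in _ <= X]card_ord max_card.
have len_T : tree_length (G := Multigraph ll) T phi = \sum_(uv <- E) dist T (f uv.1) (f uv.2).
  by rewrite /tree_length EE big_map; apply: eq_bigr => uv _; rewrite -!fphi.
have upper sigma : (forall u, u < m.*2 -> sigma (mate u) = ~~ sigma u) ->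
    tree_length (G := Multigraph ll) T phi <= W * (m.*2 * (5 * m.-1)) + size H * 2 + cut sigma H.
  move=> sm; have m0 : 0 < m by apply: ltnW.
  pose f' u : 'I_(m.*2.+2) := inord u.
  apply: leq_trans (minT _ (double_star sigma) (fun u => f' u) _) _.
    split.
    - exact: double_star_tree.
    - exact: double_star_max_degree.
    - by move=> u v uv; apply: val_inj; apply: (double_star_inj m0 _ _ uv).
    - rewrite -(double_star_leaves m0 sm); apply/setP=> x.
      by apply/imsetP/imsetP=> -[u _ ->]; exists u.
  apply: leq_trans (double_star_length sm (f := f') _) => //.
  by rewrite /tree_length EE big_map.
have deg2 := dist_sib tree_T m_ge2 deg_T f_inj f_leaf card_leaves.
have lower : W * clique_length T m f + \sum_(uv <- H) dist T (f uv.1) (f uv.2) =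
    tree_length (G := Multigraph ll) T phi.
  rewrite len_T sum_E; congr (_ * _ + _).
  by rewrite (sum_cocktail m (fun u v => dist T (f u) (f v))).
have lowerH : size H * 2 <= \sum_(uv <- H) dist T (f uv.1) (f uv.2).
  rewrite -sum_const big_seq [X in _ <= X]big_seq.
  apply: leq_sum => uv /(allP H_ok) /and3P[lt1 lt2 ne].
  by have := deg2 _ _ lt1 lt2 ne; case: sib => /=; lia.
have cut_le sigma : cut sigma H <= size H.
  by rewrite -[X in _ <= X]muln1 -sum_const; apply: leq_sum => uv _; case: (_ != _).
have odd_sides u (_ : u < m.*2) := odd_mate u.
(* Any assignment would do for the comparison; [odd] is one. An excess of one unit on the clique
   costs [W], whereas the edges of [H] can vary by at most [size H] above their minimum 2 each. *)
have tight : clique_length T m f <= m.*2 * (5 * m.-1).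
  have := upper odd odd_sides; have := cut_le odd.
  rewrite -lower => le_c le_T; rewrite leqNgt; apply/negP=> gt_c.
  have : W * (m.*2 * (5 * m.-1)).+1 <= W * clique_length T m f.
    by rewrite leq_mul2l gt_c orbT.
  by rewrite mulnS; lia.
have ge_clique := clique_length_ge tree_T m_ge2 deg_T f_inj f_leaf card_leaves.
exists N, T, f; split; first split=> //.
- by have := card_tight tree_T m_ge2 deg_T f_inj f_leaf card_leaves tight; rewrite card_ord.
- by move=> u lt_u; apply: (sib0_mate tree_T m_ge2 deg_T f_inj f_leaf card_leaves tight).
- move=> sigma sm; have := upper sigma sm; rewrite -lower.
  have -> : clique_length T m f = m.*2 * (5 * m.-1) by apply/eqP; rewrite eqn_leq tight.
  (* The heavy parts cancel; what remains on each edge of [H] is at least 2, plus 1 when its ends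
     are not siblings. *)
  rewrite -addnA leq_add2l; move=> le_H.
  rewrite -(leq_add2l (size H * 2)); apply: leq_trans le_H.
  rewrite -sum_const /cut -big_split /= big_seq [X in _ <= X]big_seq.
  apply: leq_sum => uv /(allP H_ok) /and3P[lt1 lt2 ne].
  rewrite -(sibE tree_T m_ge2 deg_T f_inj f_leaf card_leaves tight) //.
  by apply: leq_trans (deg2 _ _ lt1 lt2 ne); case: sib.
- rewrite /encode_solution; congr (encode (_ :: _ ++ _)).
  rewrite -val_enum_ord -map_comp; apply: eq_map => u /=.
  by rewrite fphi.
Qed.

End Instance.

(** * The tableau of a computation *)

Lemma all_flatten (A : Type) (p : pred A) (ss : seq (seq A)) :
  all p (flatten ss) = all (all p) ss.
Proof. by elim: ss => //= s ss IH; rewrite all_cat IH. Qed.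

Lemma all_loop (A : eqType) (p : pred A) (F : nat -> seq A) k :
  (forall i, i < k -> all p (F i)) -> all p (flatten [seq F j | j <- iota 0 k]).
Proof.
move=> pF; apply/allP=> z /flattenP[s /mapP[i]]; rewrite mem_iota => /andP[_ lt_i] ->.
by apply/allP; apply: pF.
Qed.

Section Tableau.
Variable M : machine.
Hypothesis M_free : oracle_free M.

Notation ktapes := (extra M).+2.
Notation sym := (option bool).

(* Columns are numbered relative to the heads: at all times column [S] holds
   the scanned cells of all tapes, and is flagged. *)
Definition letter : finType := (bool * state M * {ffun 'I_ktapes -> sym})%type.

Definition cell_at (S : nat) (t : tape) (j : nat) : sym :=
  if j < S then nth None (ltape t) (S.-1 - j) else nth None (rtape t) (j - S).

Definition column S (c : config M) j : letter :=
  (j == S, cstate c, [ffun i => cell_at S (ctape c i) j]).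

(** The central column [z] holds the state and all scanned symbols, hence determines the transition.
    When a head moves left, its tape shifts right relative to the columns, so each column inherits
    from its left neighbour, and symmetrically. *)
Definition next_letter (z l m r : letter) : letter :=
  if verdict z.1.2 is Some _ then m else
  let: (q', a) := delta z.1.2 z.2 in
  let written (g : letter) i := if g.1.1 then (a i).1 else g.2 i in
  (m.1.1, q', [ffun i => match (a i).2 with
                         | Left => written l i
                         | Stay => written m i
                         | Right => written r i
                         end]).

Lemma cell_at_act S t w d j : 0 < S -> 0 < j ->
  let written k := if k == S then w else cell_at S t k in
  cell_at S (act (w, d) t) j =
  written (match d with Left => j.-1 | Stay => j | Right => j.+1 end).
Proof.
case: t => l r S0 j0 /=; rewrite /cell_at /act /=; case: d => /=.
- case: (ltngtP j S) => [lt_j|lt_j|->].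
  + rewrite (_ : (j.-1 == S) = false); last by lia.
    rewrite (_ : j.-1 < S); last by lia.
    by rewrite nth_behead; congr nth; lia.
  + case: eqP => [E|ne]; first by rewrite (_ : j - S = 1) //; lia.
    rewrite (_ : (j.-1 < S) = false); last by lia.
    rewrite (_ : j - S = (j.-1 - S).-1.+2); last by lia.
    rewrite /= nth_behead; congr nth; lia.
  + rewrite subnn (_ : (S.-1 == S) = false); last by lia.
    rewrite (_ : S.-1 < S); last by lia.
    by rewrite (_ : S.-1 - S.-1 = 0) ?subnn //=; case: l.
- case: (ltngtP j S) => [//|lt_j|->]; last by rewrite subnn.
  rewrite (_ : j - S = (j - S).-1.+1) /=; last by lia.
  by rewrite nth_behead.
- case: (ltngtP j S) => [lt_j|lt_j|->].
  + case: eqP => [E|ne]; first by rewrite (_ : S.-1 - j = 0) //; lia.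
    rewrite (_ : j.+1 < S); last by lia.
    by rewrite (_ : S.-1 - j = (S.-1 - j.+1).+1) //; lia.
  + rewrite (_ : (j.+1 == S) = false); last by lia.
    rewrite (_ : (j.+1 < S) = false); last by lia.
    by rewrite nth_behead; congr nth; lia.
  + rewrite subnn (_ : (S.+1 == S) = false); last by lia.
    rewrite (_ : (S.+1 < S) = false); last by lia.
    by rewrite (_ : S.+1 - S = 1) ?nth_behead //; lia.
Qed.

Lemma cell_at_scan S t : cell_at S t S = scan t.
Proof. by rewrite /cell_at ltnn subnn /scan; case: (rtape t). Qed.

Lemma column_step S c j : 0 < S -> 0 < j ->
  column S (@step no_oracle M c) j =
  next_letter (column S c S) (column S c j.-1) (column S c j) (column S c j.+1).
Proof.
case: c => q t S0 j0; rewrite /next_letter /step /=.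
case: (verdict q) => [b|] //; rewrite M_free.
have -> : [ffun i => cell_at S (t i) S] = [ffun i => scan (t i)].
  by apply/ffunP=> i; rewrite !ffunE cell_at_scan.
case: (delta _ _) => q' a; congr (_, _, _).
apply/ffunP=> i; rewrite !ffunE /=; case: (a i) => w d.
by rewrite cell_at_act //; case: d; rewrite /= ?ffunE.
Qed.

Definition run x y t := iter t (@step no_oracle M) (init M x y).

Definition start_letter (b : bool) (s s' : sym) : letter :=
  (b, start M, [ffun i => if i == ord0 then s else if i == ord_max then s' else None]).

Definition input_symbol S x j : sym := if j < S then None else onth x (j - S).

Lemma input_symbolD S x i : input_symbol S x (S + i) = onth x i.
Proof. by rewrite /input_symbol ltnNge leq_addr addKn. Qed.

Lemma column_init S x y j : column S (init M x y) j =
  start_letter (j == S) (input_symbol S x j) (input_symbol S y j).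
Proof.
have E (s : seq bool) : cell_at S (tape_of s) j = input_symbol S s j.
  rewrite /cell_at /input_symbol /=; case: ifP => _; first by rewrite nth_nil.
  rewrite onthE; case: (ltnP (j - S) (size s)) => lt_j.
    by rewrite (nth_map false) // (nth_map false).
  by rewrite !nth_default ?size_map.
congr (_, _, _); apply/ffunP=> i; rewrite !ffunE /=.
case: eqP => _; first exact: E.
case: eqP => _; first exact: E.
by rewrite /cell_at /= !nth_nil if_same.
Qed.

(* The propositional variables attached to a column at a given time: its
   letter, the pairs and triples of letters read to compute the next letter,
   and the initial input and certificate symbols. *)
Definition datum : finType :=
  (letter + (letter * letter + (letter * letter * letter + (sym + sym))))%type.
Notation is_letter g := (inl g) (only parsing).
Notation is_pair p := (inr (inl p)) (only parsing).
Notation is_triple p := (inr (inr (inl p))) (only parsing).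
Notation is_input s := (inr (inr (inr (inl s)))) (only parsing).
Notation is_cert s := (inr (inr (inr (inr s)))) (only parsing).

(** A transition has four premises, too many for a clause of three literals, so they are conjoined
    one at a time by [r_pair], [r_triple] and [r_next]. The certificate is guessed by [r_anycert],
    and [r_endcert] keeps the cells blank after its end. *)
Definition rule : finType :=
  (letter * letter + (letter * letter * letter + (letter * letter * letter * letter
   + (bool * sym * sym + (sym + (unit + (unit + (unit + letter))))))))%type.
Notation r_pair p := (inl p) (only parsing).
Notation r_triple p := (inr (inl p)) (only parsing).
Notation r_next p := (inr (inr (inl p))) (only parsing).
Notation r_init p := (inr (inr (inr (inl p)))) (only parsing).
Notation r_input s := (inr (inr (inr (inr (inl s))))) (only parsing).
Notation r_nocert := (inr (inr (inr (inr (inr (inl tt)))))) (only parsing).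
Notation r_anycert := (inr (inr (inr (inr (inr (inr (inl tt))))))) (only parsing).
Notation r_endcert := (inr (inr (inr (inr (inr (inr (inr (inl tt)))))))) (only parsing).
Notation r_reject g := (inr (inr (inr (inr (inr (inr (inr (inr g)))))))) (only parsing).

(* Besides the data there is one variable per instance of a rule, used to split
   its clause. *)
Inductive name := NTrue | NOut | NCell of nat & nat & datum + rule.

Definition literal := (name * bool)%type.

Section Rules.
Variable S : nat.

Definition data t j (x : datum) (b : bool) : literal := (NCell t j (inl x), b).

(** Shorter clauses repeat a literal. A transition is recorded at its leftmost column: it reads
    columns [j] to [j.+2] and fills [j.+1] at the next time. *)
Definition clause_of (t j : nat) (r : rule) : literal * literal * literal :=
  match r with
  | r_pair (z, l) =>
      (data t S (is_letter z) false, data t j (is_letter l) false,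
       data t j (is_pair (z, l)) true)
  | r_triple (z, l, m) =>
      (data t j (is_pair (z, l)) false, data t j.+1 (is_letter m) false,
       data t j (is_triple (z, l, m)) true)
  | r_next (z, l, m, r) =>
      (data t j (is_triple (z, l, m)) false, data t j.+2 (is_letter r) false,
       data t.+1 j.+1 (is_letter (next_letter z l m r)) true)
  | r_init (b, s, s') =>
      (data t j (is_input s) false, data t j (is_cert s') false,
       data t j (is_letter (start_letter b s s')) true)
  | r_input s =>
      (data t j (is_input s) true, data t j (is_input s) true,
       data t j (is_input s) true)
  | r_nocert =>
      (data t j (is_cert None) true, data t j (is_cert None) true,
       data t j (is_cert None) true)
  | r_anycert =>
      (data t j (is_cert (Some false)) true, data t j (is_cert (Some true)) true,
       data t j (is_cert None) true)
  | r_endcert =>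
      (data t j (is_cert None) false, data t j (is_cert None) false,
       data t j.+1 (is_cert None) true)
  | r_reject g =>
      ((NOut, false), (NOut, false), data t j (is_letter g) false)
  end.

Definition holds (v : name -> bool) (l : literal) : bool := v l.1 == l.2.

Definition sat (v : name -> bool) (k : nat * nat * rule) : bool :=
  let: (a, b, c) := clause_of k.1.1 k.1.2 k.2 in
  [|| holds v a, holds v b | holds v c].

End Rules.

Definition accepting (g : letter) : bool := verdict g.1.2 == Some true.

Definition step_rules : seq rule :=
  [seq r_pair p | p <- enum {: letter * letter}] ++
  [seq r_triple p | p <- enum {: letter * letter * letter}] ++
  [seq r_next p | p <- enum {: letter * letter * letter * letter}].

Definition init_rules (b : bool) : seq rule :=
  [seq r_init (b, s.1, s.2) | s <- enum {: sym * sym}].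

Definition reject_rules : seq rule :=
  [seq r_reject g | g <- enum letter & ~~ accepting g].

Definition at_cell (t j : nat) (rs : seq rule) : seq (nat * nat * rule) :=
  [seq (t, j, r) | r <- rs].

(* [T] bounds the running time, [P] the length of the certificate, [R] is
   [T + size x + P]. *)
Definition center R := R.+1.

(** Nothing here depends on the bits of the input, only on numbers. The [R.+2] columns from the
    centre on hold [n] input symbols and [T + P + 2] blanks, and likewise [P] certificate symbols
    and [T + n + 2] blanks. *)
Definition pre_parts (R n T P : nat) : seq (seq (nat * nat * rule)) :=
  [:: flatten [seq flatten [seq at_cell t j step_rules | j <- iota 0 (R + R).+1]
              | t <- iota 0 T];
      flatten [seq at_cell 0 j (init_rules false ++ [:: r_input None; r_nocert])
              | j <- iota 0 R.+1];
      at_cell 0 (center R) (init_rules true);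
      flatten [seq at_cell 0 (center R + i.+1) (init_rules false) | i <- iota 0 R.+1];
      flatten [seq at_cell 0 (center R + (n + i)) [:: r_input None]
              | i <- iota 0 (T + P).+2];
      flatten [seq at_cell 0 (center R + i) [:: r_anycert; r_endcert]
              | i <- iota 0 P];
      flatten [seq at_cell 0 (center R + (P + i)) [:: r_nocert]
              | i <- iota 0 (T + n).+2];
      at_cell T (center R) reject_rules].

Definition pre_rules R n T P := flatten (pre_parts R n T P).

Definition bit_rules (R : nat) (x : seq bool) : seq (nat * nat * rule) :=
  flatten [seq at_cell 0 (center R + i) [:: r_input (Some (nth false x i))]
          | i <- iota 0 (size x)].

Section Instance.
Variables (x : seq bool) (T P : nat).
Let n := size x.
Let R := T + n + P.
Let S := center R.

Definition rules := bit_rules R x ++ pre_rules R n T P.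

Lemma mem_at_cell t j rs r : r \in rs -> (t, j, r) \in at_cell t j rs.
Proof. by move=> rs_r; apply/mapP; exists r. Qed.

Lemma mem_loop (F : nat -> seq (nat * nat * rule)) k i p :
  i < k -> p \in F i -> p \in flatten [seq F j | j <- iota 0 k].
Proof.
by move=> lt_i Fi; apply/flattenP; exists (F i) => //; apply: map_f; rewrite mem_iota.
Qed.

Lemma mem_step_rules (r : rule) :
  match r with r_pair _ | r_triple _ | r_next _ => True | _ => False end ->
  r \in step_rules.
Proof.
by rewrite /step_rules !mem_cat; case: r => [p|[p|[p|[]]]] // _;
  rewrite ?(map_f (fun p => r_pair p)) ?(map_f (fun p => r_triple p))
          ?(map_f (fun p => r_next p)) ?mem_enum ?orbT.
Qed.

(** * From a satisfying valuation to an accepted certificate *)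

Section Soundness.
Variable v : name -> bool.
Hypothesis sat_v : all (sat S v) rules.
Hypothesis out_v : v NOut.

Let satP p : p \in rules -> sat S v p. Proof. exact: (allP sat_v). Qed.
Let val t j d := v (NCell t j (inl d)).

Let in_pre i p : i < 8 -> p \in nth [::] (pre_parts R n T P) i -> sat S v p.
Proof.
move=> lt_i pp; apply: satP; rewrite mem_cat; apply/orP; right.
by apply/flattenP; exists (nth [::] (pre_parts R n T P) i) => //; apply: mem_nth.
Qed.

Lemma sat_step t j r : t < T -> j < (R + R).+1 -> r \in step_rules -> sat S v (t, j, r).
Proof.
move=> lt_t lt_j rr; apply: (in_pre (i := 0)) => //.
apply: (mem_loop (i := t) (F := fun t => flatten _)) => //.
by apply: (mem_loop (i := j)) => //; apply: mem_at_cell.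
Qed.

Lemma val_step t j z l m r : t < T -> j < (R + R).+1 ->
  val t S (is_letter z) -> val t j (is_letter l) -> val t j.+1 (is_letter m) ->
  val t j.+2 (is_letter r) -> val t.+1 j.+1 (is_letter (next_letter z l m r)).
Proof.
move=> lt_t lt_j vz vl vm vr.
have := sat_step lt_t lt_j (mem_step_rules (r := r_pair (z, l)) I).
rewrite /sat /= /holds /= -!/(val _ _ _) vz vl /= eqb_id => vp.
have := sat_step lt_t lt_j (mem_step_rules (r := r_triple (z, l, m)) I).
rewrite /sat /= /holds /= -!/(val _ _ _) vp vm /= eqb_id => vt.
have := sat_step lt_t lt_j (mem_step_rules (r := r_next (z, l, m, r)) I).
by rewrite /sat /= /holds /= -!/(val _ _ _) vt vr /= eqb_id.
Qed.

Lemma mem_init_rules b s s' : r_init (b, s, s') \in init_rules b.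
Proof. by apply/mapP; exists (s, s'); rewrite // mem_enum. Qed.

Lemma val_init j s s' : j < R.+2 + R.+1 -> val 0 j (is_input s) ->
  val 0 j (is_cert s') -> val 0 j (is_letter (start_letter (j == S) s s')).
Proof.
move=> lt_j vs vs'.
suff: sat S v (0, j, r_init (j == S, s, s')).
  by rewrite /sat /= /holds /= -!/(val _ _ _) vs vs' /= eqb_id.
case: (ltngtP j S) => [lt_jS|gt_jS|->].
- apply: (in_pre (i := 1)) => //; apply: (mem_loop (i := j)) => //.
  by apply: mem_at_cell; rewrite mem_cat mem_init_rules.
- apply: (in_pre (i := 3)) => //.
  have -> : j = S + (j - S.+1).+1 by lia.
  apply: (mem_loop (i := j - S.+1)); first by rewrite /S /center in gt_jS *; lia.
  by apply: mem_at_cell; rewrite mem_init_rules.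
- apply: (in_pre (i := 2)) => //.
  by apply: mem_at_cell; rewrite mem_init_rules.
Qed.

Lemma val_input j : j < R.+2 + R.+1 -> val 0 j (is_input (input_symbol S x j)).
Proof.
move=> lt_j; suff: sat S v (0, j, r_input (input_symbol S x j)).
  by rewrite /sat /= /holds /= -!/(val _ _ _) !orbb eqb_id.
rewrite /input_symbol; case: ltnP => [lt_S|le_S].
  apply: (in_pre (i := 1)) => //.
  by apply: (mem_loop (i := j)) => //; apply: mem_at_cell; rewrite mem_cat !inE eqxx orbT.
rewrite onthE; case: (ltnP (j - S) n) => lt_n.
  rewrite (nth_map false) //; apply: satP; rewrite mem_cat; apply/orP; left.
  rewrite -[X in (0, X, _)](subnKC le_S).
  by apply: (mem_loop (i := j - S)) => //; apply: mem_at_cell; rewrite inE.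
rewrite nth_default ?size_map //.
apply: (in_pre (i := 4)) => //.
have -> : j = S + (n + (j - S - n)) by lia.
apply: (mem_loop (i := j - S - n)).
  by move: lt_j le_S lt_n; rewrite /S /center /R; lia.
by apply: mem_at_cell; rewrite inE.
Qed.

Lemma val_nocert j : j < R.+2 + R.+1 -> j < S \/ S + P <= j ->
  val 0 j (is_cert None).
Proof.
move=> lt_j Hj; suff: sat S v (0, j, r_nocert).
  by rewrite /sat /= /holds /= -!/(val _ _ _) !orbb eqb_id.
case: Hj => [lt_S|le_S].
  apply: (in_pre (i := 1)) => //.
  by apply: (mem_loop (i := j)) => //; apply: mem_at_cell; rewrite mem_cat !inE eqxx !orbT.
apply: (in_pre (i := 6)) => //.
have -> : j = S + (P + (j - S - P)) by lia.
apply: (mem_loop (i := j - S - P)).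
  by move: lt_j le_S; rewrite /S /center /R; lia.
by apply: mem_at_cell; rewrite inE.
Qed.

Lemma val_cert i : i < P ->
  [|| val 0 (S + i) (is_cert (Some false)), val 0 (S + i) (is_cert (Some true))
    | val 0 (S + i) (is_cert None)] /\
  (val 0 (S + i) (is_cert None) -> val 0 (S + i).+1 (is_cert None)).
Proof.
move=> lt_i.
have in_cert r : r \in [:: r_anycert; r_endcert] -> sat S v (0, S + i, r).
  move=> rr.
  apply: (in_pre (i := 5)) => //.
  by apply: (mem_loop (i := i)) => //; apply: mem_at_cell.
split.
  have := in_cert r_anycert; rewrite !inE eqxx => /(_ isT).
  by rewrite /sat /= /holds /= -!/(val _ _ _) !eqb_id.
have := in_cert r_endcert; rewrite !inE eqxx orbT => /(_ isT).
by rewrite /sat /= /holds /= -!/(val _ _ _) => + vn; rewrite vn /= eqb_id.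
Qed.

(** The guessed string ends at the first cell where the blank is true: [r_endcert] propagates the
    blank from there, and [r_anycert] provides a bit before. *)
Lemma exists_certificate : exists2 y : seq bool, size y <= P &
  forall j, j < R.+2 + R.+1 -> val 0 j (is_cert (input_symbol S y j)).
Proof.
pose stop i := val 0 (S + i) (is_cert None).
have ltSP : S + P < R.+2 + R.+1 by rewrite /S /center /R; lia.
have stopP : stop P by apply: val_nocert => //; right.
have [L stopL minL] := ex_minnP (ex_intro (fun i => stop i) P stopP).
have le_L := minL P stopP.
have stop_after i : L <= i -> i <= P -> stop i.
  elim: i => [|i IH]; first by rewrite leqn0 => /eqP <-.
  rewrite leq_eqVlt => /orP[/eqP <- //|lt_i] le_i.
  have [_] := val_cert le_i; rewrite -addnS; apply; apply: IH => //.
  exact: ltnW.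
(* Both bits may be true in one cell; [true] is then preferred, and where it fails only [false] is
   left. *)
pose y := mkseq (fun i => val 0 (S + i) (is_cert (Some true))) L.
exists y; first by rewrite size_mkseq.
move=> j lt_j; rewrite /input_symbol; case: ltnP => [lt_S|le_S].
  by apply: val_nocert => //; left.
rewrite onthE; case: (ltnP (j - S) L) => lt_L; last first.
  rewrite nth_default ?size_map ?size_iota //.
  case: (leqP (S + P) j) => [le_P|lt_P]; first by apply: val_nocert => //; right.
  by rewrite -[j](subnKC le_S); apply: stop_after => //; lia.
rewrite (nth_map false) ?size_mkseq // nth_mkseq // subnKC //.
have [] := @val_cert (j - S); first by lia.
rewrite subnKC // => + _; have: ~~ stop (j - S).
  by apply/negP=> /minL; rewrite leqNgt lt_L.
rewrite /stop subnKC // => /negPf->; rewrite orbF.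
by case vt: (val 0 j (is_cert (Some true))); rewrite // orbF.
Qed.

(** A valuation may make several letters true in one column. It suffices that those of the actual
    run are among them, since every non-accepting letter is forbidden at the end. *)
Lemma soundness : exists2 y, size y <= P & verdict (cstate (run x y T)) = Some true.
Proof.
have [y le_y vy] := exists_certificate; exists y => //.
(* Each step loses one column at either end of the known window; as [T <= R], the centre is still
   inside it at time [T]. *)
have vcol t j : t <= T -> t <= j -> j + t < R.+2 + R.+1 ->
    val t j (is_letter (column S (run x y t) j)).
  elim: t j => [|t IH] j le_t le_j lt_j.
    rewrite addn0 in lt_j; rewrite /run /= column_init.
    by apply: val_init => //; [apply: val_input | apply: vy].
  case: j le_j lt_j => // j le_j lt_j.
  have lt_T : t + T + n + P < R + T + 1 by rewrite /R; lia.
  have v_t k : t <= k -> k + t < R.+2 + R.+1 ->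
      val t k (is_letter (column S (run x y t) k)).
    by apply: IH; apply: ltnW.
  rewrite [run _ _ _]/= column_step //=; apply: val_step => //; try apply: v_t;
    by move: le_t le_j lt_j; rewrite /S /center /R; lia.
have vfin : val T S (is_letter (column S (run x y T) S)).
  by apply: vcol => //; rewrite /S /center /R; lia.
apply/eqP; apply: contraTT vfin => rej.
suff: sat S v (T, S, r_reject (column S (run x y T) S)).
  by rewrite /sat /= /holds /= -!/(val _ _ _) out_v /=; case: (val _ _ _).
apply: (in_pre (i := 7)) => //.
apply: mem_at_cell; apply/mapP; exists (column S (run x y T) S) => //.
by rewrite mem_filter mem_enum rej.
Qed.

End Soundness.

(** * From a certificate to a satisfying valuation *)

Section Completeness.
Variable y : seq bool.
Hypothesis le_y : size y <= P.

Definition datum_true t j (d : datum) : bool :=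
  let c k := column S (run x y t) k in
  match d with
  | is_letter g => g == c j
  | is_pair (z, l) => (z == c S) && (l == c j)
  | is_triple (z, l, m) => [&& z == c S, l == c j & m == c j.+1]
  | is_input s => s == input_symbol S x j
  | is_cert s => s == input_symbol S y j
  end.

Definition run_holds (a : literal) : bool :=
  match a.1 with
  | NTrue => true
  | NOut => verdict (cstate (run x y T)) == Some true
  | NCell t j (inl d) => datum_true t j d
  | NCell _ _ _ => true
  end == a.2.

(* The splitting variable of a clause [a || b || c] says that [a || b] fails. *)
Definition run_valuation (nm : name) : bool :=
  match nm with
  | NCell t j (inr r) =>
      let: (a, b, _) := clause_of S t j r in ~~ (run_holds a || run_holds b)
  | _ => run_holds (nm, true)
  end.

(** Clauses never contain splitting variables, so their literals have the same value under
    [run_holds] and under the valuation. *)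
Lemma run_valuation_aux t j r : run_valuation (NCell t j (inr r)) =
  ~~ (holds run_valuation (clause_of S t j r).1.1 ||
      holds run_valuation (clause_of S t j r).1.2).
Proof.
rewrite [LHS]/=; have E nm b : (if nm is NCell _ _ (inr _) then False else True) ->
    run_holds (nm, b) = holds run_valuation (nm, b).
  by case: nm => [||t' j' [d|r']] //=; case: b;
    rewrite /run_holds /holds /= /run_holds /= ?eqb_id.
case: r => [[z l]|[[[z l] m]|[[[[z l] m] r]|[[[b s] s']|[s|[[]|[[]|[[]|g]]]]]]]] /=;
  by rewrite ?E // /holds /= /run_holds /= ?eqb_id.
Qed.

Lemma run_valuation_out :
  run_valuation NOut = (verdict (cstate (run x y T)) == Some true).
Proof. by rewrite /= /run_holds eqb_id. Qed.

Let holdsE t j d b : holds run_valuation (data t j d b) = (datum_true t j d == b).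
Proof. by rewrite /holds /= /run_holds eqb_id. Qed.

Let all_cell (p : pred (nat * nat * rule)) t j rs :
  {in rs, forall r, p (t, j, r)} -> all p (at_cell t j rs).
Proof. by move=> pr; rewrite all_map; apply/allP=> r; apply: pr. Qed.

Let sat_pre_init j b : b = (j == S) ->
  {in init_rules b, forall r, sat S run_valuation (0, j, r)}.
Proof.
move=> Eb r /mapP[[s s'] _ ->]; rewrite /sat /= !holdsE /= /run /= column_init Eb.
by case: (s =P _) => //= <-; case: (s' =P _) => //= <-; rewrite eqxx.
Qed.

(** Holds for rejected certificates too, as [NOut] is then false; this provides the reference cut to
    which an optimal one is compared. *)
Lemma completeness : all (sat S run_valuation) rules.
Proof.
have cons_all (p : pred (seq (nat * nat * rule))) a s :
  all p (a :: s) = p a && all p s by [].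
rewrite all_cat [X in _ && X]all_flatten /pre_parts !cons_all.
apply/and5P; split; last (apply/and5P; split; last (apply/andP; split => //)).
- apply: all_loop => i lt_i; apply: all_cell => r; rewrite inE => /eqP->.
  rewrite /sat /= !holdsE /= /input_symbol ltnNge leq_addr /= addKn onthE.
  by rewrite (nth_map false) // !eqxx.
- apply: all_loop => t lt_t; apply: all_loop => j lt_j; apply: all_cell => r.
  rewrite !mem_cat => /or3P[] /mapP[p _ ->]; rewrite /sat /=.
  + case: p => z l; rewrite !holdsE /=.
    by case: (z == _); case: (l == _).
  + case: p => [[z l] m]; rewrite !holdsE /=.
    by case: (z == _); case: (l == _); case: (m == _).
  + case: p => [[[z l] m] r']; rewrite !holdsE /=.
    rewrite column_step //=.
    case: (z =P _) => //= <-; case: (l =P _) => //= <-.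
    by case: (m =P _) => //= <-; case: (r' =P _) => //= <-; rewrite eqxx.
- apply: all_loop => j lt_j; apply: all_cell => r; rewrite mem_cat => /orP[].
    by apply: sat_pre_init; rewrite ltn_eqF.
  rewrite !inE => /orP[] /eqP->; rewrite /sat /= !holdsE /=;
    by rewrite /input_symbol lt_j.
- by apply: all_cell; apply: sat_pre_init; rewrite eqxx.
- apply: all_loop => j lt_j; apply: all_cell; apply: sat_pre_init.
  by rewrite gtn_eqF // addnS ltnS leq_addr.
- apply: all_loop => i lt_i; apply: all_cell => r; rewrite inE => /eqP->.
  rewrite /sat /= !holdsE /= /input_symbol ltnNge leq_addr /= addKn onthE.
  by rewrite nth_default // size_map leq_addr.
- apply: all_loop => i lt_i; have E1 := input_symbolD S y i.
  have := input_symbolD S y i.+1; rewrite addnS.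
  move: (S + i) E1 => j E1 E2.
  apply: all_cell => r; rewrite !inE => /orP[] /eqP->; rewrite /sat /= !holdsE /= E1.
    by case: (onth y i) => [[]|].
  rewrite E2; case: (ltnP i (size y)) => [lt_y|ge_y].
    by have: onth y i; [rewrite onthTE | case: (onth y i)].
  by rewrite !onth_default //; apply: leqW.
- apply: all_loop => i lt_i; apply: all_cell => r; rewrite inE => /eqP->.
  rewrite /sat /= !holdsE /= /input_symbol ltnNge leq_addr /= addKn onthE.
  by rewrite nth_default // size_map; lia.
- apply: all_cell => r /mapP[g]; rewrite mem_filter => /andP[rej _] ->.
  rewrite /sat /= !holdsE /holds run_valuation_out /=.
  case: (g =P _) => [Eg|_]; last by rewrite !orbT.
  by move: rej; rewrite Eg /accepting /= => /negPf->.
Qed.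

End Completeness.
End Instance.
End Tableau.

(** * From clauses to cuts *)

Section Encoding.
Variable M : machine.
Hypothesis M_free : oracle_free M.

Notation cell_var := (datum M + rule M)%type.

Definition block_size : nat := #|{: cell_var}|.

Section Numbering.
(* [wd] is the number of columns. *)
Variable wd : nat.

(** The number is an arithmetic expression in the time and the column, so that the emission loops
    can compute it. The positive literals of [NTrue] and [NOut] become the vertices 0 and 2. *)
Definition num (nm : name M) : nat :=
  match nm with
  | NTrue => 0
  | NOut => 1
  | NCell t j r => ((t * wd + j) * block_size + enum_rank r).+2
  end.

Definition a_var : cell_var := inr (inr (inr (inr (inr (inr (inl tt)))))).

Lemma block_size_gt0 : 0 < block_size.
Proof. by apply/card_gt0P; exists a_var. Qed.

Definition denum (k : nat) : name M :=
  match k with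
  | 0 => NTrue M
  | 1 => NOut M
  | k.+2 => NCell (k %/ block_size %/ wd) ((k %/ block_size) %% wd)
              (nth a_var (enum {: cell_var}) (k %% block_size))
  end.

Definition name_ok (T : nat) (nm : name M) : bool :=
  if nm is NCell t j _ then (t <= T) && (j < wd) else true.

Lemma numK T nm : name_ok T nm -> denum (num nm) = nm.
Proof.
case: nm => //= t j r /andP[_ lt_j].
have lt_r : enum_rank r < block_size by apply: ltn_ord.
have wd_gt0 : 0 < wd by apply: leq_ltn_trans lt_j.
have Ebs : ((t * wd + j) * block_size + enum_rank r) %/ block_size = t * wd + j.
  by rewrite divnMDl ?block_size_gt0 // divn_small // addn0.
rewrite Ebs divnMDl // (divn_small lt_j) addn0 !modnMDl (modn_small lt_j).
by rewrite (modn_small lt_r) nth_enum_rank.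
Qed.

Definition nvars T : nat := (T.+1 * wd * block_size).+2.

Lemma num_lt T nm : name_ok T nm -> num nm < nvars T.
Proof.
case: nm => //= t j r /andP[le_t lt_j]; rewrite /nvars !ltnS.
have lt_r : enum_rank r < block_size by apply: ltn_ord.
apply: (@leq_trans ((t * wd + j).+1 * block_size)); first by rewrite mulSn addnC ltn_add2r.
by rewrite leq_mul2r; apply/orP; right; nia.
Qed.

Definition vertex_of (l : literal M) : nat := (num l.1).*2 + ~~ l.2.
Definition negate (l : literal M) : literal M := (l.1, ~~ l.2).

Lemma vertex_of_lt T l : name_ok T l.1 -> vertex_of l < (nvars T).*2.
Proof. by move=> /num_lt; rewrite /vertex_of; case: l.2; lia. Qed.

Lemma odd_vertex_of l : odd (vertex_of l) = ~~ l.2.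
Proof. by rewrite oddD odd_double; case: l.2. Qed.

Lemma vertex_of_half l : (vertex_of l)./2 = num l.1.
Proof.
by rewrite /vertex_of addnC half_bit_double.
Qed.

(* With [s] the splitting literal of the clause [a || b || c], the six edges
   express that [a, b, s] are not all equal, and that [~ s, c, False] are not
   all equal: such a triangle has one cut edge, or three. *)
Definition clause_edges S (k : nat * nat * rule M) : seq (nat * nat) :=
  let: (a, b, c) := clause_of S k.1.1 k.1.2 k.2 in
  let s := (NCell k.1.1 k.1.2 (inr k.2), true) in
  [:: (vertex_of a, vertex_of (negate b)); (vertex_of b, vertex_of (negate s));
      (vertex_of a, vertex_of (negate s));
      (vertex_of (negate s), vertex_of (negate c));
      (vertex_of c, 0); (vertex_of (negate s), 0)].

Definition rule_ok T S (k : nat * nat * rule M) : bool :=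
  let: (a, b, c) := clause_of S k.1.1 k.1.2 k.2 in
  [&& name_ok T a.1, name_ok T b.1, name_ok T c.1 & name_ok T (NCell k.1.1 k.1.2 (inr k.2))].

(** These facts keep the gadget free of loops: equal signs prevent [a] from being the negation of
    [b], no literal is a splitting variable, and [c] is not a truth constant. *)
Lemma clause_of_shape S t j r :
  let: (a, b, c) := clause_of (M := M) S t j r in
  [/\ a.2 = b.2, if a.1 is NCell _ _ (inr _) then false else true,
      if b.1 is NCell _ _ (inr _) then false else true &
      if c.1 is NCell _ _ (inl _) then true else false].
Proof.
by case: r => [[z l]|[[[z l] m]|[[[[z l] m] r]|[[[b s] s']|[s|[[]|[[]|[[]|g]]]]]]]].
Qed.

Lemma vertex_of_neq T a b : name_ok T a.1 -> name_ok T b.1 -> a <> b ->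
  vertex_of a != vertex_of b.
Proof.
case: a b => [n1 b1] [n2 b2] /= ok1 ok2 ne; apply/negP=> /eqP E; case: ne.
have := congr1 odd E; rewrite !odd_vertex_of /= => /negb_inj ->.
by have := congr1 half E; rewrite !vertex_of_half /= => /(congr1 denum);
  rewrite (numK ok1) (numK ok2) => ->.
Qed.

Lemma clause_edges_ok T S k : rule_ok T S k ->
  simple_pairs (nvars T).*2 (clause_edges S k).
Proof.
case: k => [[t j] r]; rewrite /rule_ok /clause_edges /=.
have := clause_of_shape S t j r; case: (clause_of _ _ _ _) => [[a b] c] /=.
case=> sab sa sb sc /and4P[oka okb okc oks].
have lt0 : 0 < (nvars T).*2 by [].
rewrite /simple_pairs /= !(@vertex_of_lt T) // ?lt0 /= ?andbT; apply/and5P; split.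
- apply: (@vertex_of_neq T) => //; case: a b sab {sa sb oka okb} => [n1 b1] [n2 b2] /= ->.
  by case=> _; case: b2.
- by apply: (@vertex_of_neq T) => // E; rewrite E in sb.
- by apply: (@vertex_of_neq T) => // E; rewrite E in sa.
- by apply: (@vertex_of_neq T) => // -[E _]; rewrite -E in sc.
- by rewrite -[X in _ != X]/(vertex_of (NTrue M, true)); apply: (@vertex_of_neq T) => // E; rewrite E in sc.
Qed.

Section Cut.
Variables (T S : nat) (sigma : nat -> bool) (v : name M -> bool).
Hypothesis v_true : v (NTrue M).
Hypothesis sigmaE : forall l, name_ok T l.1 -> sigma (vertex_of l) = holds v l.

Let sigma0 : sigma 0 = true.
Proof. by rewrite -[0]/(vertex_of (NTrue M, true)) sigmaE // /holds /= v_true. Qed.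

Let holds_negate l : holds v (negate l) = ~~ holds v l.
Proof. by rewrite /holds /=; case: (v _); case: l.2. Qed.

Let cut_clauseE t j r : rule_ok T S (t, j, r) ->
  let: (a, b, c) := clause_of S t j r in
  cut sigma (clause_edges S (t, j, r)) =
  let s := v (NCell t j (inr r)) in
  (holds v a == holds v b) + (holds v b == s) + (holds v a == s) +
  (s != holds v c) + ~~ holds v c + s.
Proof.
rewrite /rule_ok /clause_edges /=; case: (clause_of _ _ _ _) => [[a b] c] /=.
case/and4P=> oka okb okc oks.
rewrite /cut !big_cons big_nil /= !sigma0 !sigmaE // !holds_negate.
rewrite /holds /= !eqb_id; set s := v (NCell _ _ _).
by case: (_ == a.2); case: (_ == b.2); case: (_ == c.2); case: s.
Qed.

(** If [a], [b] and [c] are false, a cheap first triangle forces the splitting literal to be true,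
    and then the second triangle has three equal literals; either way one triangle costs 3 instead
    of 1. *)
Lemma cut_clause_ge k : rule_ok T S k ->
  2 + (if sat S v k then 0 else 2) <= cut sigma (clause_edges S k).
Proof.
case: k => [[t j] r] ok; have := cut_clauseE ok; rewrite /sat /=.
case: (clause_of _ _ _ _) => [[a b] c] ->.
by case: (holds v a); case: (holds v b); case: (holds v c); case: (v _).
Qed.

Lemma cut_clause_eq k : rule_ok T S k -> sat S v k ->
  v (NCell k.1.1 k.1.2 (inr k.2)) =
    ~~ (holds v (clause_of S k.1.1 k.1.2 k.2).1.1 ||
        holds v (clause_of S k.1.1 k.1.2 k.2).1.2) ->
  cut sigma (clause_edges S k) = 2.
Proof.
case: k => [[t j] r] ok; have := cut_clauseE ok; rewrite /sat /=.
case: (clause_of _ _ _ _) => [[a b] c] /= -> + ->.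
by case: (holds v a); case: (holds v b); case: (holds v c).
Qed.

Definition gadget_edges S (ks : seq (nat * nat * rule M)) : seq (nat * nat) :=
  (0, 2) :: flatten [seq clause_edges S k | k <- ks].

Lemma cut_gadget ks : cut sigma (gadget_edges S ks) =
  ~~ v (NOut M) + \sum_(k <- ks) cut sigma (clause_edges S k).
Proof.
rewrite /cut big_cons big_flatten_nat big_map /= sigma0; congr (_ + _).
by rewrite -[2]/(vertex_of (NOut M, true)) sigmaE // /holds /=; case: (v _).
Qed.

Lemma cut_gadget_ge ks : all (rule_ok T S) ks ->
  ~~ v (NOut M) + 2 * size ks + (if all (sat S v) ks then 0 else 2) <=
  cut sigma (gadget_edges S ks).
Proof.
move=> ok; rewrite cut_gadget -addnA leq_add2l.
elim: ks ok => [|k ks IH] /=; first by rewrite big_nil.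
case/andP=> /cut_clause_ge ge_k /IH ge_ks; rewrite big_cons.
by move: ge_k ge_ks; case: (sat S v k); case: (all _ _) => /=; lia.
Qed.

Lemma cut_gadget_eq ks : all (rule_ok T S) ks -> all (sat S v) ks ->
  (forall t j r, v (NCell t j (inr r)) =
    ~~ (holds v (clause_of S t j r).1.1 || holds v (clause_of S t j r).1.2)) ->
  cut sigma (gadget_edges S ks) = ~~ v (NOut M) + 2 * size ks.
Proof.
move=> ok sats aux; rewrite cut_gadget; congr (_ + _).
elim: ks ok sats => [|k ks IH] /=; first by rewrite big_nil.
case/andP=> okk okks /andP[satk satks]; rewrite big_cons IH // cut_clause_eq //.
by rewrite mulnS.
Qed.

End Cut.

Lemma gadget_edges_ok T S ks : all (rule_ok T S) ks ->
  simple_pairs (nvars T).*2 (gadget_edges S ks).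
Proof.
move=> ok; rewrite /gadget_edges /simple_pairs /=.
elim: ks ok => //= k ks IH /andP[okk /IH okks].
by rewrite all_cat okks andbT; apply: clause_edges_ok.
Qed.

(** Six heavy copies go with the six edges of each clause and two with the acceptance edge, so the
    multiplicity exceeds the number of light edges by one. Interleaving them lets the loops that
    emit the clauses produce the copies, without computing the number of clauses. *)
Definition graph_edges m S (ks : seq (nat * nat * rule M)) : seq (nat * nat) :=
  (0, 2) :: cocktail m ++ cocktail m ++
  flatten [seq clause_edges S k ++ flatten (nseq 6 (cocktail m)) | k <- ks].

Lemma size_gadget_edges S ks : size (gadget_edges S ks) = 1 + 6 * size ks.
Proof.
rewrite /gadget_edges /= size_flatten /shape -map_comp.
elim: ks => //= k ks IH; rewrite mulnS -addnS; move: IH; rewrite /clause_edges /=.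
by case: (clause_of _ _ _ _) => [[a b] c] /=; lia.
Qed.

Lemma sum_graph_edges m S ks (g : nat * nat -> nat) :
  \sum_(uv <- graph_edges m S ks) g uv =
  (2 + 6 * size ks) * (\sum_(uv <- cocktail m) g uv) +
  \sum_(uv <- gadget_edges S ks) g uv.
Proof.
rewrite /graph_edges /gadget_edges !big_cons !big_cat /=.
set C := \sum_(uv <- cocktail m) g uv.
have -> : \sum_(uv <- flatten [seq clause_edges S k ++ flatten (nseq 6 (cocktail m)) | k <- ks]) g uv
   = size ks * (6 * C) + \sum_(uv <- flatten [seq clause_edges S k | k <- ks]) g uv.
  elim: ks => [|k ks IH]; first by rewrite !big_nil.
  rewrite /= !big_cat /= IH big_nil -/C [(size ks).+1 * _]mulSn.
  set X := \sum_(_ <- clause_edges _ _) _; set Y := \sum_(_ <- flatten _) _.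
  by move: (size ks * _) => Z; lia.
have -> : (2 + 6 * size ks) * C = 2 * C + size ks * (6 * C).
  by rewrite mulnDl -mulnA [in RHS]mulnCA.
by set Y := \sum_(_ <- flatten _) _; move: (size ks * _) => Z; lia.
Qed.

Lemma cocktail_ok m : simple_pairs m.*2 (cocktail m).
Proof.
apply/allP=> uv /flattenP[s /mapP[j]]; rewrite mem_iota => /andP[_ lt_j] ->.
case/flattenP=> s' /mapP[i]; rewrite mem_iota => /andP[_ lt_i] ->.
rewrite /block_edges !inE.
by do 7!(case/orP=> [/eqP->|]; first by rewrite /=; lia); move/eqP->; rewrite /=; lia.
Qed.

Lemma graph_edges_ok T S ks : all (rule_ok T S) ks ->
  simple_pairs (nvars T).*2 (graph_edges (nvars T) S ks).
Proof.
move=> ok; have cok := cocktail_ok (nvars T).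
have cat_ok a b : simple_pairs (nvars T).*2 (a ++ b) =
    simple_pairs (nvars T).*2 a && simple_pairs (nvars T).*2 b by apply: all_cat.
have ok6 : simple_pairs (nvars T).*2 (flatten (nseq 6 (cocktail (nvars T)))).
  by rewrite /simple_pairs all_flatten all_nseq; apply/orP; right.
rewrite /graph_edges (cat_ok [:: (0, 2)]) 2!(cat_ok (cocktail _)) cok /=.
elim: ks ok => // k ks IH /= /andP[okk /IH okks].
rewrite (cat_ok (clause_edges _ _ ++ _)) (cat_ok (clause_edges _ _)) okks.
by rewrite clause_edges_ok // ok6.
Qed.

End Numbering.

Section Instance.
Variables (x : seq bool) (T P : nat).
Let n := size x.
Let R := T + n + P.
Let S := center R.
Let wd := R.+2 + R.+1.
Let ks := rules M x T P.

Let shape j (r : rule M) : bool :=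
  match r with
  | inr (inr (inr (inr (inr (inr (inr (inl _))))))) => j.+1 < wd
  | inr (inr (inr _)) => j < wd
  | _ => false
  end.

Let ok_cell j rs : all (shape j) rs -> all (rule_ok wd T S) (at_cell 0 j rs).
Proof.
move=> /allP sh; rewrite all_map; apply/allP=> r /sh; rewrite /rule_ok /=.
case: r => [[z l]|[[[z l] m]|[[[[z l] m] r]|[[[b s] s']|[s|[[]|[[]|[[]|g]]]]]]]] //= lt_j;
  by rewrite ?lt_j ?(ltnW lt_j).
Qed.

Let shape_init j b : j < wd -> all (shape j) (init_rules M b).
Proof. by move=> lt_j; apply/allP=> r /mapP[s _ ->]. Qed.

Lemma rules_ok : all (rule_ok wd T S) ks.
Proof.
have cons_all (p : pred (seq (nat * nat * rule M))) a s :
  all p (a :: s) = p a && all p s by [].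
rewrite all_cat [X in _ && X]all_flatten /pre_parts !cons_all.
apply/and5P; split; last (apply/and5P; split; last (apply/andP; split => //)).
- apply: all_loop => i lt_i; apply: ok_cell; rewrite /= /wd /center.
  by rewrite /R /n; lia.
- apply: all_loop => t lt_t; apply: all_loop => j lt_j; rewrite all_map.
  have ltS : S < wd by rewrite /S /wd /center; lia.
  have [lt1 lt2] : j.+1 < wd /\ j.+2 < wd by rewrite /wd; split; lia.
  have lt0 : j < wd by apply: ltnW.
  have le_t : t <= T by apply: ltnW.
  apply/allP=> r; rewrite !mem_cat => /or3P[] /mapP[p _ ->]; rewrite /rule_ok /=.
  + by case: p => z l; rewrite /= le_t ltS lt0.
  + by case: p => [[z l] m]; rewrite /= le_t lt0 lt1.
  + by case: p => [[[z l] m] r']; rewrite /= le_t lt_t lt0 lt1 lt2.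
- apply: all_loop => j lt_j; apply: ok_cell; rewrite all_cat shape_init /= /wd; lia.
- by apply: ok_cell; apply: shape_init; rewrite /wd /center; lia.
- by apply: all_loop => i lt_i; apply: ok_cell; apply: shape_init; rewrite /wd /center; lia.
- apply: all_loop => i lt_i; apply: ok_cell; rewrite /= /wd /center.
  by rewrite /R; move: lt_i; rewrite /n; lia.
- apply: all_loop => i lt_i; apply: ok_cell; rewrite /= /wd /center.
  by rewrite /R; lia.
- apply: all_loop => i lt_i; apply: ok_cell; rewrite /= /wd /center.
  by rewrite /R; move: lt_i; rewrite /n; lia.
- rewrite all_map; apply/allP=> r /mapP[g _ ->]; rewrite /rule_ok /= leqnn.
  by rewrite /S /wd /center /=; lia.
Qed.

Let m := nvars wd T.
Let H := gadget_edges wd S ks.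

Definition certified : Prop :=
  exists2 y, size y <= P & verdict (cstate (run M x y T)) = Some true.

Let sigma_of (v : name M -> bool) (u : nat) : bool := v (denum wd u./2) == ~~ odd u.

Let sigma_of_mate v u : sigma_of v (mate u) = ~~ sigma_of v u.
Proof.
have half_u : (mate u)./2 = u./2.
  by have := odd_double_half u; rewrite /mate; case: (odd u); lia.
by rewrite /sigma_of half_u odd_mate; case: (v _); case: (odd u).
Qed.

Let sigma_of_vertex v l : name_ok wd T l.1 -> sigma_of v (vertex_of wd l) = holds v l.
Proof.
move=> ok; rewrite /sigma_of vertex_of_half (numK ok) odd_vertex_of negbK.
by [].
Qed.

(** A cut is unchanged when all values are flipped; the condition [sigma 0] selects the assignment
    in which the literal True is true. *)
Lemma optimal_cut sigma :
  (forall u, u < m.*2 -> sigma (mate u) = ~~ sigma u) -> sigma 0 ->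
  (forall sigma', (forall u, u < m.*2 -> sigma' (mate u) = ~~ sigma' u) ->
     cut sigma H <= cut sigma' H) ->
  (sigma 2 <-> certified).
Proof.
move=> sm s0 opt; pose v nm := sigma (num wd nm).*2.
have sigmaE l : name_ok wd T l.1 -> sigma (vertex_of wd l) = holds v l.
  case: l => nm b /= ok; rewrite /vertex_of /holds /v /=.
  have lt_nm : (num wd nm).*2 < m.*2 by rewrite ltn_double; apply: num_lt ok.
  case: b => /=; first by rewrite addn0 eqb_id.
  have := sm _ lt_nm; rewrite /mate odd_double addn1 => ->.
  by case: (sigma _).
have v_true : v (NTrue M) = true by [].
have ok := rules_ok.
have v_out : v (NOut M) = sigma 2 by [].
have upper y : size y <= P -> cut sigma H <=
    ~~ (verdict (cstate (run M x y T)) == Some true) + 2 * size ks.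
  move=> le_y; pose w := @run_valuation M x T P y.
  have le1 := opt (sigma_of w) (fun u _ => sigma_of_mate w u).
  apply: (leq_trans le1).
  rewrite /H (@cut_gadget_eq wd T S _ w) //.
  - by rewrite /w run_valuation_out.
  - by move=> l; apply: sigma_of_vertex.
  - exact: completeness.
  - exact: run_valuation_aux.
have lower := cut_gadget_ge v_true sigmaE ok; rewrite -/H v_out in lower.
(* The empty certificate bounds the optimum by [1 + 2 * size ks], which leaves no room for the
   additional 2 of a violated clause. *)
have sats : all (sat S v) ks.
  have := upper [::] isT; move: lower; case: (all _ _) => //.
  by case: (_ == _); case: (sigma 2); lia.
split=> [s2|[y le_y acc]].
  by apply: (@soundness M M_free x T P v); rewrite // v_out.
have := upper y le_y; move: lower; rewrite acc eqxx sats.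
by case: (sigma 2) => //; lia.
Qed.

End Instance.
End Encoding.

(** * Writing the instance *)

Lemma adder_eq d e e' : e =1 e' -> adder d e -> adder d e'.
Proof. by move=> /functional_extensionality ->. Qed.

Lemma emitter_eq d F F' : F =1 F' -> emitter d F -> emitter d F'.
Proof. by move=> /functional_extensionality ->. Qed.

Lemma adder_succ d e : adder d e -> adder d (fun r => (e r).+1).
Proof. exact: (adder_add (adder_const d 1)). Qed.

Lemma adder_double d e : adder d e -> adder d (fun r => (e r).*2).
Proof.
by move=> ad; apply: adder_eq (adder_add ad ad) => r; rewrite addnn.
Qed.

Lemma adder_horner d e (p : {poly nat}) : adder d e -> adder d (fun r => p.[e r]%R).
Proof.
move=> ad; rewrite /horner; elim: (polyseq p) => [|a s IH] /=.
  exact: adder_const.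
exact: adder_add (adder_mul IH ad) (adder_const d a).
Qed.

(** The form used below of [emitter_for], with the loop variable as an ordinary parameter of the
    body. *)
Lemma emitter_loop d e (G : (nat -> nat) -> nat -> seq nat) :
  adder d e -> (forall r r' i, agree d r r' -> G r i = G r' i) ->
  emitter d.+1 (fun r => G r (r d)) ->
  emitter d (fun r => flatten [seq G r i | i <- iota 0 (e r)]).
Proof.
move=> ad extG em; apply: emitter_eq (emitter_for ad em) => r.
congr flatten; apply: eq_map => i; rewrite {2}/upd eqxx.
by apply: extG => j lt_j; rewrite /upd; case: eqP => // ?; lia.
Qed.

Lemma pair_names_cat a b : pair_names (a ++ b) = pair_names a ++ pair_names b.
Proof. by rewrite /pair_names map_cat flatten_cat. Qed.

Lemma pair_names_flatten s : pair_names (flatten s) = flatten (map pair_names s).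
Proof. by elim: s => //= a s IH; rewrite pair_names_cat IH. Qed.

Lemma emitter_pair d u v : adder d u -> adder d v ->
  emitter d (fun r => pair_names [:: (u r, v r)]).
Proof. by move=> au av; apply: (emitter_cat (emitter_num au) (emitter_num av)). Qed.

Lemma emitter_pairs d u v E : adder d u -> adder d v ->
  emitter d (fun r => pair_names (E r)) ->
  emitter d (fun r => pair_names ((u r, v r) :: E r)).
Proof. by move=> au av; apply: (emitter_cat (emitter_pair au av)). Qed.

Lemma emitter_cocktail d e : 0 < d -> adder d e ->
  emitter d (fun r => pair_names (cocktail (e r))).
Proof.
move=> d0 ad.
apply: (@emitter_eq _ (fun r => flatten [seq flatten
    [seq pair_names (block_edges i j) | i <- iota 0 j] | j <- iota 0 (e r)])).
  move=> r; rewrite /cocktail pair_names_flatten -map_comp; congr flatten.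
  by apply: eq_map => j /=; rewrite pair_names_flatten -map_comp.
apply: (emitter_loop (G := fun _ j => flatten
  [seq pair_names (block_edges i j) | i <- iota 0 j])) => //.
have var_d : adder d.+1 (fun r => r d) by apply: adder_var; lia.
apply: (emitter_loop (G := fun r i => pair_names (block_edges i (r d)))) => //.
  by move=> r r' i ag; rewrite ag //; lia.
have ai : adder d.+2 (fun r => r d.+1) by apply: adder_var; lia.
have aj : adder d.+2 (fun r => r d) by apply: adder_var; lia.
have [ai0 aj0] := (adder_double ai, adder_double aj).
have [ai1 aj1] := (adder_succ ai0, adder_succ aj0).
by do 8 (apply: emitter_pairs => //); apply: emitter_nil.
Qed.

Section Emission.
Variables (M : machine) (p : {poly nat}).

Definition cert_bound n : nat := p.[n]%R.
(** Sufficient for every certificate of length at most [cert_bound n], by monotonicity of [p]. *)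
Definition time_bound n : nat := p.[n + cert_bound n]%R.
Definition radius n := time_bound n + n + cert_bound n.
Definition width n := (radius n).+2 + (radius n).+1.
Definition nvertex_pairs n := nvars M (width n) (time_bound n).

(* The input, reversed or not, is split between registers 1 and 2. *)
Definition input_size (r : nat -> nat) := r 1 + r 2.

Section Adders.
Variable d : nat.
Hypothesis d_gt2 : 2 < d.

Lemma adder_input_size : adder d input_size.
Proof. by apply: adder_add; apply: adder_var; lia. Qed.

Lemma adder_cert_bound : adder d (fun r => cert_bound (input_size r)).
Proof. exact: adder_horner adder_input_size. Qed.

Lemma adder_time_bound : adder d (fun r => time_bound (input_size r)).
Proof. exact: adder_horner (adder_add adder_input_size adder_cert_bound). Qed.

Lemma adder_radius : adder d (fun r => radius (input_size r)).
Proof.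
exact: adder_add (adder_add adder_time_bound adder_input_size) adder_cert_bound.
Qed.

Lemma adder_center : adder d (fun r => center (radius (input_size r))).
Proof. exact: adder_succ adder_radius. Qed.

Lemma adder_width : adder d (fun r => width (input_size r)).
Proof.
have ad := adder_succ adder_radius.
exact: adder_add (adder_succ ad) ad.
Qed.

Lemma adder_nvertex_pairs : adder d (fun r => nvertex_pairs (input_size r)).
Proof.
do 2 apply: adder_succ; apply: adder_mul (adder_const _ _).
exact: adder_mul (adder_succ adder_time_bound) adder_width.
Qed.

Lemma adder_vertex t j c b : adder d t -> adder d j ->
  adder d (fun r => vertex_of (width (input_size r))
                      (NCell (t r) (j r) c : name M, b)).
Proof.
move=> at_ aj; apply: adder_add (adder_const _ _); apply: adder_double.
do 2 apply: adder_succ; apply: adder_add (adder_const _ _).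
apply: adder_mul (adder_const _ _); apply: adder_add aj.
exact: adder_mul at_ adder_width.
Qed.

Lemma adder_vertex_out b : adder d (fun r => vertex_of (width (input_size r)) (NOut M, b)).
Proof. exact: adder_const. Qed.

End Adders.

Definition clause_out n t j (rl : rule M) : seq nat :=
  pair_names (clause_edges (width n) (center (radius n)) (t, j, rl) ++
              flatten (nseq 6 (cocktail (nvertex_pairs n)))).

(** For a fixed machine [M] there are finitely many rules, so the rule is a parameter of the
    program; only the time and the column are computed at run time. *)
Lemma emitter_clause d t j rl : 2 < d -> adder d t -> adder d j ->
  emitter d (fun r => clause_out (input_size r) (t r) (j r) rl).
Proof.
move=> d2 at_ aj; have d0 : 0 < d by lia.
have tail : emitter d (fun r =>
    pair_names (flatten (nseq 6 (cocktail (nvertex_pairs (input_size r)))))).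
  have em := emitter_cocktail d0 (adder_nvertex_pairs d2).
  elim: 6 => [|k IH] /=; first exact: emitter_nil.
  apply: emitter_eq (emitter_cat em IH) => r.
  exact: esym (pair_names_cat _ _).
apply: emitter_eq (fun r => esym (pair_names_cat _ _)) _.
apply: emitter_cat tail; rewrite /clause_edges.
have az := adder_center d2.
have [aj1 at1] := (adder_succ aj, adder_succ at_); have aj2 := adder_succ aj1.
by case: rl => [[z l]|[[[z l] m]|[[[[z l] m] g]|[[[b s] s']|[s|[[]|[[]|[[]|g]]]]]]]] /=;
  do 6 (apply: emitter_pairs;
        [first [exact: adder_vertex | exact: adder_vertex_out]
        |first [exact: adder_const | exact: adder_vertex | exact: adder_vertex_out]
        |]); apply: emitter_nil.
Qed.

Definition clauses_out n (ks : seq (nat * nat * rule M)) : seq nat :=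
  flatten [seq clause_out n k.1.1 k.1.2 k.2 | k <- ks].

Lemma clauses_out_cat n a b : clauses_out n (a ++ b) = clauses_out n a ++ clauses_out n b.
Proof. by rewrite /clauses_out map_cat flatten_cat. Qed.

Lemma clauses_out_flatten n s : clauses_out n (flatten s) = flatten (map (clauses_out n) s).
Proof. by elim: s => //= a s IH; rewrite clauses_out_cat IH. Qed.

Lemma emitter_cell d t j rs : 2 < d -> adder d t -> adder d j ->
  emitter d (fun r => clauses_out (input_size r) (at_cell (t r) (j r) rs)).
Proof.
move=> d2 at_ aj; elim: rs => [|rl rs IH]; first exact: emitter_nil.
exact: emitter_cat (emitter_clause _ d2 at_ aj) IH.
Qed.

Lemma emitter_parts d (K : (nat -> nat) -> seq (nat * nat * rule M)) Ks :
  emitter d (fun r => clauses_out (input_size r) (K r)) ->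
  emitter d (fun r => flatten (map (clauses_out (input_size r)) (Ks r))) ->
  emitter d (fun r => flatten (map (clauses_out (input_size r)) (K r :: Ks r))).
Proof. exact: emitter_cat. Qed.

Lemma emitter_column_loop e f rs :
  adder 3 e -> adder 4 (fun r => f (input_size r) (r 3)) ->
  emitter 3 (fun r => clauses_out (input_size r)
    (flatten [seq at_cell 0 (f (input_size r) i) rs | i <- iota 0 (e r)])).
Proof.
move=> ae af.
apply: (@emitter_eq _ (fun r => flatten
  [seq clauses_out (input_size r) (at_cell 0 (f (input_size r) i) rs) | i <- iota 0 (e r)])).
  by move=> r; rewrite clauses_out_flatten -map_comp.
apply: (emitter_loop (G := fun r i => clauses_out (input_size r)
  (at_cell 0 (f (input_size r) i) rs))) => //.
  by move=> r r' i ag; rewrite /input_size !ag.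
exact: (emitter_cell rs _ (adder_const _ _) af).
Qed.

Lemma emitter_pre_rules : emitter 3 (fun r => clauses_out (input_size r)
  (pre_rules M (radius (input_size r)) (input_size r) (time_bound (input_size r))
     (cert_bound (input_size r)))).
Proof.
have n3 := adder_input_size (isT : 2 < 3).
have R3 := adder_radius (isT : 2 < 3).
have T3 := adder_time_bound (isT : 2 < 3).
have P3 := adder_cert_bound (isT : 2 < 3).
have [n4 S4] := (adder_input_size (isT : 2 < 4), adder_center (isT : 2 < 4)).
have P4 := adder_cert_bound (isT : 2 < 4).
have i4 : adder 4 (fun r => r 3) by apply: adder_var.
apply: emitter_eq (fun r => esym (clauses_out_flatten _ _)) _.
rewrite /pre_parts.
refine (emitter_parts _ (emitter_parts _ (emitter_parts _ (emitter_parts _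
  (emitter_parts _ (emitter_parts _ (emitter_parts _ (emitter_parts _
  _)))))))); last exact: emitter_nil.
- apply: (@emitter_eq _ (fun r => flatten [seq flatten
    [seq clauses_out (input_size r) (at_cell t j (step_rules M))
      | j <- iota 0 (radius (input_size r) + radius (input_size r)).+1]
      | t <- iota 0 (time_bound (input_size r))])).
    move=> r; rewrite clauses_out_flatten -map_comp; congr flatten.
    by apply: eq_map => t; rewrite [RHS]clauses_out_flatten -map_comp.
  apply: (emitter_loop (G := fun r t => flatten
    [seq clauses_out (input_size r) (at_cell t j (step_rules M))
      | j <- iota 0 (radius (input_size r) + radius (input_size r)).+1])) => //.
    by move=> r r' i ag; rewrite /input_size !ag.
  have R4 := adder_radius (isT : 2 < 4).
  apply: (emitter_loop (G := fun r j =>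
    clauses_out (input_size r) (at_cell (r 3) j (step_rules M)))).
  + exact: adder_succ (adder_add R4 R4).
  + by move=> r r' i ag; rewrite /input_size !ag.
  + by apply: emitter_cell => //; apply: adder_var.
- exact: (emitter_column_loop (f := fun _ j => j) _ (adder_succ R3)).
- exact: emitter_cell (adder_const _ _) (adder_center _).
- apply: (emitter_column_loop (f := fun n i => center (radius n) + i.+1)).
    exact: adder_succ R3.
  exact: adder_add S4 (adder_succ i4).
- apply: (emitter_column_loop (f := fun n i => center (radius n) + (n + i))).
    exact: adder_succ (adder_succ (adder_add T3 P3)).
  exact: adder_add S4 (adder_add n4 i4).
- apply: (emitter_column_loop (f := fun n i => center (radius n) + i)) => //.
  exact: adder_add S4 i4.
- apply: (emitter_column_loop (f := fun n i => center (radius n) + (cert_bound n + i))).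
    exact: adder_succ (adder_succ (adder_add T3 n3)).
  exact: adder_add S4 (adder_add P4 i4).
- exact: emitter_cell T3 (adder_center _).
Qed.

(* While the bits of the input move from register 2 back to register 1, the
   size of register 2 is the position of the last one moved. *)
Definition bit_out n a b := clauses_out n
  (at_cell 0 (center (radius n) + a)
     [:: inr (inr (inr (inr (inl (Some b))))) : rule M]).

Lemma emitter_bit b : emitter 3 (fun r => bit_out (input_size r) (r 2) b).
Proof.
apply: emitter_cell => //; first exact: adder_const.
by apply: adder_add; [apply: adder_center | apply: adder_var].
Qed.

Definition header_out n : seq nat :=
  [:: (nvertex_pairs n).*2, (nvertex_pairs n).+1 &
      pair_names ((0, 2) :: cocktail (nvertex_pairs n) ++ cocktail (nvertex_pairs n))].

Lemma emitter_header : emitter 3 (fun r => header_out (input_size r)).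
Proof.
have am := adder_nvertex_pairs (isT : 2 < 3).
apply: emitter_cat (emitter_num (adder_double am)) _.
apply: emitter_cat (emitter_num (adder_succ am)) _.
apply: emitter_pairs; try exact: adder_const.
apply: emitter_eq (fun r => esym (pair_names_cat _ _)) _.
by apply: emitter_cat; apply: emitter_cocktail.
Qed.

Definition instance_out (x : seq bool) : seq nat :=
  let n := size x in
  instance (nvertex_pairs n)
    (graph_edges (width n) (nvertex_pairs n) (center (radius n))
       (rules M x (time_bound n) (cert_bound n))).

Lemma instance_outE x : let n := size x in
  instance_out x = header_out n ++
    flatten [seq bit_out n a (nth false x a) | a <- iota 0 n] ++
    clauses_out n (pre_rules M (radius n) n (time_bound n) (cert_bound n)).
Proof.
set n := size x; rewrite /instance_out /instance -/n /header_out /graph_edges.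
rewrite [RHS]cat_cons [X in _ = _ :: X]cat_cons; congr [:: _, _ & _].
rewrite -cat1s [cocktail _ ++ _ ++ _]catA -[in RHS]cat1s !pair_names_cat -!catA.
congr (_ ++ (_ ++ (_ ++ _))).
have outE ks : pair_names (flatten [seq clause_edges (width n) (center (radius n)) k ++
    flatten (nseq 6 (cocktail (nvertex_pairs n))) | k <- ks]) = clauses_out n ks.
  rewrite pair_names_flatten -map_comp; apply: (congr1 flatten).
  by apply: eq_map => -[[t j] rl].
rewrite outE /rules clauses_out_cat; congr (_ ++ _).
by rewrite clauses_out_flatten -map_comp.
Qed.

(** The only place where the content of the input matters. Blocks are written last first, so the
    input is consumed from its last bit, which is on top of the reversed copy. *)
Lemma exec_bits : exists c C, poly_bounded C /\
  forall s x, s 2 = rev x -> s 1 = [::] -> (forall i, 2 < i -> s i = [::]) ->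
  ex c s (C (size x)) (upd (upd (upd s 2 [::]) 1 x) 0
    (encode (flatten [seq bit_out (size x) a (nth false x a) | a <- iota 0 (size x)])
       ++ s 0)).
Proof.
have [ext0 [c0 [C0 [pC0 ex0]]]] := emitter_bit false.
have [ext1 [c1 [C1 [pC1 ex1]]]] := emitter_bit true.
exists (While 2 nonempty (If 2 (pred1 (Some true)) (Seq (move1 2 1) c1)
                                                   (Seq (move1 2 1) c0))).
exists (fun n => n * (6 + (C0 n + C1 n)) + 1); split; first by pbound.
move=> s x s2 s1 sd; set n := size x.
pose G a := bit_out n a (nth false x a).
pose st i := upd (upd (upd s 2 (rev (take (n - i) x))) 1 (drop (n - i) x)) 0
  (encode (flatten [seq G a | a <- iota (n - i) i]) ++ s 0).
have E0 : st 0 = s.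
  by rewrite /st subn0 take_size drop_size /=; upds.
have <- : st n = upd (upd (upd s 2 [::]) 1 x) 0
    (encode (flatten [seq G a | a <- iota 0 n]) ++ s 0).
  by rewrite /st subnn take0 drop0.
rewrite -[X in ex _ X]E0.
apply: (ex_While (s := st)) => [i lt_i|i lt_i|].
- by rewrite nonempty_ohead /st /upd /= -size_eq0 size_rev size_takel ?leq_subr // -lt0n subn_gt0.
- set a := n - i.+1; have lt_a : a < n by rewrite /a; lia.
  have Ea : n - i = a.+1 by rewrite /a; lia.
  have st2 : st i 2 = nth false x a :: rev (take a x).
    by rewrite /st /upd /= Ea (take_nth false) // rev_rcons.
  have st1 : st i 1 = drop a.+1 x by rewrite /st /upd /= Ea.
  pose s' := upd (upd (st i) 2 (rev (take a x))) 1 (drop a x).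
  have exm : ex (move1 2 1) (st i) 4 s'.
    apply: ex_eq (ex_move1 _ _) => //; last by rewrite st2.
    by rewrite st2 st1 /= /s' [drop a x](drop_nth false).
  have size1 : size (s' 1) = n - a by rewrite /s' /upd /= size_drop.
  have size2 : size (s' 2) = a by rewrite /s' /upd /= size_rev size_takel // ltnW.
  have s'0 : s' 0 = encode (flatten [seq G a | a <- iota a.+1 i]) ++ s 0.
    by rewrite /s' /st /upd /= Ea.
  have bs : bounded 3 (sizes s') n.
    by case=> [|[|[|k]]] // _; rewrite /sizes ?size1 ?size2; lia.
  have s'd j : 3 <= j -> s' j = [::].
    by case: j => [|[|[|j]]] // _; rewrite /s' /st /upd /= sd.
  have Est b : nth false x a = b -> st i.+1 =
      upd s' 0 (encode (bit_out (input_size (sizes s')) (sizes s' 2) b) ++ s' 0).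
    move=> Eb.
    have -> : bit_out (input_size (sizes s')) (sizes s' 2) b = bit_out n a b.
      by rewrite /input_size /sizes size1 size2 subnK // ltnW.
    rewrite s'0 catA -encode_cat.
    have -> : bit_out n a b ++ flatten [seq G a0 | a0 <- iota a.+1 i] =
        flatten [seq G a0 | a0 <- iota a i.+1] by rewrite /= /G Eb.
    by rewrite /st -/a /s' /st; upds.
  apply: ex_If; rewrite st2 /=.
  apply: (@ex_le _ _ (4 + (C0 n + C1 n))); first by [].
  case Eb: (nth false x a); apply: ex_Seq exm _; rewrite (Est _ Eb).
    by apply: ex_le (ex1 _ _ _ s'd bs) => //; apply: leq_addl.
  by apply: ex_le (ex0 _ _ _ s'd bs) => //; apply: leq_addr.
- by rewrite nonempty_ohead /st /upd /= subnn take0.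
Qed.

Lemma exec_instance : exists c C, poly_bounded C /\
  forall x, ex c (init_stacks x) (C (size x))
    (upd (init_stacks x) 0 (encode (instance_out x))).
Proof.
have [extp [cp [Cp [pCp exp]]]] := emitter_pre_rules.
have [exth [ch [Ch [pCh exh]]]] := emitter_header.
have [cb [Cb [pCb exb]]] := exec_bits.
(* The pieces of the instance are emitted from the last to the first; [move_all] reverses the input
   for [cb], which restores it. *)
exists (Seq (move_all 1 2) (Seq cp (Seq cb ch))).
exists (fun n => (n * 5 + 1) + (Cp n + (Cb n + Ch n))); split; first by pbound.
move=> x; set n := size x; set s := init_stacks x.
have exm := ex_move_all s (isT : 1 != 2).
apply: ex_Seq exm _.
set s1 := upd _ _ _.
have [s11 s12 s10] : [/\ s1 1 = [::], s1 2 = rev x & s1 0 = [::]].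
  by rewrite /s1 /s /init_stacks /upd /= cats0.
have s1d i : 3 <= i -> s1 i = [::].
  by case: i => [|[|[|i]]] // _; rewrite /s1 /s /init_stacks /upd /=.
have bs1 : bounded 3 (sizes s1) n.
  by case=> [|[|[|k]]] // _; rewrite /sizes ?s11 ?s12 ?size_rev.
apply: ex_Seq (exp _ _ isT s1d bs1) _.
have -> : input_size (sizes s1) = n.
  by rewrite /input_size /sizes s11 s12 size_rev.
rewrite s10 cats0; set pre := clauses_out _ _; set s2 := upd _ _ _.
have s2d i : 2 < i -> s2 i = [::] by case: i => // i lt_i; apply: s1d.
apply: ex_Seq (exb s2 x s12 s11 s2d) _.
set s3 := upd _ _ _.
have Es3 i : 0 < i -> s3 i = init_stacks x i.
  by case: i => [|[|[|i]]] // _; rewrite /s3 /s2 /s1 /s /init_stacks /upd /=.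
have s3d i : 3 <= i -> s3 i = [::].
  by case: i => [|[|[|i]]] // _; rewrite Es3.
have bs3 : bounded 3 (sizes s3) n by case=> [|[|[|k]]] // _; rewrite /sizes Es3.
apply: ex_eq (exh _ _ isT s3d bs3).
have -> : input_size (sizes s3) = n.
  by rewrite /input_size /sizes !Es3 //= /init_stacks /upd /= addn0.
apply: functional_extensionality => -[|i]; last by rewrite /upd /= Es3.
rewrite instance_outE -/n (encode_cat (header_out n)) (encode_cat (flatten _)).
have s20 : s2 0 = encode pre by [].
have s30 : s3 0 = encode (flatten [seq bit_out n a (nth false x a) | a <- iota 0 n])
    ++ s2 0 by [].
by rewrite [LHS]/upd eqxx s30 s20.
Qed.

End Emission.

(** * Reading the answer *)

Lemma ex_While_done r (P : pred (option bool)) c s :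
  ~~ P (ohead (s r)) -> ex (While r P c) s 1 s.
Proof. by move=> nP; exists 1 => //; apply: ExDone. Qed.

Lemma ex_While_step r (P : pred (option bool)) c s s1 s2 t1 t2 :
  P (ohead (s r)) -> ex c s t1 s1 -> ex (While r P c) s1 t2 s2 ->
  ex (While r P c) s (t1 + t2).+1 s2.
Proof.
move=> Ps [n1 le1 ex1] [n2 le2 ex2]; exists (n1 + n2).+1; first by lia.
exact: ExLoop ex1 ex2.
Qed.

Definition clear r := While r nonempty (Pop r).

Lemma ex_clear r s : ex (clear r) s (size (s r) * 2 + 1) (upd s r [::]).
Proof.
move E: (s r) => l; elim: l s E => [|b l IH] s E.
  by apply: ex_eq (ex_While_done _ _); [upds | rewrite E].
apply: (@ex_le _ _ (1 + (size l * 2 + 1)).+1); first by rewrite /=; lia.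
apply: ex_While_step (ex_Pop _ _) _; first by rewrite E.
by apply: ex_eq (IH _ _); [upds | rewrite /upd eqxx E].
Qed.

Definition skip_number := Seq (While 0 (pred1 (Some true)) (Pop 0)) (Pop 0).

Lemma ex_skip_number s k w : s 0 = nseq k true ++ false :: w ->
  ex skip_number s (k * 2 + 2) (upd s 0 w).
Proof.
move=> E; apply: (@ex_le _ _ ((k * 2 + 1) + 1)); first by lia.
apply: (@ex_Seq _ _ _ (upd s 0 (false :: w))); last first.
  by apply: ex_eq (ex_Pop _ _); upds.
elim: k s E => [|k IH] s E.
  by apply: ex_eq (ex_While_done _ _); [upds | rewrite E].
apply: (@ex_le _ _ (1 + (k * 2 + 1)).+1); first by lia.
apply: ex_While_step (ex_Pop _ _) _; first by rewrite E.
by apply: ex_eq (IH _ _); [upds | rewrite /upd eqxx E].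
Qed.

Definition read_number r :=
  Seq (While 0 (pred1 (Some true)) (Seq (Pop 0) (Push r true))) (Pop 0).

Lemma ex_read_number r s k w : 0 < r -> s 0 = nseq k true ++ false :: w ->
  ex (read_number r) s (k * 4 + 2) (upd (upd s 0 w) r (nseq k true ++ s r)).
Proof.
move=> r0 E; apply: (@ex_le _ _ ((k * 4 + 1) + 1)); first by lia.
apply: (@ex_Seq _ _ _ (upd (upd s 0 (false :: w)) r (nseq k true ++ s r))); last first.
  by apply: ex_eq (ex_Pop _ _); upds.
elim: k s E => [|k IH] s E.
  by apply: ex_eq (ex_While_done _ _); [upds | rewrite E].
apply: (@ex_le _ _ ((1 + 2) + (k * 4 + 1)).+1); first by lia.
apply: ex_While_step; first by rewrite E.
  exact: ex_Seq (ex_Pop _ _) (ex_Push _ _ _).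
rewrite E /=; set s' := upd _ _ _.
have s'0 : s' 0 = nseq k true ++ false :: w.
  by rewrite /s' /upd (ltn_eqF r0) eqxx.
have s'r : s' r = true :: s r by rewrite /s' /upd eqxx (gtn_eqF r0).
apply: ex_eq (IH _ s'0); rewrite s'r /s'; upds.
by rewrite -cat_rcons -[true :: _]cat1s catA; congr (_ ++ _); elim: (k) => //= n <-.
Qed.

(* Registers 9 to 12 are scratch space, empty before and after. *)
Definition if_same_size r q c :=
  Seq (copy r 9 11) (Seq (copy q 10 11)
  (Seq (While 9 nonempty (Seq (Pop 9) (If 10 nonempty (Pop 10) (Push 12 true))))
  (If 12 nonempty (clear 12) (If 10 nonempty (clear 10) c)))).

Lemma ex_if_same_size r q c s t s' : r < 9 -> q < 9 ->
  (forall i, 8 < i -> s i = [::]) -> ex c s t s' ->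
  ex (if_same_size r q c) s ((size (s r) + size (s q)) * 20 + 20 + t)
     (if size (s r) == size (s q) then s' else s).
Proof.
move=> lt_r lt_q s_gt exc; set kr := size (s r); set kq := size (s q).
(* Each round takes a unit from register 9 and one from register 10 or, once that is empty, adds one
   to register 12; so 10 and 12 end with the two truncated differences, both empty exactly when the
   sizes agree. *)
pose st i := upd (upd (upd s 9 (nseq (kr - i) true)) 10 (nseq (kq - i) true))
               12 (nseq (i - kq) true).
apply: (@ex_le _ _ ((kr * 12 + 2) + ((kq * 12 + 2) + ((kr * 5 + 1) +
   ((kr + kq) * 2 + 2 + t).+1)))); first by lia.
have [s9 s10 s12] : [/\ s 9 = [::], s 10 = [::] & s 12 = [::]].
  by split; apply: s_gt.
have [r9 r11 q10 q11] : [/\ r != 9, r != 11, q != 10 & q != 11] by split; lia.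
apply: ex_Seq; first by apply: ex_copy => //; apply: s_gt.
set s1 := upd s 9 _.
have s1q : s1 q = s q by rewrite /s1 /upd; case: eqP => // ?; lia.
apply: (@ex_Seq _ _ _ (st 0)).
  apply: ex_eq (ex_le _ (ex_copy (s := s1) q10 q11 _ _)) => //.
  - by rewrite s1q /st !subn0 sub0n /s1; upds; rewrite ?s9 ?s10 ?s12 ?cats0.
  - by rewrite s1q.
  - by rewrite /s1 /upd /= s_gt.
apply: (@ex_Seq _ _ _ (st kr)).
  apply: (ex_While (s := st) (t := 4)) => [i lt_i|i lt_i|].
  - by rewrite /st /upd /=; case: (kr - i) (subn_gt0 i kr) => //; rewrite lt_i.
  - apply: (@ex_le _ _ (1 + 3)) => //; apply: ex_Seq (ex_Pop _ _) _; apply: ex_If.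
    have Er : kr - i = (kr - i.+1).+1 by lia.
    set z := upd (st i) 9 _.
    have zE : z = upd (upd (upd s 9 (nseq (kr - i.+1) true)) 10 (nseq (kq - i) true))
                        12 (nseq (i - kq) true).
      apply: functional_extensionality => j; rewrite /z /st /upd Er /=.
      by case: (eqVneq j 9) => [?|_] //; subst j.
    have z10 : z 10 = nseq (kq - i) true by rewrite zE.
    have z12 : z 12 = nseq (i - kq) true by rewrite zE.
    rewrite z10; case: (ltnP i kq) => lt_kq.
      have E : kq - i = (kq - i.+1).+1 by lia.
      have E1 : i - kq = 0 by lia.
      have E2 : i.+1 - kq = 0 by lia.
      rewrite E /=; apply: ex_le (ex_eq _ (ex_Pop _ _)) => //.
      rewrite z10 E zE /st E1 E2.
      apply: functional_extensionality => j; rewrite /upd.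
      by case: (eqVneq j 10) => [?|_] //; subst j.
    have E : kq - i = 0 by lia.
    have E1 : i.+1 - kq = (i - kq).+1 by lia.
    have E2 : kq - i.+1 = 0 by lia.
    rewrite E /=; apply: ex_eq (ex_Push _ _ _).
    rewrite z12 zE /st E E1 E2.
    apply: functional_extensionality => j; rewrite /upd.
    by case: (eqVneq j 12) => [?|_] //; subst j.
  - by rewrite /st /upd /= subnn.
have st12 : st kr 12 = nseq (kr - kq) true by [].
have st10 : st kr 10 = nseq (kq - kr) true by [].
have nonempty_nseq k : nonempty (ohead (nseq k true)) = (0 < k) by case: k.
apply: ex_If; rewrite st12 nonempty_nseq subn_gt0.
have cleared j : j \in [:: 10; 12] ->
    (forall i, i \in [:: 10; 12] -> i != j -> st kr i = [::]) ->
    upd (st kr) j [::] = s.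
  move=> jin others; apply: functional_extensionality => i; rewrite /upd.
  case: (eqVneq i j) => [->|ij].
    by move: jin; rewrite !inE => /orP[] /eqP->; rewrite ?s10 ?s12.
  case iin: (i \in [:: 10; 12]).
    by rewrite others //; move: iin; rewrite !inE => /orP[] /eqP->; rewrite ?s10 ?s12.
  move: iin; rewrite !inE => /norP[i10 i12].
  rewrite /st /upd (negPf i10) (negPf i12) subnn.
  by case: (eqVneq i 9) => [->|].
case: (ltngtP kr kq) => [lt|gt|eq].
- apply: (@ex_le _ _ ((kq - kr) * 2 + 1).+1); first by lia.
  apply: ex_If; rewrite st10 nonempty_nseq subn_gt0 lt.
  have := ex_clear 10 (st kr); rewrite st10 size_nseq; apply: ex_eq.
  apply: cleared => // i; rewrite !inE => /orP[] /eqP-> // _.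
  by rewrite st12 (_ : kr - kq = 0) //; lia.
- apply: (@ex_le _ _ ((kr - kq) * 2 + 1)); first by lia.
  have := ex_clear 12 (st kr); rewrite st12 size_nseq; apply: ex_eq.
  apply: cleared => // i; rewrite !inE => /orP[] /eqP-> // _.
  by rewrite st10 (_ : kq - kr = 0) //; lia.
- apply: (@ex_le _ _ t.+1); first by lia.
  apply: ex_If; rewrite st10 nonempty_nseq eq subnn /=.
  suff -> : st kq = s by [].
  rewrite -eq; have <- : upd (st kr) 10 [::] = st kr.
    apply: functional_extensionality => i; rewrite {1}/upd.
    by case: eqP => // ->; rewrite st10 eq subnn.
  apply: cleared => // i; rewrite !inE => /orP[] /eqP-> // _.
  by rewrite st12 eq subnn.
Qed.

(* At a leaf, this is the name of the parent. *)
Definition neighbour_sum (a : nat) (Es : seq (nat * nat)) : nat :=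
  \sum_(uv <- Es) ((uv.1 == a) * uv.2 + (uv.2 == a) * uv.1).

(** Registers 3 and 4 hold the names of two leaves, 5 and 6 their neighbour sums so far, 7 and 8 the
    ends of the current edge; 13 is scratch for [copy]. *)
Definition edge_body : cmd :=
  Seq (read_number 7) (Seq (read_number 8)
  (Seq (if_same_size 7 3 (copy 8 5 13)) (Seq (if_same_size 8 3 (copy 7 5 13))
  (Seq (if_same_size 7 4 (copy 8 6 13)) (Seq (if_same_size 8 4 (copy 7 6 13))
  (Seq (clear 7) (clear 8))))))).

Ltac regs_cases := apply: functional_extensionality;
  do 10 (case=> [|]; first by rewrite /upd /= ?cats0 -?nseqD);
  by move=> ?; rewrite /upd /=.

Section Check.
Variable x : seq bool.

Definition regs_state (w : seq bool) (l3 l4 l5 l6 l7 l8 l9 : nat) : stacks :=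
  fun i => match i with
  | 0 => w
  | 1 => x
  | 3 => nseq l3 true
  | 4 => nseq l4 true
  | 5 => nseq l5 true
  | 6 => nseq l6 true
  | 7 => nseq l7 true
  | 8 => nseq l8 true
  | 9 => nseq l9 true
  | _ => [::]
  end.

Lemma ex_add_if_same r q k l s N : r < 9 -> q < 9 -> k < 9 -> l < 9 -> k != l ->
  (forall i, 8 < i -> s i = [::]) ->
  size (s r) <= N -> size (s q) <= N -> size (s k) <= N ->
  ex (if_same_size r q (copy k l 13)) s (N * 52 + 22)
    (if size (s r) == size (s q) then upd s l (nseq (size (s k)) true ++ s l) else s).
Proof.
move=> r9 q9 k9 l9 kl s_gt le_r le_q le_k.
have exc : ex (copy k l 13) s (N * 12 + 2) (upd s l (nseq (size (s k)) true ++ s l)).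
  apply: ex_le (ex_copy kl _ _ _); [by lia | by lia | by lia | exact: s_gt].
by apply: ex_le (ex_if_same_size r9 q9 s_gt exc); lia.
Qed.

Lemma ex_edge_body N A B a b u v w : u <= N -> v <= N -> A <= N -> B <= N ->
  ex edge_body
    (regs_state (nseq u true ++ false :: nseq v true ++ false :: w) A B a b 0 0 0)
    (N * 300 + 200)
    (regs_state w A B ((v == A) * u + ((u == A) * v + a))
                      ((v == B) * u + ((u == B) * v + b)) 0 0 0).
Proof.
move=> le_u le_v le_A le_B.
apply: (@ex_le _ _ ((N * 4 + 2) + ((N * 4 + 2) + ((N * 52 + 22) +
  ((N * 52 + 22) + ((N * 52 + 22) + ((N * 52 + 22) +
  ((N * 2 + 1) + (N * 2 + 1))))))))); first by lia.
apply: (@ex_Seq _ _ _ (regs_state (nseq v true ++ false :: w) A B a b u 0 0)).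
  apply: ex_eq (ex_le _ (ex_read_number (k := u) (w := nseq v true ++ false :: w) _ _)) => //.
    by regs_cases.
  by lia.
apply: (@ex_Seq _ _ _ (regs_state w A B a b u v 0)).
  apply: ex_eq (ex_le _ (ex_read_number (k := v) (w := w) _ _)) => //.
    by regs_cases.
  by lia.
have gt8 a' b' i : 8 < i -> regs_state w A B a' b' u v 0 i = [::].
  by do 10 (case: i => [|i] //).
have step r q k l a' b' a'' b'' : r < 9 -> q < 9 -> k < 9 -> l < 9 -> k != l ->
    let s := regs_state w A B a' b' u v 0 in
    size (s r) <= N -> size (s q) <= N -> size (s k) <= N ->
    (if size (s r) == size (s q) then upd s l (nseq (size (s k)) true ++ s l) else s) =
      regs_state w A B a'' b'' u v 0 ->
    ex (if_same_size r q (copy k l 13)) s (N * 52 + 22) (regs_state w A B a'' b'' u v 0).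
  move=> r9 q9 k9 l9 kl s le_r le_q le_k <-.
  by apply: ex_add_if_same => //; apply: gt8.
apply: (@ex_Seq _ _ _ (regs_state w A B ((u == A) * v + a) b u v 0)).
  apply: step; rewrite //= ?size_nseq //.
  by case: eqP => _; rewrite ?mul0n ?mul1n //; regs_cases.
apply: (@ex_Seq _ _ _ (regs_state w A B ((v == A) * u + ((u == A) * v + a)) b u v 0)).
  apply: step; rewrite //= ?size_nseq //.
  by case: eqP => _; rewrite ?mul0n ?mul1n //; regs_cases.
set a2 := _ + _.
apply: (@ex_Seq _ _ _ (regs_state w A B a2 ((u == B) * v + b) u v 0)).
  apply: step; rewrite //= ?size_nseq //.
  by case: eqP => _; rewrite ?mul0n ?mul1n //; regs_cases.
apply: (@ex_Seq _ _ _ (regs_state w A B a2 ((v == B) * u + ((u == B) * v + b)) u v 0)).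
  apply: step; rewrite //= ?size_nseq //.
  by case: eqP => _; rewrite ?mul0n ?mul1n //; regs_cases.
set b2 := _ + _.
apply: (@ex_Seq _ _ _ (regs_state w A B a2 b2 0 v 0)).
  apply: ex_eq (ex_le _ (ex_clear _ _)); first by regs_cases.
  by rewrite /= size_nseq; lia.
apply: ex_eq (ex_le _ (ex_clear _ _)); first by regs_cases.
by rewrite /= size_nseq; lia.
Qed.

Lemma neighbour_sum_cons a u v Es :
  neighbour_sum a ((u, v) :: Es) = (u == a) * v + (v == a) * u + neighbour_sum a Es.
Proof. by rewrite /neighbour_sum big_cons. Qed.

Lemma ex_edge_loop N A B Es a b : A <= N -> B <= N ->
  all (fun uv => (uv.1 <= N) && (uv.2 <= N)) Es ->
  ex (While 0 nonempty edge_body)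
    (regs_state (encode (pair_names Es)) A B a b 0 0 0)
    (size Es * (N * 300 + 201) + 1)
    (regs_state [::] A B (neighbour_sum A Es + a) (neighbour_sum B Es + b) 0 0 0).
Proof.
move=> le_A le_B; elim: Es a b => [|[u v] Es IH] a b /=.
  by move=> _; rewrite /neighbour_sum !big_nil; apply: ex_While_done.
case/andP=> /andP[le_u le_v] /IH{}IH.
have -> : encode [:: u, v & pair_names Es] =
    nseq u true ++ false :: nseq v true ++ false :: encode (pair_names Es).
  by rewrite /encode /= !cat_rcons.
apply: (@ex_le _ _ ((N * 300 + 200) + (size Es * (N * 300 + 201) + 1)).+1).
  by rewrite mulSn; lia.
apply: ex_While_step (ex_edge_body _ _ _ le_u le_v le_A le_B) _.
  by case: (u).
apply: ex_eq (IH _ _).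
by rewrite !neighbour_sum_cons; congr regs_state; lia.
Qed.

Lemma ex_skip_loop N ns w A B : all (fun k => k <= N) ns ->
  ex (While 9 nonempty (Seq (Pop 9) skip_number))
    (regs_state (encode (ns ++ w)) A B 0 0 0 0 (size ns))
    (size ns * (N * 2 + 4) + 1)
    (regs_state (encode w) A B 0 0 0 0 0).
Proof.
elim: ns => [|k ns IH] /=; first by move=> _; apply: ex_While_done.
case/andP=> le_k /IH{}IH.
apply: (@ex_le _ _ ((1 + (N * 2 + 2)) + (size ns * (N * 2 + 4) + 1)).+1).
  by rewrite mulSn; lia.
apply: ex_While_step IH => //.
apply: (@ex_Seq _ _ _ (regs_state (encode (k :: ns ++ w)) A B 0 0 0 0 (size ns))).
  by apply: ex_eq (ex_Pop _ _); regs_cases.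
apply: ex_eq (ex_le _ (ex_skip_number (k := k) (w := encode (ns ++ w)) _)).
- by regs_cases.
- by lia.
- by rewrite /= /encode /= cat_rcons.
Qed.

End Check.

Lemma encode_cons k s : encode (k :: s) = nseq k true ++ false :: encode s.
Proof. by rewrite /encode /= cat_rcons. Qed.

Section CheckProgram.
Variables (M : machine) (p : {poly nat}).
Let nv := nvertex_pairs M p.

Lemma exec_check : exists c C, poly_bounded C /\
  forall x N (ks : seq nat) Es, size ks = (nv (size x)).*2 ->
  N <= (nv (size x)).*2.+2 -> all (fun k => k <= N) ks ->
  all (fun uv => (uv.1 <= N) && (uv.2 <= N)) Es -> size Es <= N * N ->
  exists2 s, ex c (upd (init_stacks x) 0 (encode (N :: ks ++ pair_names Es)))
                  (C (size x)) s &
    (s 0 != [::]) =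
      (neighbour_sum (nth 0 ks 0) Es == neighbour_sum (nth 0 ks 2) Es).
Proof.
(* The number of leaf names after the first three, [(nv n).*2 - 3], written without subtraction
   since adders offer sums and products only. *)
pose rest n := ((time_bound p n).+1 * width p n * block_size M).*2.+1.
have ad : adder 3 (fun r => rest (input_size r)).
  apply: adder_succ; apply: adder_double; apply: adder_mul (adder_const _ _).
  exact: adder_mul (adder_succ (adder_time_bound _ _)) (adder_width _ _).
case: ad => extr [cr [Cr [Vr [pCr pVr bVr exr]]]].
have pnv : poly_bounded nv.
  have [_ [_ [_ [V [_ pV bV _]]]]] := adder_nvertex_pairs M p (isT : 2 < 3).
  apply: poly_bounded_le pV _ => n.
  pose r i := if i == 1 then n else 0.
  rewrite (_ : n = input_size r); last by rewrite /input_size /r /= addn0.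
  by apply: bV => i _; rewrite /r; case: eqP => //; rewrite /input_size /= addn0.
(* The numbers skipped are the number of vertices of the tree and the name of leaf 1; those read are
   the names of leaves 0 and 2. *)
pose body := Seq skip_number (Seq (read_number 3) (Seq skip_number (Seq (read_number 4)
  (Seq (cr 9 10) (Seq (While 9 nonempty (Seq (Pop 9) skip_number))
  (Seq (While 0 nonempty edge_body) (if_same_size 5 6 (Push 0 true)))))))).
pose K n := nv n * 2 + 2.
exists body, (fun n => (K n * 2 + 2) + ((K n * 4 + 2) + ((K n * 2 + 2) + ((K n * 4 + 2) +
  (Cr n + ((K n * (K n * 2 + 4) + 1) + ((K n * K n * (K n * 300 + 201) + 1) +
  ((K n * K n * K n * 2) * 20 * 2 + 22)))))))).
split; first by rewrite /K; pbound.
move=> x N ks Es size_ks le_N le_ks le_Es size_Es.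
set n := size x in size_ks le_N *.
case: ks size_ks le_ks => [|A [|k1 [|B ks]]] //= size_ks; [by rewrite /nv /nvertex_pairs /nvars in size_ks; lia .. |].
case/and4P=> le_A le_k1 le_B le_ks.
have size_rest : size ks = rest n.
  by move: size_ks; rewrite /nv /nvertex_pairs /nvars /rest; lia.
have le_K : N <= K n by rewrite /K; lia.
set sA := neighbour_sum A Es; set sB := neighbour_sum B Es.
have sum_le a : neighbour_sum a Es <= size Es * (N + N).
  rewrite /neighbour_sum -[size Es * _]mulnC -iter_addn_0 -count_predT.
  rewrite -big_const_seq big_seq [X in _ <= X]big_seq; apply: leq_sum => uv uvE.
  have /andP[le1 le2] := allP le_Es _ uvE.
  by case: (_ == a); case: (_ == a); rewrite /= ?mul1n ?mul0n; lia.
have sum_K a : neighbour_sum a Es <= K n * K n * K n * 2.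
  apply: leq_trans (sum_le a) _; rewrite addnn -mul2n -mulnA.
  rewrite [2 * N]mulnC !mulnA leq_mul2r /=.
  by apply: leq_mul => //; apply: leq_trans size_Es _; apply: leq_mul.
exists (if sA == sB then upd (regs_state x [::] A B sA sB 0 0 0) 0 [:: true]
        else regs_state x [::] A B sA sB 0 0 0); last first.
  by case: (sA == sB).
have E0 w : upd (init_stacks x) 0 w = regs_state x w 0 0 0 0 0 0 0.
  apply: functional_extensionality; rewrite /init_stacks.
  by do 10 (case=> [|]; first by rewrite /upd /=); move=> ?; rewrite /upd /=.
rewrite E0 !encode_cons; set w := encode _.
pose st w' a b l9 := regs_state x w' a b 0 0 0 0 l9.
apply: (@ex_Seq _ _ _ (st (nseq A true ++ false :: nseq k1 true ++ false ::
                           nseq B true ++ false :: w) 0 0 0)).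
  apply: ex_eq (ex_le _ (ex_skip_number (k := N) (w := nseq A true ++ false ::
    nseq k1 true ++ false :: nseq B true ++ false :: w) _)) => //.
    by regs_cases.
  by lia.
apply: (@ex_Seq _ _ _ (st (nseq k1 true ++ false :: nseq B true ++ false :: w) A 0 0)).
  apply: ex_eq (ex_le _ (ex_read_number (k := A)
    (w := nseq k1 true ++ false :: nseq B true ++ false :: w) _ _)) => //.
    by regs_cases.
  by lia.
apply: (@ex_Seq _ _ _ (st (nseq B true ++ false :: w) A 0 0)).
  apply: ex_eq (ex_le _ (ex_skip_number (k := k1) (w := nseq B true ++ false :: w) _)) => //.
    by regs_cases.
  by lia.
apply: (@ex_Seq _ _ _ (st w A B 0)).
  apply: ex_eq (ex_le _ (ex_read_number (k := B) (w := w) _ _)) => //.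
    by regs_cases.
  by lia.
apply: (@ex_Seq _ _ _ (st w A B (size ks))).
  have -> : st w A B (size ks) = upd (st w A B 0) 9
      (nseq (rest (input_size (sizes (st w A B 0)))) true ++ st w A B 0 9).
    have -> : rest (input_size (sizes (st w A B 0))) = size ks.
      by rewrite size_rest /input_size /sizes /= addn0.
    by regs_cases.
  apply: exr => //.
    by do 10 (case=> [//|]).
  by case=> [|[|[|i]]].
apply: (@ex_Seq _ _ _ (st (encode (pair_names Es)) A B 0)).
  apply: ex_le (ex_skip_loop _ _ _ _ le_ks); rewrite leq_add2r.
  apply: leq_mul; last by lia.
  by move: size_ks; rewrite /K; lia.
apply: (@ex_Seq _ _ _ (regs_state x [::] A B sA sB 0 0 0)).
  apply: ex_le (ex_eq _ (ex_edge_loop x 0 0 le_A le_B le_Es)).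
    rewrite leq_add2r; apply: leq_mul; last by lia.
    by apply: leq_trans size_Es _; apply: leq_mul.
  by rewrite !addn0.
have exp := ex_Push (regs_state x [::] A B sA sB 0 0 0) 0 true.
have := ex_if_same_size (isT : 5 < 9) (isT : 6 < 9) _ exp.
rewrite {2 3 4 5}/regs_state !size_nseq => exi.
apply: ex_le (exi _); last by do 10 (case=> [//|]).
have := sum_K A; have := sum_K B; rewrite -/sA -/sB.
by set KK := K n * K n * K n * 2; lia.
Qed.

End CheckProgram.

(** * Parents read off the edge list of a tree *)

Definition named_edges n (T : rel 'I_n) : seq (nat * nat) :=
  [seq (val uv.1, val uv.2) | uv <- tree_edges T].

Lemma neighbour_sum_leaf n (T : rel 'I_n) (x : 'I_n) : is_tree T ->
  x \in leaves T -> neighbour_sum x (named_edges T) = parent T x.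
Proof.
move=> tree_T Lx; have Tx y := leaf_adj (T := T) y Lx; set p := parent T x in Tx *.
have [_ T_sym T_irr _ _] := tree_T.
have px : p != x.
  by apply/eqP=> E; have := T_irr x; rewrite Tx E eqxx.
have px' : (p != x :> nat) by rewrite val_eqE.
rewrite /neighbour_sum big_map big_filter big_enum_cond /=.
(* The only listed edge at the leaf [x], with its smaller end first. *)
pose q := if x < p then (x, p) else (p, x).
have qP : (q.1 < q.2) && T q.1 q.2.
  rewrite /q; case: (ltnP x p) => [lt|le] /=; first by rewrite lt Tx eqxx.
  by rewrite ltn_neqAle px' le T_sym Tx eqxx.
rewrite (bigD1 q) //= big1 ?addn0.
  rewrite /q; case: ifP => _ /=; rewrite eqxx (negPf px') mul1n mul0n;
  by rewrite ?addn0.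
move=> [u v] /= /andP[/andP[lt_uv Tuv] nq]; case: eqP => [ux|_]; last first.
  case: eqP => [vx|_] //; case/eqP: nq; move: Tuv lt_uv.
  rewrite (val_inj vx) T_sym Tx => /eqP-> lt; rewrite /q.
  by rewrite ltnNge ltnW.
case/eqP: nq; move: Tuv lt_uv; rewrite (val_inj ux) Tx => /eqP-> lt.
by rewrite /q lt.
Qed.

Lemma size_named_edges n (T : rel 'I_n) : size (named_edges T) <= n * n.
Proof.
rewrite size_map size_filter; apply: leq_trans (count_size _ _) _.
by rewrite -cardE card_prod card_ord.
Qed.

Lemma named_edges_lt n (T : rel 'I_n) :
  all (fun uv => (uv.1 <= n) && (uv.2 <= n)) (named_edges T).
Proof. by apply/allP=> _ /mapP[[u v] _ ->]; apply/andP; split; apply: ltnW (ltn_ord _). Qed.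

Lemma run_halted M x y t t' : t <= t' -> outcome no_oracle M x y t <> None ->
  outcome no_oracle M x y t' = outcome no_oracle M x y t.
Proof.
rewrite /outcome => le_t; case E: (verdict _) => [b|] // _.
by rewrite -(subnK le_t) iterD (iter_step_halted _ _ E).
Qed.

Theorem theorem6 : NP_hard minimum_routing_tree_length.
Proof.
move=> A [M [p [M_free halts AP]]].
have [c1 [C1 [pC1 ex1]]] := exec_instance M p.
have [c2 [C2 [pC2 ex2]]] := exec_check M p.
have [q le_q] : poly_bounded (fun n => C1 n + C2 n + 2) by pbound.
exists (oracle_machine c1 c2), q => O O_solves x.
pose n := size x; pose T := time_bound p n; pose P := cert_bound p n.
have AC : A x <-> certified M x T P.
  (* With a short certificate the machine halts before time [T], and its verdict then persists. *)
  have eqT y : size y <= P ->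
      outcome no_oracle M x y T = outcome no_oracle M x y p.[n + size y]%R.
    move=> le_y; apply: run_halted (halts x y).
    by apply: horner_nat_mono; rewrite leq_add2l.
  by split=> [/AP|] [y le_y acc]; [|apply/AP]; exists y => //; rewrite -acc;
    [rewrite -eqT | rewrite -[LHS]eqT].
pose m := nvertex_pairs M p n; pose ks := rules M x T P.
pose E := graph_edges (width p n) m (center (radius p n)) ks.
pose H := gadget_edges (width p n) (center (radius p n)) ks.
have m2 : 1 < m by [].
have ks_ok : all (rule_ok (width p n) T (center (radius p n))) ks by apply: rules_ok.
have E_ok : simple_pairs m.*2 E by apply: graph_edges_ok.
have H_ok : simple_pairs m.*2 H by apply: gadget_edges_ok.
have ltHW : size H < 2 + 6 * size ks by rewrite size_gadget_edges.
have sum_E := sum_graph_edges (width p n) m (center (radius p n)) ks.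
have [y solvable] := exists_solution m2 E_ok.
have sol : minimum_routing_tree_length (encode (instance m E)) (O (encode (instance m E))).
  by case: (O_solves (encode (instance m E))) => // -[no _]; case: (no y).
have [N [tr [f [spec EO]]]] := solutionP m2 E_ok H_ok ltHW sum_E sol.
have [tree_T le_N f_leaf f_mate opt] := spec.
have lt2 : 2 < m.*2 by rewrite (ltn_double 1 m).
have lt0 : 0 < m.*2 by apply: leq_trans lt2.
rewrite edge_namesE -/(named_edges tr) in EO.
have [|||||s ex_s s0] := ex2 x N [seq val (f u) | u <- iota 0 m.*2] (named_edges tr).
- by rewrite size_map size_iota.
- exact: le_N.
- by rewrite all_map; apply/allP=> u _ /=; apply: ltnW.
- exact: named_edges_lt.
- exact: size_named_edges.
rewrite !(nth_map 0) ?size_iota // !nth_iota // !add0n in s0.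
rewrite !neighbour_sum_leaf ?f_leaf // in s0.
rewrite -EO in ex_s.
have [n1 le1 exec1] := ex1 x; have [n2 le2 exec2] := ex_s.
have out : outcome O (oracle_machine c1 c2) x [::] q.[size x]%R = Some (sib tr f 0 2).
  have -> : sib tr f 0 2 = (s 0 != [::]) by rewrite s0.
  apply: outcome_oracle_machine exec1 _ _.
    by rewrite upd_upd; apply: exec2.
  by apply: leq_trans (le_q _); rewrite leq_add2r leq_add.
rewrite out; split=> //; apply: (iff_trans AC).
have opt_cut := optimal_cut M_free (x := x) (T := T) (P := P) f_mate (sib_refl tr f 0) opt.
by split=> [/opt_cut ->|[]] // /opt_cut.
Qed.
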